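(* Let $s\in(0,1)$, $\gamma\in(0,1]$, $n>2s$, let $\Omega\subset\mathbb{R}^n$ be a bounded domain, and let $\mathbb{G}$ be a Green kernel on $\Omega$ with Green operator $\mathcal{G}$ and heat semigroup $\mathcal{S}(t)$ as in the context. Assume: (1) $\mathbb{G}(x,y)=\mathbb{G}(y,x)\asymp |x-y|^{-(n-2s)}\left(\frac{\delta(x)\delta(y)}{|x-y|^2}\wedge 1\right)^{\gamma}$ for all $x\neq y$ in $\Omega$; (2) $\mathcal{G}:\delta^\gamma L^\infty(\Omega)\to\delta^\gamma C(\overline\Omega)$ is continuous; (3) for all $t\ge 0$, $0\le u_0\le 1$ implies $0\le \mathcal{S}(t)[u_0]\le 1$; (4) for every $\zeta\in\partial\Omega$ and $y\in\Omega$ the limit $D_\gamma\mathbb{G}(\zeta,y)=\lim_{x\to\zeta,\,x\in\Omega}\mathbb{G}(x,y)/\delta(x)^\gamma$ exists. Let $u_0\in L^1(\Omega,\delta^\gamma)$, and let $f(t,x)=f(x)\in L^1(\Omega,\delta^\gamma)$ and $h(t,\zeta)=h(\zeta)\in L^1(\partial\Omega)$ be time-independent. Then $$\mathcal{H}[u_0,f,h](t,\cdot)\to\mathcal{G}[f]+\mathcal{M}[h]\qquad\text{in }L^1(\Omega,\delta^\gamma)\text{ as }t\to+\infty.$$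
   Context: Notation: $\delta(x)=\mathrm{dist}(x,\Omega^c)$; $a\wedge b=\min(a,b)$; $\asymp$ means two-sided bounds by positive constants independent of $x,y$. $\mathbb{G}:\Omega\times\Omega\to[0,\infty]$ is a measurable kernel and $\mathcal{G}[f](x)=\int_\Omega\mathbb{G}(x,y)f(y)\,dy$. $L^1(\Omega,\delta^\gamma)=\{u\in L^1_{loc}(\Omega):\int_\Omega|u|\delta^\gamma<\infty\}$; $\delta^\gamma X=\{\delta^\gamma v:v\in X\}$ with norm $\|u\|_{\delta^\gamma X}=\|u/\delta^\gamma\|_X$; $d\zeta$ is surface measure on $\partial\Omega$. Standing eigen-decomposition: $\mathcal{G}$ is a compact, self-adjoint, injective, positive operator on $L^2(\Omega)$, and there is an orthonormal basis $(\varphi_k)_{k\ge1}$ of $L^2(\Omega)$ with $\mathcal{G}[\varphi_k]=\lambda_k^{-1}\varphi_k$, $0<\lambda_1<\lambda_2\le\lambda_3\le\cdots\to\infty$. The heat semigroup on $L^2(\Omega)$ is $\mathcal{S}(t)[u_0]=\sum_{k\ge1}e^{-\lambda_kt}\langle u_0,\varphi_k\rangle\varphi_k$, with $\langle\cdot,\cdot\rangle$ the $L^2(\Omega)$ inner product; it extends uniquely by continuity to $L^1(\Omega,\delta^\gamma)$. For $t>0$ its integral (heat) kernel is $\mathbb{S}(t,x,y)=\sum_{k\ge1}e^{-\lambda_kt}\varphi_k(x)\varphi_k(y)$ and $D_\gamma\mathbb{S}(t,\zeta,y)=\lim_{x\to\zeta,\,x\in\Omega}\mathbb{S}(t,x,y)/\delta(x)^\gamma$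 for $\zeta\in\partial\Omega$; both are well defined under the assumptions. Parabolic solution operator: $$\mathcal{H}[u_0,f,h](t,x)=\mathcal{S}(t)[u_0](x)+\int_0^t\mathcal{S}(t-\sigma)[f(\sigma,\cdot)](x)\,d\sigma+\int_0^t\int_{\partial\Omega}D_\gamma\mathbb{S}(t-\sigma,\zeta,x)\,h(\sigma,\zeta)\,d\zeta\,d\sigma .$$ Martin operator (the solution of the elliptic problem with singular boundary data $h$ and zero right-hand side): $\mathcal{M}[h](x)=\int_{\partial\Omega}D_\gamma\mathbb{G}(\zeta,x)\,h(\zeta)\,d\zeta$. *)

(* Defs.v *)
From HB Require Import structures.
From mathcomp Require Import all_boot all_order all_algebra.
From mathcomp Require Import all_classical all_reals all_analysis.
From mathcomp Require Import measurable_realfun.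
From mathcomp Require Import ring lra.
Set Implicit Arguments. Unset Strict Implicit. Unset Printing Implicit Defensive.
Import Order.TTheory GRing.Theory Num.Theory.
Import numFieldNormedType.Exports.
Local Open Scope classical_set_scope.
Local Open Scope ring_scope.

(* Matrices carry the Borel sigma-algebra of their topology. *)
Definition borel_rV_display : measure_display.
Proof. exact: default_measure_display. Qed.

Section borel.
Context {R : realType} {m n : nat}.
Let G := <<s (@open 'M[R]_(m, n)) >>.
Let G0 : G set0. Proof. exact: sigma_algebra0. Qed.
Let GC A : G A -> G (~` A). Proof. exact: sigma_algebraC. Qed.
Let GU (F : _^nat) : (forall i, G (F i)) -> G (\bigcup_i F i).
Proof. exact: sigma_algebra_bigcup. Qed.

HB.instance Definition _ :=
  @isMeasurable.Build borel_rV_display 'M[R]_(m, n) G G0 GC GU.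

Lemma open_measurable_mx (A : set 'M[R]_(m, n)) : open A -> measurable A.
Proof. by move=> oA; exact: sub_sigma_algebra. Qed.
End borel.

Section lebesgue.
Context {R : realType}.

Definition cons_rV (n : nat) (p : R * 'rV[R]_n) : 'rV[R]_n.+1 :=
  row_mx p.1%:M p.2.
Arguments cons_rV : clear implicits.


Let lshift0E n : @lshift 1 n ord0 = ord0 :> 'I_n.+1.
Proof. exact/val_inj. Qed.

Let ratball n (qk : 'rV[rat]_n * nat) : set 'rV[R]_n :=
  ball (map_mx ratr qk.1 : 'rV[R]_n) qk.2.+1%:R^-1.

Let open_bigcup_ratball n (U : set 'rV[R]_n) : open U ->
  U = \bigcup_(qk in [set qk | ratball qk `<=` U]) ratball qk.
Proof.
move=> oU; apply/seteqP; split => [x Ux|x [qk qkU qx]]; last exact: qkU.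
have /nbhs_ballP[e /= e0 xeU] := open_nbhs_nbhs (conj oU Ux).
have [k ke] : exists k : nat, k.+1%:R^-1 < e / 2.
  have [k _ kP] := near_infty_natSinv_lt (PosNum (divr_gt0 e0 (ltr0Sn R 1))).
  by exists k; apply: (kP k) => /=.
have k0 : (0 : R) < k.+1%:R^-1 by rewrite invr_gt0.
have h i : exists q : rat, `|x ord0 i - ratr q| < k.+1%:R^-1.
  have [|q] := @rat_in_itvoo R (x ord0 i - k.+1%:R^-1) (x ord0 i + k.+1%:R^-1).
    by rewrite ltrD2l gtrN.
  by rewrite in_itv/= => qP; exists q; rewrite distrC ltr_distl.
have [q qP] := choice h.
have bq : ratball (\row_i q i, k) x.
  by split => // i j; rewrite !mxE ord1 /ball/= distrC; exact: qP.
exists (\row_i q i, k) => //= y qy; apply: xeU.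
by apply: (@ball_splitr _ _ (map_mx ratr (\row_i q i) : 'rV[R]_n));
  apply: le_ball (ltW ke) _ _.
Qed.

Lemma measurable_cons_rV n : measurable_fun setT (cons_rV n).
Proof.
apply: (measurability (@open 'rV[R]_n.+1)) => // _ [U oU <-].
rewrite setTI (open_bigcup_ratball oU) preimage_bigcup.
rewrite bigcup_mkcond; apply: countable_bigcupT_measurable => [|[q k]].
  exact: countableP.
case: ifP => _; last exact: measurable0.
rewrite [X in measurable X](_ : _ =
    (ball (ratr (q ord0 ord0) : R) k.+1%:R^-1) `*`
    (ball (\row_j ratr (q ord0 (rshift 1 j)) : 'rV[R]_n) k.+1%:R^-1)).
  apply: measurableX; first exact: (open_measurable (ball_open _ _)).
  exact: open_measurable_mx (ball_open _ _).
have k0 : (0 : R) < k.+1%:R^-1 by rewrite invr_gt0.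
apply/seteqP; split => -[x v] /=.
  move=> [_ h]; split.
    have := h ord0 (@lshift 1 n ord0).
    by rewrite mxE/= /cons_rV (@row_mxEl _ 1 1 n) mxE/= lshift0E.
  split => // i j; have := h ord0 (rshift 1 j).
  by rewrite mxE/= /cons_rV (@row_mxEr _ 1 1 n) mxE/= !ord1.
move=> [hx [_ hv]]; split => // i j; rewrite ord1 /cons_rV.
case: (@split_ordP 1 n j) => {}j ->.
  by rewrite (@row_mxEl _ 1 1 n) !mxE/= ord1 lshift0E.
by have := hv ord0 j; rewrite (@row_mxEr _ 1 1 n) !mxE.
Qed.

Definition uncons_rV n (v : 'rV[R]_n.+1) : R * 'rV[R]_n :=
  (v ord0 ord0, rsubmx (v : 'rV[R]_(1 + n))).

Lemma cons_rVK n : cancel (cons_rV n) (@uncons_rV n).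
Proof.
move=> [x v]; rewrite /uncons_rV /cons_rV row_mxKr; congr pair.
by rewrite -(lshift0E n) (@row_mxEl _ 1 1 n) mxE.
Qed.

Lemma measurable_uncons_rV n : measurable_fun setT (@uncons_rV n).
Proof.
apply/measurable_fun_pair.
  apply: (measurability _ (@RGenOpens.measurableE R)) => _ [_ [a [b ->]] <-].
  rewrite setTI; apply: open_measurable_mx.
  by apply: open_comp => // v _; exact: coord_continuous.
apply: (measurability (@open 'rV[R]_n)) => // _ [U oU <-].
rewrite setTI; apply: open_measurable_mx; apply: open_comp => // v _ A /=.
move=> /nbhs_ballP[e e0 eA]; apply/nbhs_ballP; exists e => // w [_ vw].
by apply: eA; split => // i j; rewrite !mxE; exact: vw.
Qed.

Section lebesgue_step.
Variables (n : nat) (m : {sigma_finite_measure set 'rV[R]_n -> \bar R}).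
Local Open Scope ereal_scope.

Definition lebesgue_step : set 'rV[R]_n.+1 -> \bar R :=
  pushforward (@lebesgue_measure R \x m) (cons_rV n).

Let mmap : {measure set 'rV[R]_n.+1 -> \bar R} :=
  measure_function_pushforward__canonical__measure_function_Measure
    (@lebesgue_measure R \x m)%E (@measurable_cons_rV n).

HB.instance Definition _ := isMeasure.Build _ _ _ lebesgue_step
  (measure0 mmap) (measure_ge0 mmap) (@measure_semi_sigma_additive _ _ _ mmap).

Let sigma_finite_step : sigma_finite setT lebesgue_step.
Proof.
have /sigma_finiteP[F [FT ndF mF]] := sigma_finiteT (@lebesgue_measure R).
have /sigma_finiteP[G [GT ndG mG]] := sigma_finiteT m.
exists (fun k => @uncons_rV n @^-1` (F k `*` G k)).
  apply/seteqP; split => // v _.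
  have [i _ Fi] : (\bigcup_i F i) (uncons_rV v).1 by rewrite -FT.
  have [j _ Gj] : (\bigcup_i G i) (uncons_rV v).2 by rewrite -GT.
  exists (maxn i j) => //; split.
    by have /subsetPset := ndF _ _ (leq_maxl i j); apply.
  by have /subsetPset := ndG _ _ (leq_maxr i j); apply.
move=> k; have [mFk Fk] := mF k; have [mGk Gk] := mG k; split.
  rewrite -[X in measurable X]setTI; apply: measurable_uncons_rV => //.
  exact: measurableX.
rewrite /lebesgue_step /pushforward -comp_preimage.
rewrite (_ : _ \o _ = id) ?preimage_id; last first.
  by apply/funext => p /=; exact: cons_rVK.
by rewrite product_measure1E// lte_mul_pinfty// ge0_fin_numE.
Qed.

HB.instance Definition _ := Measure_isSigmaFinite.Build _ _ _ lebesgue_step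
  sigma_finite_step.
End lebesgue_step.

Fixpoint lebesgue_rV n : {sigma_finite_measure set 'rV[R]_n -> \bar R} :=
  if n is n'.+1 then lebesgue_step (lebesgue_rV n') else @dirac _ 'rV[R]_0 0 R.

End lebesgue.
Arguments lebesgue_rV R n : clear implicits.

Section euclidean.
Context {R : realType} {n : nat}.
Implicit Types (x y : 'rV[R]_n) (A : set 'rV[R]_n).

(* The library norm of 'rV[R]_n is the sup norm, so the Euclidean one is needed
   separately. *)
Definition enorm x : R := Num.sqrt (\sum_(i < n) x ord0 i ^+ 2).

Definition ediam A : \bar R :=
  ereal_sup [set (enorm (p.1 - p.2))%:E | p in A `*` A].

Lemma norm_le_enorm x : `|x| <= enorm x.
Proof.
rewrite [`|x|]mx_normrE; apply: bigmax_le => [|[i j] _]; first exact: sqrtr_ge0.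
rewrite -sqrtr_sqr ler_wsqrtr// ord1 (bigD1 j)//= lerDl.
by apply: sumr_ge0 => k _; exact: sqr_ge0.
Qed.

End euclidean.

Section hausdorff.
Context {R : realType} {n : nat}.
Implicit Types (A B : set 'rV[R]_n).
Local Open Scope ereal_scope.

(* Hausdorff measure is normalised so that in dimension d it agrees with the
   d-dimensional volume (counting measure for d = 0). Sets of diameter > e get
   weight +oo, so that only covers by sets of diameter at most e contribute. *)
Definition unit_ball_volume (d : nat) : \bar R :=
  lebesgue_rV R d [set x | (enorm x <= 1)%R].

Definition hausdorff_gauge (d : nat) (e : R) A : \bar R :=
  if asbool (A = set0) then 0
  else if ediam A <= e%:E then
    unit_ball_volume d * (ediam A * (2^-1)%:E) ^+ d
  else +oo.

Definition hausdorff_content (d : nat) (e : R) A : \bar R :=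
  ereal_inf [set \sum_(k <oo) hausdorff_gauge d e (F k)
            | F in [set F : (set 'rV[R]_n)^nat | A `<=` \bigcup_k F k]].

Definition hausdorff (d : nat) A : \bar R :=
  ereal_sup [set hausdorff_content d e A | e in [set e : R | (0 < e)%R]].
End hausdorff.

Section metric_outer_measure.
Context {R : realType} {n : nat} (mu : {outer_measure set 'rV[R]_n -> \bar R}).
Local Open Scope ereal_scope.
Hypothesis mu_metric : forall (A B : set 'rV[R]_n) (e : R), (0 < e)%R ->
  (forall x y, A x -> B y -> (e <= `|x - y|)%R) -> mu A + mu B <= mu (A `|` B).

Let caratheodory_closed (C : set 'rV[R]_n) : closed C -> mu.-caratheodory C.
Proof.
move=> cC; apply: le_caratheodory_measurable => X.
pose e j : R := (j.+1%:R^-1)%R.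
have e0 j : (0 < e j)%R by rewrite invr_gt0.
have elt i j : (i < j)%N -> (0 < e i - e j)%R.
  by move=> ij; rewrite subr_gt0 ltf_pV2 ?posrE// ltr_nat.
pose A j := [set x | X x /\ forall c, C c -> (e j <= `|x - c|)%R].
have A_ndec i j : (i <= j)%N -> A i `<=` A j.
  move=> ij x [Xx xC]; split => // c Cc; apply: le_trans (xC c Cc).
  by rewrite lef_pV2 ?posrE// ler_nat.
have AX j : A j `<=` X by move=> x [].
have AXC j : A j `<=` X `&` ~` C.
  by move=> x [Xx xC]; split => // /xC; rewrite subrr normr0 leNgt e0.
have sepA i j x y : (i < j)%N -> A i x -> X y -> ~ A j y ->
    (e i - e j <= `|x - y|)%R.
  move=> ij [_ Aix] Xy nAjy.
  have [c [Cc yc]] : exists c, C c /\ (`|y - c| < e j)%R.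
    apply: contrapT => /forallNP h; apply: nAjy; split => // c Cc.
    by rewrite leNgt; apply/negP => yc; exact: (h c).
  rewrite lerBlDr (le_trans (Aix c Cc))//.
  by rewrite (le_trans (ler_distD y _ _))// lerD2l ltW.
have XC_A : X `&` ~` C = \bigcup_j A j.
  apply/seteqP; split => [x [Xx nCx]|x [j _ /AXC]//].
  have : nbhs x (~` C) by apply: open_nbhs_nbhs; split => //; exact: closed_openC.
  move=> /nbhs_ballP[r /= r0 xr].
  have [j _ jr] := near_infty_natSinv_lt (PosNum r0).
  exists j => //; split => // c Cc; rewrite leNgt; apply/negP => xc.
  apply: (xr c) => //; rewrite mx_norm_ball /ball_/=.
  by rewrite (lt_trans xc)//; exact: (jr j (leqnn j)).
have [->|Xfin] := eqVneq (mu X) +oo; first exact: leey.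
have ge0 := outer_measure_ge0 mu.
have finS B : B `<=` X -> mu B \is a fin_num.
  move=> BX; rewrite ge0_fin_numE// (le_lt_trans (le_outer_measure mu _ _ BX))//.
  by rewrite ltey.
pose a j := fine (mu (A j)).
have aE j : mu (A j) = (a j)%:E by rewrite fineK// finS.
have a_ndec : nondecreasing_seq a.
  by move=> i j ij; rewrite -lee_fin -!aE; exact/le_outer_measure/A_ndec.
have XCa j : mu (X `&` C) + (a j)%:E <= mu X.
  rewrite -aE addeC; apply: le_trans (mu_metric (e0 j) _) _.
    by move=> x y [_ xC] [_ /xC].
  by apply: le_outer_measure => x [/AX//|[]].
have Cfin : mu (X `&` C) \is a fin_num by apply: finS => x [].
have a_ub : has_ubound (range a).
  exists (fine (mu X)) => _ [j _ <-]; rewrite -lee_fin (fineK (finS _ (@subset_refl _ X))).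
  by apply: le_trans (XCa j); rewrite leeDr.
pose L := sup (range a).
have aL j : (a j <= L)%R by apply: ub_le_sup => //; exists j.
have cva : a @ \oo --> L by exact: nondecreasing_cvgn.
have CL : mu (X `&` C) + L%:E <= mu X.
  rewrite -leeBrDl// -(fineK Cfin) -(fineK (finS _ (@subset_refl _ X))).
  rewrite -EFinB lee_fin; apply: sup_le_ub; first by exists (a 0%N), 0%N.
  move=> _ [j _ <-]; rewrite -lee_fin EFinB (fineK Cfin) (fineK (finS _ (@subset_refl _ X))).
  by rewrite leeBrDl.
apply: le_trans CL; rewrite leeD2lE//.
pose B j := A j.+1 `\` A j.
have BX j : B j `<=` X by move=> x [/AX].
pose b j := fine (mu (B j)).
have bE j : mu (B j) = (b j)%:E by rewrite fineK// finS.
have b0 j : (0 <= b j)%R by rewrite -lee_fin -bE.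
have bA j : (b j.+1 <= a j.+2 - a j)%R.
  rewrite lerBrDl -lee_fin EFinD -!aE -bE.
  have := @mu_metric (A j) (B j.+1) (e j - e j.+1)%R (elt _ _ (ltnSn j)).
  move=> /(_ _)/le_trans; apply.
    by move=> x y Ajx [/AX Xy nAy]; exact: sepA.
  by apply: le_outer_measure => x [|[]//]; exact/A_ndec/leqW/leqnSn.
have sumb N k : (\sum_(N <= j < N + k) b j.+1 <= L + L - a N - a N.+1)%R.
  suff h : (\sum_(N <= j < N + k) b j.+1 <=
      a (N + k).+1 + a (N + k)%N - a N - a N.+1)%R.
    by apply: le_trans h _; rewrite !lerD2r lerD.
  elim: k => [|k ih].
    by rewrite !addn0 big_geq// addrK subrr.
  rewrite !addnS big_nat_recr ?leq_addr//=.
  apply: le_trans (lerD ih (bA _)) _.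
  rewrite le_eqVlt; apply/orP; left; apply/eqP.
  set x := a _; set y := a _; set z := a N; set w := a _; set v := a _.
  ring.
have main N : mu (X `&` ~` C) <= (L + (L + L - a N - a N.+1))%:E.
  pose F k := if k is k'.+1 then B (N + k').+1 else A N.+1.
  have : X `&` ~` C `<=` \bigcup_k F k.
    rewrite XC_A => x [j _].
    elim: j => [A0|j ih Aj].
      by exists 0%N => //=; exact: A_ndec A0.
    have [/ih//|nAj] := pselect (A j x).
    have [jN|Nj] := leqP j N; first by exists 0%N => //; apply: A_ndec Aj.
    exists (j - N.+1).+1 => //=.
    by rewrite (_ : (N + (j - N.+1)).+1 = j)// -addSn subnKC.
  move=> /(le_outer_measure mu)/le_trans; apply.
  apply: le_trans (outer_measure_sigma_subadditive mu F) _.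
  apply: lime_le; first by apply: is_cvg_nneseries => *.
  apply: nearW => -[|k].
    rewrite big_geq// lee_fin; have := sumb N 0%N; rewrite addn0 big_geq//.
    have := aL 0%N; have : (0 <= a 0%N)%R by rewrite -lee_fin -aE.
    by move=> ? ? ?; rewrite addr_ge0//; apply: le_trans (aL 0%N).
  rewrite big_nat_recl//= aE EFinD; apply: leeD; first by rewrite lee_fin.
  under eq_bigr do rewrite bE.
  rewrite sumEFin lee_fin; apply: le_trans (sumb N k).
  rewrite -{2}[N]add0n (big_addn 0 (N + k)%N N xpredT) addKn.
  by under [leRHS]eq_bigr do rewrite addnC.
have cv : (fun N => (L + (L + L - a N - a N.+1))%:E) @ \oo --> (L + (L + L - L - L))%:E.
  apply: cvg_EFin; first exact: nearW.
  apply: cvgD; first exact: cvg_cst.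
  apply: cvgB; last by rewrite (cvg_shiftS a).
  by apply: cvgB => //; exact: cvg_cst.
rewrite (_ : L%:E = (L + (L + L - L - L))%:E); last by congr EFin; ring.
rewrite -(cvg_lim _ cv)//; apply: lime_ge; first by apply/cvg_ex; eexists; exact: cv.
exact: nearW.
Qed.

Lemma metric_outer_measure_caratheodory (A : set 'rV[R]_n) :
  measurable A -> mu.-caratheodory A.
Proof.
suff : measurable `<=` (mu.-cara.-measurable : set (set 'rV[R]_n)) by exact.
apply: smallest_sub; first exact: sigma_algebra_measurable.
move=> U oU; rewrite -(setCK U).
by apply: caratheodory_measurable_setC; apply: caratheodory_closed; exact: open_closedC.
Qed.
End metric_outer_measure.

Section hausdorff_measure.
Context {R : realType} {n : nat} (d : nat).
Implicit Types (A B : set 'rV[R]_n) (e : R).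
Local Open Scope ereal_scope.
Local Notation gauge := (@hausdorff_gauge R n d).
Local Notation content := (@hausdorff_content R n d).
Local Notation haus := (@hausdorff R n d).

Let discrete := g_sigma_algebraType [set: set 'rV[R]_n].

Let contentE e A :
  content e A = mu_ext (gauge e : set discrete -> \bar R) A.
Proof.
congr ereal_inf; apply/seteqP; split => _ [F AF <-]; exists F => //.
  by split => // i; exact: sub_sigma_algebra.
by case: AF.
Qed.

Let gauge0 e : gauge e set0 = 0.
Proof. by rewrite /hausdorff_gauge; case: asboolP. Qed.

Let gauge_ge0 e A : 0 <= gauge e A.
Proof.
rewrite /hausdorff_gauge; case: asboolP => // /eqP/set0P[x Ax].
case: ifPn => // _; apply: mule_ge0; first exact: measure_ge0.
apply: expe_ge0; apply: mule_ge0; last by rewrite lee_fin.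
apply: le_trans (ereal_sup_ubound _) => /=; last by exists (x, x).
by rewrite lee_fin sqrtr_ge0.
Qed.

Let content_ge0 e A : 0 <= content e A.
Proof. by rewrite contentE; apply: mu_ext_ge0 => X; exact: gauge_ge0. Qed.

Let le_content e A : (0 < e)%R -> content e A <= haus A.
Proof. by move=> e0; apply: ereal_sup_ubound; exists e. Qed.

Let haus0 : haus set0 = 0.
Proof.
apply/eqP; rewrite eq_le; apply/andP; split.
  apply: ge_ereal_sup => _ [e _ <-]; by rewrite contentE mu_ext0.
exact: le_trans (content_ge0 1%R _) (le_content _ ltr01).
Qed.

Let haus_ge0 A : 0 <= haus A.
Proof. exact: le_trans (content_ge0 1%R _) (le_content _ ltr01). Qed.

Let le_haus : {homo haus : A B / A `<=` B >-> A <= B}.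
Proof.
move=> A B AB; apply: ge_ereal_sup => _ [e e0 <-].
apply: le_trans (le_content _ e0); rewrite !contentE.
exact: le_mu_ext.
Qed.

Let haus_sigma_subadditive : sigma_subadditive haus.
Proof.
move=> F; apply: ge_ereal_sup => _ [e e0 <-]; rewrite contentE.
have := @mu_ext_sigma_subadditive _ discrete R (gauge e) (gauge_ge0 e) F.
move=> /le_trans; apply.
apply: lee_nneseries => k _; rewrite -contentE//.
exact: le_content.
Qed.

HB.instance Definition _ := isOuterMeasure.Build R 'rV[R]_n haus
  haus0 haus_ge0 le_haus haus_sigma_subadditive.

Let haus_metric A B (r : R) : (0 < r)%R ->
  (forall x y, A x -> B y -> (r <= `|x - y|)%R) ->
  haus A + haus B <= haus (A `|` B).
Proof.
move=> r0 AB.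
have le_gauge e s X : (e <= s)%R -> gauge s X <= gauge e X.
  move=> es; rewrite /hausdorff_gauge; case: asboolP => // _.
  have [Xe|_] := boolP (ediam X <= e%:E); last by rewrite leey.
  by rewrite (le_trans Xe) ?lee_fin.
have le_content_e e s X : (e <= s)%R -> content s X <= content e X.
  move=> es; apply: le_ereal_inf_tmp => _ [F XF <-].
  apply: ge_ereal_inf; exists (\sum_(k <oo) gauge s (F k)); first by exists F.
  by apply: lee_nneseries => // k _; exact: le_gauge.
have split_content e : (0 < e < r)%R ->
    content e A + content e B <= content e (A `|` B).
  move=> /andP[e0 er]; apply: le_ereal_inf_tmp => _ [F ABF <-].
  pose F_ X k := if asbool (F k `&` X !=set0) then F k else set0.
  have F_cover X : X `<=` A `|` B -> X `<=` \bigcup_k F_ X k.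
    move=> XAB x Xx; have [k _ Fkx] := ABF _ (XAB _ Xx).
    by exists k => //; rewrite /F_; case: asboolP => // -[]; exists x.
  apply: (@le_trans _ _ (\sum_(k <oo) gauge e (F_ A k) +
                         \sum_(k <oo) gauge e (F_ B k))).
    apply: leeD; apply: ereal_inf_lbound => /=.
      by exists (F_ A) => //; apply: F_cover => x; left.
    by exists (F_ B) => //; apply: F_cover => x; right.
  rewrite -nneseriesD => [|k _ _|k _ _]; [|exact: gauge_ge0..].
  apply: lee_nneseries => [k _ _|k _]; first by apply: adde_ge0; exact: gauge_ge0.
  rewrite /F_; case: asboolP => [[x [Fx Ax]]|_]; last first.
    by case: ifPn => _; rewrite ?gauge0 ?add0e// ?gauge_ge0.
  case: asboolP => [[y [Fy By]]|_]; last by rewrite gauge0 adde0.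
  rewrite /hausdorff_gauge; case: asboolP => [F0|_]; first by rewrite F0 in Fx.
  rewrite ifF ?leey//; apply/negbTE; rewrite -ltNge.
  apply: (@lt_le_trans _ _ (enorm (x - y))%:E).
    by rewrite lte_fin (lt_le_trans er)// (le_trans (AB _ _ Ax By))// norm_le_enorm.
  by apply: ereal_sup_ubound; exists (x, y).
have [->|Afin] := eqVneq (haus (A `|` B)) +oo; first exact: leey.
have finS X : X `<=` A `|` B -> haus X \is a fin_num.
  move=> /le_haus XAB; rewrite ge0_fin_numE//.
  by rewrite (le_lt_trans XAB)// ltey.
have fA : haus A \is a fin_num by apply: finS => x; left.
have fB : haus B \is a fin_num by apply: finS => x; right.
apply/lee_addgt0Pr => t t0.
have t2 : (0 < t / 2)%R by rewrite divr_gt0.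
have [_ [a a0 <-] Aa] := ub_ereal_sup_adherent t2 fA.
have [_ [b b0 <-] Bb] := ub_ereal_sup_adherent t2 fB.
pose e : R := (Num.min (r / 2) (Num.min a b))%R.
have e0 : (0 < e)%R by rewrite !lt_min a0 b0 divr_gt0.
have er : (0 < e < r)%R.
  by rewrite e0/= /e gt_min (_ : r / 2 < r)%R//; lra.
have ea : (e <= a)%R by rewrite !ge_min lexx !orbT.
have eb : (e <= b)%R by rewrite !ge_min lexx !orbT.
have hA : haus A <= content e A + (t / 2)%:E.
  by rewrite -leeBlDr// ltW// (lt_le_trans Aa)// le_content_e.
have hB : haus B <= content e B + (t / 2)%:E.
  by rewrite -leeBlDr// ltW// (lt_le_trans Bb)// le_content_e.
apply: le_trans (leeD hA hB) _.
rewrite addeACA -EFinD -splitr leeD2rE//.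
exact: le_trans (split_content _ er) (le_content _ e0).
Qed.

Let haus_measurable A : measurable A -> haus.-caratheodory A.
Proof. exact: (metric_outer_measure_caratheodory haus_metric). Qed.

Let haus_sigma_additive : semi_sigma_additive haus.
Proof.
move=> F mF tF mUF.
apply: (@caratheodory_measure_sigma_additive R 'rV[R]_n haus F) => //.
- by move=> i; exact: haus_measurable.
- exact: haus_measurable.
Qed.

HB.instance Definition _ := isMeasure.Build _ _ _ haus
  haus0 haus_ge0 haus_sigma_additive.

End hausdorff_measure.

Section domains.
Context {R : realType} {n : nat}.
Implicit Types (Omega : set 'rV[R]_n) (x y z : 'rV[R]_n).

Definition bounded_domain Omega :=
  [/\ open Omega, connected Omega, Omega !=set0 & bounded_set Omega].

Definition frontier Omega := closure Omega `\` Omega^°.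

Definition delta Omega x : R := inf [set enorm (x - y) | y in ~` Omega].

Definition surface_measure : {measure set 'rV[R]_n -> \bar R} :=
  hausdorff n.-1.

(* boundary_trace is D_gamma: the limit of k / delta^gamma at the boundary point
   z along points of Omega. *)
Definition boundary_filter Omega z : set_system 'rV[R]_n :=
  within Omega (nbhs z).

Definition boundary_quotient Omega (gamma : R) (k : 'rV[R]_n -> R) x : R :=
  k x / delta Omega x `^ gamma.

Definition boundary_trace Omega gamma (k : 'rV[R]_n -> R) z : R :=
  lim (boundary_quotient Omega gamma k x @[x --> boundary_filter Omega z]).

End domains.

(* Functions on Omega are total functions on R^n, and only their values on Omega
   matter. *)
Section function_spaces.
Context {R : realType} {n : nat} (Omega : set 'rV[R]_n) (gamma : R).
Implicit Types (u v : 'rV[R]_n -> R).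
Local Notation leb := (lebesgue_rV R n).
Local Notation dg x := (delta Omega x `^ gamma).
Local Notation Lp_norm p u := (Lnorm leb p (EFin \o (u \_ Omega))).

Definition inner u v : R := \int[leb]_(x in Omega) (u x * v x).

Definition inL2 u := u \_ Omega \in Lfun leb 2%:E.
Definition normL2 u : \bar R := Lp_norm 2%:E u.

Definition inL1w u :=
  (forall K, compact K -> K `<=` Omega -> leb.-integrable K (EFin \o u)) /\
  (fun x => u x * dg x) \_ Omega \in Lfun leb 1.
Definition normL1w u : \bar R := Lp_norm 1 (fun x => u x * dg x).

Definition inLinfw u := (fun x => u x / dg x) \_ Omega \in Lfun leb +oo%E.
Definition normLinfw u : \bar R := Lp_norm +oo%E (fun x => u x / dg x).

Definition inCw u := exists2 v : 'rV[R]_n -> R,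
  {within closure Omega, continuous v} &
  forall x, Omega x -> u x = dg x * v x.
(* The supremum over Omega equals the one over its closure, by continuity. *)
Definition normCw u : \bar R :=
  ereal_sup [set (`|u x / dg x|)%:E | x in Omega].

Definition continuous_operator
    (X : ('rV[R]_n -> R) -> Prop) (normX : ('rV[R]_n -> R) -> \bar R)
    (Y : ('rV[R]_n -> R) -> Prop) (normY : ('rV[R]_n -> R) -> \bar R)
    (T : ('rV[R]_n -> R) -> 'rV[R]_n -> R) :=
  (forall u, X u -> Y (T u)) /\
  forall (u_ : nat -> 'rV[R]_n -> R) u, (forall j, X (u_ j)) -> X u ->
    normX (u_ j - u) @[j --> \oo] --> 0%E ->
    normY (T (u_ j) - T u) @[j --> \oo] --> 0%E.

Definition cvgL1w (F : R -> 'rV[R]_n -> R) (g : 'rV[R]_n -> R) :=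
  [/\ inL1w g,
      \forall t \near +oo, inL1w (F t) &
      normL1w (F t - g) @[t --> +oo] --> 0%E].

End function_spaces.

Section green_operator.
Context {R : realType} {n : nat} (Omega : set 'rV[R]_n) (gamma : R).
Context (G : 'rV[R]_n -> 'rV[R]_n -> \bar R).
Implicit Types (u v : 'rV[R]_n -> R).
Local Notation leb := (lebesgue_rV R n).

Definition nonneg_kernel :=
  measurable_fun (Omega `*` Omega) (fun p => G p.1 p.2) /\
  forall x y, Omega x -> Omega y -> (0 <= G x y)%E.

Definition green u : 'rV[R]_n -> R :=
  fun x => fine (\int[leb]_(y in Omega) (G x y * (u y)%:E))%E.

Definition green_trace z x : R :=
  boundary_trace Omega gamma (fun x' => fine (G x' x)) z.

Definition martin (h : 'rV[R]_n -> R) : 'rV[R]_n -> R :=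
  fun x => \int[surface_measure]_(z in frontier Omega) (green_trace z x * h z).

Definition comparison_kernel (s : R) x y : R :=
  enorm (x - y) `^ (- (n%:R - 2 * s)) *
  Num.min (delta Omega x * delta Omega y / enorm (x - y) ^+ 2) 1 `^ gamma.

Definition compactL2 := forall u_ : nat -> 'rV[R]_n -> R,
  (forall j, inL2 Omega (u_ j)) ->
  (exists M : R, forall j, (normL2 Omega (u_ j) <= M%:E)%E) ->
  exists g : nat -> nat, {homo g : i j / (i < j)%N} /\
    exists2 v, inL2 Omega v &
      normL2 Omega (green (u_ (g j)) - v) @[j --> \oo] --> 0%E.

Definition selfadjointL2 := forall u v, inL2 Omega u -> inL2 Omega v ->
  inner Omega (green u) v = inner Omega u (green v).

Definition injectiveL2 := forall u v, inL2 Omega u -> inL2 Omega v ->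
  {ae leb, forall x, Omega x -> green u x = green v x} ->
  {ae leb, forall x, Omega x -> u x = v x}.

Definition positiveL2 := forall u, inL2 Omega u -> 0 <= inner Omega (green u) u.

Definition green_operatorL2 :=
  [/\ forall u, inL2 Omega u -> inL2 Omega (green u),
      compactL2, selfadjointL2, injectiveL2 & positiveL2].

Definition orthonormal_basis (phi : nat -> 'rV[R]_n -> R) :=
  [/\ forall k, inL2 Omega (phi k),
      forall j k, inner Omega (phi j) (phi k) = (j == k)%:R &
      forall u, inL2 Omega u ->
        normL2 Omega (u - \sum_(k < N) (fun x => inner Omega u (phi k) * phi k x))
          @[N --> \oo] --> 0%E].

(* The eigenvalues are numbered from 0. The eigenvalue equation holds at every
   point of Omega, not just almost everywhere: this singles out the
   representative of phi k that enters the pointwise heat kernel. *)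
Definition eigen_decomposition (lambda : nat -> R) (phi : nat -> 'rV[R]_n -> R) :=
  [/\ 0 < lambda 0%N < lambda 1%N,
      nondecreasing_seq lambda,
      lambda @ \oo --> +oo,
      orthonormal_basis phi &
      forall k x, Omega x -> green (phi k) x = (lambda k)^-1 * phi k x].

End green_operator.

Section heat.
Context {R : realType} {n : nat} (Omega : set 'rV[R]_n) (gamma : R).
Context (lambda : nat -> R) (phi : nat -> 'rV[R]_n -> R).
Implicit Types (u v : 'rV[R]_n -> R) (t : R) (x y z : 'rV[R]_n).

(* Elements of L^1(Omega, delta^gamma) are classes; the last clause selects
   representatives of S t u measurable in (t, x), for which the time integrals
   below make sense for almost every x and do not depend on the selection. *)
Definition heat_semigroup (S : R -> ('rV[R]_n -> R) -> 'rV[R]_n -> R) :=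
  [/\ forall t u, 0 <= t -> inL2 Omega u ->
        inL2 Omega (S t u) /\
        normL2 Omega (S t u - \sum_(k < N)
            (fun x => expR (- lambda k * t) * inner Omega u (phi k) * phi k x))
          @[N --> \oo] --> 0%E,
      forall t, 0 <= t ->
        continuous_operator (inL1w Omega gamma) (normL1w Omega gamma)
                            (inL1w Omega gamma) (normL1w Omega gamma) (S t) &
      forall u, inL1w Omega gamma u ->
        measurable_fun ([set t : R | 0 <= t] `*` Omega) (fun p => S p.1 u p.2)].

Definition heat_kernel t x y : R :=
  limn (series (fun k => expR (- lambda k * t) * phi k x * phi k y)).

Definition heat_trace t z y : R :=
  boundary_trace Omega gamma (fun x => heat_kernel t x y) z.

Definition parabolic (S : R -> ('rV[R]_n -> R) -> 'rV[R]_n -> R)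
    (u0 : 'rV[R]_n -> R) (f h : R -> 'rV[R]_n -> R) t x : R :=
  S t u0 x +
  \int[lebesgue_measure]_(r in `[0, t]) S (t - r) (f r) x +
  \int[lebesgue_measure]_(r in `[0, t])
    \int[surface_measure]_(z in frontier Omega) (heat_trace (t - r) z x * h r z).

End heat.

(* Main.v *)
(** Dividing by w = delta^gamma and replacing the Lebesgue measure by w^2 dx turns
    L^1(Omega, delta^gamma) into L^1 of a finite measure and G into a symmetric
    kernel K whose part above height A^M has row integrals at most C / A. This
    makes the quotients eta_k = phi_k / w bounded, with bounds growing at most
    polynomially in lambda_k, and lambda_k grow at least like a power of k, so
    that the normalised heat kernel sum_k exp(- lambda_k t) eta_k(x) eta_k(y) converges
    absolutely, also for x on the boundary, where eta_k extends continuously. It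
    is nonnegative by the submarkov property, and its integral over all times
    t > 0 is K(x, y), or the boundary trace of K when x is a boundary point.
    Hence, after the substitution t - r -> r, the source and boundary parts of
    the solution are integrals over `[0, t] of nonnegative heat kernels against
    finite signed measures, whose integrals over all times are the normalised
    G[f] and M[h]; by dominated convergence the tails vanish in L^1, while the
    contribution of u0 decays like exp(- lambda_0 t). *)

From HB Require Import structures.
Require Import Defs.
From mathcomp Require Import all_boot all_order all_algebra.
From mathcomp Require Import all_classical all_reals all_analysis.
From mathcomp Require Import ess_sup_inf measurable_realfun zify ring lra.
Set Implicit Arguments. Unset Strict Implicit. Unset Printing Implicit Defensive.
Import Order.TTheory GRing.Theory Num.Theory.
Import numFieldNormedType.Exports.
Local Open Scope classical_set_scope.
Local Open Scope ring_scope.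

(** In the variable v = u / w the submarkov bound only says v <= 1 / w, which is no bound near the
    boundary: it gives the sign of the normalised heat flow, but not its boundedness uniformly in
    time. That bound comes from psi = K 1, which the kernel estimates keep between two positive
    constants and which decreases along the flow, being the time integral of the flow of 1. Any 0 <=
    v <= 1 lies below psi / c1, hence so does its flow. This is what lets the lower end of the time
    integral tend to 0 in pairings with the sections of K, which are merely integrable. At the
    boundary the limit of these sections is taken in L^1 by Vitali's theorem; the excess bound
    supplies the uniform integrability, and its constants do not depend on the point, so they
    survive the limit. The boundary of a general bounded domain may have infinite surface measure,
    so Fubini is applied to the finite measure |h| dzeta instead, with the sign of h as a bounded
    factor. *)

Section density.
Import HBNNSimple.
Context d (T : measurableType d) (R : realType).
Variables (m : {measure set T -> \bar R}) (r : T -> R).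
Hypotheses (r0 : forall x, 0 <= r x) (ri : m.-integrable setT (EFin \o r)).
Local Open Scope ereal_scope.

(** The two facts are phantom arguments, so that the measure instances below attach to the term
    itself. It serves for the weighted measure and for the charges built from f and h; the latter
    turns a surface measure that need not be sigma-finite into a finite measure. *)
Definition density of (forall x, (0 <= r x)%R) & m.-integrable setT (EFin \o r) :=
  fun A : set T => \int[m]_(x in A) (r x)%:E.
Local Notation nu := (density r0 ri).

Let mr : measurable_fun setT r.
Proof. exact/measurable_EFinP/(measurable_int _ ri). Qed.

Let density0 : nu set0 = 0.
Proof. by rewrite /density integral_set0. Qed.

Let density_ge0 A : 0 <= nu A.
Proof. by apply: integral_ge0 => x _; rewrite lee_fin. Qed.

Let density_sigma_additive : semi_sigma_additive nu.
Proof.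
move=> F mF tF mUF; rewrite /density ge0_integral_bigcup//.
- by apply: is_cvg_nneseries => k _ _; apply: density_ge0.
- by apply/measurable_EFinP/measurable_funTS.
- by move=> x _; rewrite lee_fin.
Qed.

HB.instance Definition _ := isMeasure.Build _ _ _ nu
  density0 density_ge0 density_sigma_additive.

Let density_finite : fin_num_fun nu.
Proof.
move=> A mA; rewrite ge0_fin_numE ?density_ge0//.
have /integrableP[_] := integrableS measurableT mA (@subsetT _ A) ri.
apply: le_lt_trans; apply: ge0_le_integral => //.
- by move=> x _; rewrite lee_fin.
- by apply/measurable_EFinP/measurable_funTS.
- by apply/measurableT_comp => //; apply/measurable_EFinP/measurable_funTS.
- by move=> x _; exact: lee_abs.
Qed.

HB.instance Definition _ := Measure_isFinite.Build _ _ _ nu density_finite.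

(** Both sides are limits of integrals of the same increasing simple functions, by monotone
    convergence; on a level set the identity is the definition of [nu]. *)
Lemma ge0_integral_density (f : T -> \bar R) E : measurable E ->
  (forall x, 0 <= f x) -> measurable_fun E f ->
  \int[nu]_(x in E) f x = \int[m]_(x in E) (f x * (r x)%:E).
Proof.
move=> mE f0 mf; pose h := nnsfun_approx mE mf; set g := EFin \o r.
have mg D : measurable_fun D g by exact/measurable_EFinP/measurable_funTS.
have g0 x : 0 <= g x by rewrite lee_fin.
have -> : \int[nu]_(x in E) f x =
    lim (\int[nu]_(x in E) (EFin \o h n) x @[n --> \oo]).
  have fE x : E x -> f x = lim ((EFin \o h n) x @[n --> \oo]).
    by move=> Ex; apply/esym/cvg_lim => //; exact: cvg_nnsfun_approx.
  under eq_integral => x /[!inE] /fE -> //.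
  apply: monotone_convergence => //.
  - by move=> n; apply/measurable_EFinP/measurable_funTS/measurable_funP.
  - by move=> n x Ex //=; rewrite lee_fin.
  - by move=> x Ex a b ab; rewrite lee_fin; exact/lefP/nd_nnsfun_approx.
have -> : \int[m]_(x in E) (f \* g) x =
    lim (\int[m]_(x in E) ((EFin \o h n) \* g) x @[n --> \oo]).
  have fg x : E x -> f x * g x = lim (((EFin \o h n) \* g) x @[n --> \oo]).
    by move=> Ex; apply/esym/cvg_lim => //; apply: cvgeZr => //;
      exact: cvg_nnsfun_approx.
  under eq_integral => x /[!inE] /fg -> //.
  apply: monotone_convergence => [//| | |].
  - move=> n; apply/emeasurable_funM => //.
    exact/measurable_EFinP/measurable_funTS.
  - by move=> n x Ex /=; rewrite mule_ge0 ?lee_fin.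
  - by move=> x Ex a b ab/=; rewrite lee_wpmul2r ?lee_fin//; exact/lefP/nd_nnsfun_approx.
apply/congr_lim/funext => n.
transitivity (\int[nu]_(x in E)
   (\sum_(y \in range (h n)) (y * \1_(h n @^-1` [set y]) x)%:E)).
  by apply: eq_integral => t tE; rewrite /= fimfunE -fsumEFin.
have indich k y : measurable_fun E (fun x => (y * \1_(h k @^-1` [set y]) x)%:E).
  by apply: (measurable_comp measurableT) => //; exact: measurable_funM.
rewrite ge0_integral_fsum//; last by move=> k y Ey; exact: nnfun_muleindic_ge0.
transitivity (\int[m]_(x in E) (\sum_(y \in range (h n))
    (y * \1_(h n @^-1` [set y]) x)%:E * g x)); last first.
  under eq_integral => x xE.
    rewrite -ge0_mule_fsuml => [|y]; last exact: nnfun_muleindic_ge0.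
    rewrite fsumEFin // -(fimfunE _ x); over.
  by [].
rewrite ge0_integral_fsum//; last 2 first.
  - by move=> y; apply: emeasurable_funM.
  - by move=> k y Ey; rewrite mule_ge0// nnfun_muleindic_ge0.
apply: eq_fsbigr => y rhn.
under eq_integral do rewrite EFinM.
rewrite integralZl_indic_nnsfun => //.
under [RHS]eq_integral do rewrite EFinM -muleA.
rewrite ge0_integralZl//.
- under [in RHS]eq_integral do rewrite muleC.
  rewrite [in RHS](eq_integral (g \_ (h n @^-1` [set y]))); last first.
    by move=> x xE; rewrite epatch_indic.
  by rewrite -integral_mkcondr integral_indic// setIC.
- apply: emeasurable_funM => //; exact/measurable_EFinP.
- by move=> t Et; rewrite mule_ge0// lee_fin.
- by move: rhn; rewrite inE => -[t _ <-]; rewrite lee_fin.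
Qed.

Lemma integrable_density (f : T -> R) E : measurable E -> measurable_fun E f ->
  nu.-integrable E (EFin \o f) <->
  m.-integrable E (fun x => (f x)%:E * (r x)%:E).
Proof.
move=> mE mf.
have H : \int[nu]_(x in E) `|(f x)%:E| = \int[m]_(x in E) `|(f x)%:E * (r x)%:E|.
  rewrite ge0_integral_density//.
    by apply: eq_integral => x _; rewrite abseM [X in _ = _ * X]gee0_abs ?lee_fin.
  by apply: measurableT_comp => //; exact/measurable_EFinP.
split => /integrableP[_ fi]; apply/integrableP; split.
- apply: emeasurable_funM; first exact/measurable_EFinP.
  exact/measurable_EFinP/measurable_funTS.
- by rewrite -H.
- exact/measurable_EFinP.
- by rewrite H.
Qed.

Lemma integral_density (f : T -> R) E : measurable E -> measurable_fun E f ->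
  \int[nu]_(x in E) (f x)%:E = \int[m]_(x in E) ((f x)%:E * (r x)%:E).
Proof.
move=> mE mf; have mef : measurable_fun E (EFin \o f) by exact/measurable_EFinP.
rewrite [LHS]integralE [RHS]integralE !ge0_integral_density//; last 2 first.
  exact: measurable_funeneg.
  exact: measurable_funepos.
congr (_ - _); apply: eq_integral => x _.
  by rewrite !funeposE -EFinM -!EFin_max -EFinM maxr_pMl// mul0r.
by rewrite !funenegE -EFinM -!EFinN -!EFin_max -EFinM maxr_pMl// mul0r mulNr.
Qed.

Lemma negligible_density A : m.-negligible A -> nu.-negligible A.
Proof.
move=> [B [mB B0 AB]]; exists B; split => //=; rewrite /density.
by apply: null_set_integral => //; exact/measurable_EFinP/measurable_funTS.
Qed.

End density.

(** * Termwise dominated series *)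

Section series.
Context {R : realType}.
Implicit Types u v : R^nat.

Definition rsum u : R := limn (series u).

Lemma cvg_rsum u v : (forall k, `|u k| <= v k) -> cvgn (series v) ->
  series u @ \oo --> rsum u.
Proof.
move=> uv cv; apply: (normed_cvg _).
by apply: (@series_le_cvg _ (fun k => `|u k|) v) => // k; exact: le_trans (uv k).
Qed.

Lemma eq_rsum u v : u =1 v -> rsum u = rsum v.
Proof. by move=> uv; rewrite /rsum (_ : u = v)//; exact/funext. Qed.

Lemma norm_rsum_le u v : (forall k, `|u k| <= v k) -> cvgn (series v) ->
  `|rsum u| <= rsum v.
Proof.
move=> uv cv; have cu := cvg_rsum uv cv.
apply: (@ler_cvg_to _ \oo _ _ (fun n => `|series u n|) (series v)) => //.
  exact: cvg_norm.
apply: nearW => n; rewrite /series/=; apply: le_trans (ler_norm_sum _ _ _) _.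
exact: ler_sum.
Qed.

Lemma rsum_tail_le u v n : (forall k, `|u k| <= v k) -> cvgn (series v) ->
  `|rsum u - series u n| <= rsum v - series v n.
Proof.
move=> uv cv; have cu := cvg_rsum uv cv.
apply: (@ler_cvg_to _ \oo _ _ (fun m => `|series u m - series u n|)
    (fun m => series v m - series v n)).
- by apply: cvg_norm; apply: cvgB => //; exact: cvg_cst.
- by apply: cvgB => //; exact: cvg_cst.
near=> m; have nm : (n <= m)%N by near: m; exact: nbhs_infty_ge.
rewrite !sub_series nm; apply: le_trans (ler_norm_sum _ _ _) _.
exact: ler_sum.
Unshelve. all: by end_near. Qed.

Lemma ge0_rsum_ge v n : (forall k, 0 <= v k) -> cvgn (series v) ->
  series v n <= rsum v.
Proof.
move=> v0 cv; rewrite -subr_ge0; apply: le_trans (@rsum_tail_le (cst 0) v n _ cv) => //.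
by move=> k; rewrite normr0.
Qed.

Lemma rsumZ (a : R) u : cvgn (series u) -> rsum (fun k => a * u k) = a * rsum u.
Proof.
by move=> cu; rewrite /rsum -[RHS]/(a *: _) -lim_seriesZ.
Qed.

Lemma rsumD u v : cvgn (series u) -> cvgn (series v) ->
  rsum (fun k => u k + v k) = rsum u + rsum v.
Proof. by move=> cu cv; rewrite /rsum -lim_seriesD. Qed.

Lemma rsumB u v : cvgn (series u) -> cvgn (series v) ->
  rsum (fun k => u k - v k) = rsum u - rsum v.
Proof. by move=> cu cv; rewrite /rsum -lim_seriesB. Qed.

(** Tannery's theorem along a filter, with three thirds of [e]: the two tails are bounded by the
    tail of [v] uniformly in [x], and the remaining finite sum converges termwise. All continuity of
    heat series in time and space comes from here. *)
Lemma cvg_rsum_dominated (T : topologicalType) (F : set_system T) {FF : ProperFilter F}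
    (u : T -> R^nat) (l v : R^nat) :
  (forall k, u ^~ k @ F --> l k) ->
  (\forall x \near F, forall k, `|u x k| <= v k) ->
  cvgn (series v) -> (rsum (u x) @[x --> F]) --> rsum l.
Proof.
move=> ul uv cv.
have lv k : `|l k| <= v k.
  apply: (@ler_cvg_to _ F _ _ (fun x => `|u x k|) (fun=> v k)).
  - by apply: cvg_norm; exact: ul.
  - exact: cvg_cst.
  - by apply: filterS uv => x; exact.
apply/cvgrPdist_lt => e e0.
have e3 : 0 < e / 3 by rewrite divr_gt0.
have [n _ /(_ n (leqnn n))] : \forall n \near \oo, `|rsum v - series v n| < e / 3.
  by move/cvgrPdist_lt : cv; exact.
move=> /(le_lt_trans (ler_norm _)) vn.
have : series (u x) n @[x --> F] --> series l n.
  rewrite /series/=; elim: n {vn} => [|n ih].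
    by under eq_fun do rewrite big_geq//; rewrite big_geq//; exact: cvg_cst.
  under eq_fun do rewrite big_nat_recr//=.
  by rewrite big_nat_recr//=; exact: cvgD.
move=> /cvgrPdist_lt/(_ _ e3) un.
near=> x; have uvx : forall k, `|u x k| <= v k by near: x.
rewrite (_ : _ - _ = (rsum l - series l n) - (rsum (u x) - series (u x) n)
  + (series l n - series (u x) n)); last ring.
rewrite (splitr e) (le_lt_trans (ler_normD _ _))//.
have h1 := le_lt_trans (rsum_tail_le n lv cv) vn.
have h2 := le_lt_trans (rsum_tail_le n uvx cv) vn.
have h3 : `|series l n - series (u x) n| < e / 3 by near: x.
have := ler_normB (rsum l - series l n) (rsum (u x) - series (u x) n).
move: h1 h2 h3; set a := `|_|; set b := `|_|; set c := `|_|; set g := `|_|.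
by lra.
Unshelve. all: by end_near. Qed.

End series.

Section integral_series.
Context d (T : measurableType d) (R : realType).
Variables (mu : {measure set T -> \bar R}) (D : set T) (mD : measurable D).
Variables F H : nat -> T -> R.
Hypotheses (mF : forall k, measurable_fun D (F k))
  (mH : forall k, measurable_fun D (H k))
  (FH : forall k x, D x -> `|F k x| <= H k x)
  (cH : forall x, D x -> cvgn (series (H ^~ x)))
  (iH : (\sum_(k <oo) \int[mu]_(x in D) (H k x)%:E < +oo)%E).

Let H0 k x : D x -> 0 <= H k x.
Proof. by move=> Dx; exact: le_trans (FH k Dx). Qed.

Let cF x : D x -> series (F ^~ x) @ \oo --> rsum (F ^~ x).
Proof. by move=> Dx; apply: (@cvg_rsum _ _ (H ^~ x)) => [k|]; [exact: FH|exact: cH]. Qed.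

Let nneseriesH x : D x -> (\sum_(k <oo) (H k x)%:E)%E = (rsum (H ^~ x))%:E.
Proof.
move=> Dx; rewrite /rsum -EFin_lim; last exact: cH.
by apply: congr_lim; apply/funext => n /=; rewrite /series/= sumEFin.
Qed.

Lemma measurable_rsum : measurable_fun D (fun x => rsum (F ^~ x)).
Proof.
apply: (@measurable_fun_cvg _ _ _ D (fun n x => series (F ^~ x) n)).
  by move=> n; rewrite /series/=; exact: measurable_sum.
by move=> x Dx; exact: cF.
Qed.

(** Dominated convergence for the partial sums. The majorant is the pointwise sum of the [H k],
    whose integral is the sum of their integrals by monotone convergence. *)
Let hyps : mu.-integrable D (EFin \o (fun x => rsum (F ^~ x))) /\
  (\int[mu]_(x in D) (series (F ^~ x) n)%:E)%E @[n --> \oo] -->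
  (\int[mu]_(x in D) (rsum (F ^~ x))%:E)%E.
Proof.
have [] := @dominated_convergence _ T R mu D mD
    (fun n x => (series (F ^~ x) n)%:E) (fun x => (rsum (F ^~ x))%:E)
    (fun x => (\sum_(k <oo) (H k x)%:E)%E); last by split.
- move=> n; apply/measurable_EFinP; rewrite /series/=; exact: measurable_sum.
- exact/measurable_EFinP/measurable_rsum.
- by apply: aeW => x Dx; apply: cvg_EFin; [exact: nearW|exact: cF].
- have mH' : measurable_fun D (fun x => \sum_(k <oo) (H k x)%:E)%E.
    apply: ge0_emeasurable_sum => [k x Dx _|k _]; first by rewrite lee_fin H0.
    exact/measurable_EFinP.
  apply/integrableP; split => //.
  rewrite (eq_integral (fun x => \sum_(k <oo) (H k x)%:E))%E.
    rewrite integral_nneseries// => k; first exact/measurable_EFinP.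
  move=> x /[!inE] Dx; rewrite gee0_abs//; apply: nneseries_ge0 => k _ _.
  by rewrite lee_fin H0.
- apply: aeW => x n Dx; rewrite nneseriesH// lee_fin.
  have := ge0_rsum_ge n (fun k => H0 k Dx) (cH Dx); apply: le_trans.
  rewrite /series/=; apply: le_trans (ler_norm_sum _ _ _) _.
  by apply: ler_sum => k _; exact: FH.
Qed.

Lemma integrable_rsum : mu.-integrable D (EFin \o (fun x => rsum (F ^~ x))).
Proof. by case: hyps. Qed.

Lemma Rintegral_rsum :
  series (fun k => \int[mu]_(x in D) F k x) @ \oo -->
  \int[mu]_(x in D) rsum (F ^~ x).
Proof.
have [iF cvF] := hyps.
have iFk k : mu.-integrable D (EFin \o F k).
  apply: (@le_integrable _ _ _ mu D mD _ (fun x => (H k x)%:E)).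
  - exact/measurable_EFinP.
  - by move=> x Dx; rewrite /= lee_fin (le_trans (FH k Dx))// ler_norm.
  apply/integrableP; split; first exact/measurable_EFinP.
  (* A single integral is at most the partial sum up to its index, hence at most the whole
     series. *)
  apply: le_lt_trans iH; rewrite (eq_integral (fun x => (H k x)%:E))%E.
    rewrite (le_trans _ (nneseries_lim_ge k.+1 _))// => [|n _ _].
      rewrite big_nat_recr//= leeDr//; apply: sume_ge0 => n _.
      by apply: integral_ge0 => x Dx; rewrite lee_fin H0.
    by apply: integral_ge0 => x Dx; rewrite lee_fin H0.
  by move=> x /[!inE] Dx; rewrite gee0_abs// lee_fin H0.
rewrite (_ : series _ = fun n => fine (\int[mu]_(x in D) (series (F ^~ x) n)%:E)%E).
  by apply: fine_cvg; rewrite /Rintegral fineK//; exact: integrable_fin_num.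
have iS n : mu.-integrable D (fun x => (\sum_(0 <= k < n) F k x)%:E).
  under eq_fun do rewrite -sumEFin; apply: integrable_sum => // k _; exact: iFk.
apply/funext => n; rewrite /series/=.
elim: n => [|n ih].
  by rewrite big_geq//; under eq_integral do rewrite big_geq//; rewrite integral0.
have fS : (\int[mu]_(x in D) (\sum_(0 <= k < n) F k x)%:E)%E \is a fin_num.
  by apply: integrable_fin_num => //; exact: iS.
have fF : (\int[mu]_(x in D) (F n x)%:E)%E \is a fin_num.
  by apply: integrable_fin_num => //; exact: iFk.
rewrite big_nat_recr//= ih -fineD// -integralD//; last exact: iFk.
by congr fine; apply: eq_integral => x _; rewrite big_nat_recr.
Qed.

End integral_series.

(** * Integral operators with uniformly integrable kernels *)

Section real_integral.
Context d (T : measurableType d) (R : realType).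
Variables (mu : {measure set T -> \bar R}).

Lemma integrable_Radd D (f g : T -> R) : measurable D ->
  mu.-integrable D (EFin \o f) -> mu.-integrable D (EFin \o g) ->
  mu.-integrable D (EFin \o (fun x => f x + g x)).
Proof. by move=> mD fi gi; exact: (integrableD mD fi gi). Qed.

Lemma integrable_Rsub D (f g : T -> R) : measurable D ->
  mu.-integrable D (EFin \o f) -> mu.-integrable D (EFin \o g) ->
  mu.-integrable D (EFin \o (fun x => f x - g x)).
Proof. by move=> mD fi gi; exact: (integrableB mD fi gi). Qed.

Lemma integrable_Rscale D (f : T -> R) a : measurable D ->
  mu.-integrable D (EFin \o f) -> mu.-integrable D (EFin \o (fun x => a * f x)).
Proof. by move=> mD fi; exact: (integrableZl mD a fi). Qed.

Lemma integrable_Rsum (F : nat -> T -> R) n :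
  (forall k, mu.-integrable setT (EFin \o F k)) ->
  mu.-integrable setT (EFin \o (fun x => \sum_(k < n) F k x)).
Proof.
move=> iF; rewrite (_ : _ \o _ = fun x => (\sum_(k < n) (F k x)%:E)%E).
  by apply: integrable_sum => // k _; exact: iF.
by apply/funext => x; rewrite /= sumEFin.
Qed.

Lemma Rintegral_sum (F : nat -> T -> R) n :
  (forall k, mu.-integrable setT (EFin \o F k)) ->
  \int[mu]_x (\sum_(k < n) F k x) = \sum_(k < n) \int[mu]_x F k x.
Proof.
move=> iF; elim: n => [|n ih].
  by under eq_Rintegral do rewrite big_ord0; rewrite big_ord0 Rintegral_cst// mul0r.
under eq_Rintegral do rewrite big_ord_recr.
rewrite RintegralD//=; last exact: (integrable_Rsum n iF).
by rewrite ih big_ord_recr.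
Qed.

End real_integral.

Section bounded_integrable.
Context d (T : measurableType d) (R : realType).
Variables (mu : {finite_measure set T -> \bar R}).

Lemma bounded_integrable (f : T -> R) B :
  measurable_fun setT f -> (forall x, `|f x| <= B) -> mu.-integrable setT (EFin \o f).
Proof.
move=> mf fB.
apply: (@le_integrable _ _ _ mu setT measurableT _ (cst B%:E)).
- exact/measurable_EFinP.
- by move=> x _; rewrite /= lee_fin (le_trans (fB x))// ler_norm.
- exact: finite_measure_integrable_cst.
Qed.

Lemma integrableM_bounded (f g : T -> R) B : mu.-integrable setT (EFin \o f) ->
  measurable_fun setT g -> (forall x, `|g x| <= B) ->
  mu.-integrable setT (EFin \o (fun x => f x * g x)).
Proof.
move=> fi mg gB.
apply: (@le_integrable _ _ _ mu setT measurableT _ (fun x => (B * f x)%:E)).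
- apply/measurable_EFinP; apply: measurable_funM => //.
  exact/measurable_EFinP/(measurable_int _ fi).
- move=> x _; rewrite /= lee_fin !normrM mulrC ler_wpM2r//.
  exact: le_trans (gB x) (ler_norm _).
- under eq_fun do rewrite EFinM; exact: integrableZl.
Qed.

End bounded_integrable.

(** * Boundedness and growth of eigenfunctions *)

Section kernel.
Context d (T : measurableType d) (R : realType).
Variables (mu : {finite_measure set T -> \bar R}) (K : T -> T -> R).
Hypotheses (K_ge0 : forall x y, 0 <= K x y) (K_sym : forall x y, K x y = K y x)
  (mK : measurable_fun setT (fun p : T * T => K p.1 p.2)).

(** The assumption below, that the excess above [A ^+ M] integrates to at most [C / A] for every
    [x], is uniform integrability with a rate. The rate is put into the height, as an integer power,
    so that the bounds derived from it are polynomial. *)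
Definition excess (A : R) x y : R := Num.max (K x y - A) 0.

Variables (C : R) (M : nat).
Hypotheses (C0 : 0 <= C) (excess_le : forall x (A : R), 1 <= A ->
  (\int[mu]_y (excess (A ^+ M) x y)%:E <= (C / A)%:E)%E).

Let mKx x : measurable_fun setT (K x).
Proof. exact: (measurable_fun_pair2 x mK). Qed.

Let mexcess A : measurable_fun setT (fun p : T * T => excess A p.1 p.2).
Proof. by apply: measurable_maxr => //; exact: measurable_funB. Qed.

Let mexcessx A x : measurable_fun setT (excess A x).
Proof. exact: (measurable_fun_pair2 x (mexcess A)). Qed.

Lemma excess_ge0 A x y : 0 <= excess A x y.
Proof. by rewrite le_max lexx orbT. Qed.

Lemma kernel_le_excess A x y : K x y <= A + excess A x y.
Proof. by rewrite -lerBlDl le_max lexx. Qed.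

Lemma excess_sym A x y : excess A x y = excess A y x.
Proof. by rewrite /excess K_sym. Qed.

Lemma excess_integrable (A : R) x : 1 <= A ->
  mu.-integrable setT (EFin \o excess (A ^+ M) x).
Proof.
move=> A1; apply/integrableP; split; first exact/measurable_EFinP.
rewrite (eq_integral (fun y => (excess (A ^+ M) x y)%:E)); last first.
  by move=> y _; rewrite gee0_abs// lee_fin excess_ge0.
exact: le_lt_trans (excess_le x A1) (ltry _).
Qed.

Lemma Rintegral_excess_le (A : R) x : 1 <= A ->
  \int[mu]_y excess (A ^+ M) x y <= C / A.
Proof.
move=> A1; rewrite -lee_fin fineK ?excess_le//.
exact: (integrable_fin_num measurableT (excess_integrable x A1)).
Qed.

Lemma kernel_integrable x : mu.-integrable setT (EFin \o K x).
Proof.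
apply: (@le_integrable _ _ _ mu setT measurableT _
  (EFin \o (fun y => 1 ^+ M + excess (1 ^+ M) x y))).
- exact/measurable_EFinP.
- move=> y _; rewrite /= lee_fin !ger0_norm// ?kernel_le_excess//.
  by rewrite addr_ge0// ?excess_ge0// exprn_ge0.
- apply: integrable_Radd => //; last exact: excess_integrable.
  exact: finite_measure_integrable_cst.
Qed.

Lemma Rintegral_kernel_le x : \int[mu]_y K x y <= fine (mu setT) + C.
Proof.
rewrite (le_trans (@le_Rintegral _ _ _ mu setT _
  (fun y => 1 + excess (1 ^+ M) x y) measurableT _ _ _))//.
- exact: kernel_integrable.
- apply: integrable_Radd => //; last exact: excess_integrable.
  exact: finite_measure_integrable_cst.
- by move=> y _; rewrite -[X in X + _](expr1n _ M) kernel_le_excess.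
rewrite RintegralD//; last 2 first.
- exact: finite_measure_integrable_cst.
- exact: excess_integrable.
rewrite Rintegral_cst// mul1r lerD2l -[leRHS]divr1.
exact: Rintegral_excess_le.
Qed.

(* Truncating u at twice the bound 2 b obtained from the bounded part of the
   kernel leaves a function dominated by l times the singular part of the
   kernel applied to it, a contraction in L^1. *)
Lemma subeigenfunction_bounded (l : R) (u : T -> R) : 0 <= l ->
  (forall x, 0 <= u x) -> mu.-integrable setT (EFin \o u) ->
  (forall x, ((u x)%:E <= l%:E * \int[mu]_y (K x y * u y)%:E)%E) ->
  exists B, forall x, u x <= B.
Proof.
move=> l0 u0 iu ule.
have mu' : measurable_fun setT u by exact/measurable_EFinP/(measurable_int _ iu).
(* This height makes [l] times the row integrals of the excess at most 1/2. *)
pose A := 1 + 2 * l * C.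
have A1 : 1 <= A by rewrite /A lerDl !mulr_ge0.
have Agt0 : 0 < A := lt_le_trans ltr01 A1.
have lCA : l * (C / A) <= 2^-1.
  by rewrite mulrA ler_pdivrMr// /A; lra.
pose U := \int[mu]_y u y.
have U0 : 0 <= U by exact: Rintegral_ge0.
have UE : (\int[mu]_y (u y)%:E)%E = U%:E.
  by rewrite fineK//; exact: (integrable_fin_num measurableT iu).
(* [b] bounds [l] times the part of the kernel below [A ^+ M] applied to [u]; the integral of [u] is
   enough for this. *)
pose b := l * A ^+ M * U.
have AM0 : 0 <= A ^+ M by rewrite exprn_ge0// ltW.
have b0 : 0 <= b by rewrite !mulr_ge0.
pose e y := Num.max (u y - 2 * b) 0.
have me : measurable_fun setT e by apply: measurable_maxr => //; exact: measurable_funB.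
have e0 y : 0 <= e y by rewrite le_max lexx orbT.
have ue y : u y <= e y + 2 * b by rewrite -lerBlDr le_max lexx.
have mE g x : measurable_fun setT g -> measurable_fun setT (fun y => (excess (A ^+ M) x y * g y)%:E).
  by move=> mg; apply/measurable_EFinP/measurable_funM.
(* Replacing [u] by [e + 2 * b] inside the excess costs [2 * b * l * (C / A) <= b], so the constants
   add up to [2 * b] again. *)
have step x : ((u x)%:E <= (2 * b)%:E + l%:E * \int[mu]_y (excess (A ^+ M) x y * e y)%:E)%E.
  apply: le_trans (ule x) _.
  have h : (\int[mu]_y (K x y * u y)%:E <= (A ^+ M * U)%:E +
      ((2 * b)%:E * (C / A)%:E + \int[mu]_y (excess (A ^+ M) x y * e y)%:E))%E.
    apply: (@le_trans _ _ (\int[mu]_y ((A ^+ M)%:E * (u y)%:E +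
       ((2 * b)%:E * (excess (A ^+ M) x y)%:E + (excess (A ^+ M) x y * e y)%:E)))%E).
      apply: ge0_le_integral => //.
      - by move=> y _; rewrite lee_fin mulr_ge0.
      - exact/measurable_EFinP/measurable_funM.
      - apply/measurable_EFinP; apply: measurable_funD; first exact: measurable_funM.
        by apply: measurable_funD; apply: measurable_funM.
      - move=> y _; rewrite -!EFinM -!EFinD lee_fin.
        apply: le_trans (ler_wpM2r (u0 y) (kernel_le_excess (A ^+ M) x y)) _.
        rewrite mulrDl lerD2l.
        by have := ler_wpM2l (excess_ge0 (A ^+ M) x y) (ue y); lra.
    rewrite ge0_integralD//; last 4 first.
    - by move=> y _; rewrite -EFinM lee_fin mulr_ge0.
    - exact/measurable_EFinP/measurable_funM.
    - by move=> y _; rewrite -EFinM -EFinD lee_fin addr_ge0// !mulr_ge0// excess_ge0.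
    - apply/measurable_EFinP; apply: measurable_funD; exact: measurable_funM.
    rewrite ge0_integralD//; last 4 first.
    - by move=> y _; rewrite -EFinM lee_fin !mulr_ge0// excess_ge0.
    - exact/measurable_EFinP/measurable_funM.
    - by move=> y _; rewrite lee_fin !mulr_ge0// excess_ge0.
    - exact: mE.
    rewrite !ge0_integralZl_EFin ?UE//; last 5 first.
    - by move=> y _; rewrite lee_fin excess_ge0.
    - exact/measurable_EFinP.
    - by rewrite mulr_ge0.
    - by move=> y _; rewrite lee_fin.
    - exact/measurable_EFinP.
    rewrite -EFinM leeD2l// leeD2r// lee_wpmul2l ?lee_fin ?mulr_ge0//.
    exact: excess_le.
  apply: le_trans (lee_wpmul2l _ h) _; first by rewrite lee_fin.
  rewrite addeA muleDr//.
  apply: leeD2r; suff : l * (A ^+ M * U + 2 * b * (C / A)) <= 2 * b.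
    by rewrite -lee_fin.
  rewrite mulrDr mulrA -/b.
  have := ler_wpM2l b0 lCA; lra.
pose J := (\int[mu]_x (e x)%:E)%E.
have J_fin : (J < +oo)%E.
  rewrite (@le_lt_trans _ _ U%:E) ?ltry// -UE; apply: ge0_le_integral => //.
  - by move=> y _; rewrite lee_fin.
  - exact/measurable_EFinP.
  - exact/measurable_EFinP.
  - by move=> y _; rewrite lee_fin /e ge_max u0 andbT; lra.
have J0 : (0 <= J)%E by apply: integral_ge0 => y _; rewrite lee_fin.
have mEe : measurable_fun setT (fun p : T * T => (excess (A ^+ M) p.1 p.2 * e p.2)%:E).
  apply/measurable_EFinP; apply: measurable_funM => //.
  exact: measurableT_comp.
have Ee0 (p : T * T) : (0 <= (excess (A ^+ M) p.1 p.2 * e p.2)%:E)%E.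
  by rewrite lee_fin mulr_ge0// excess_ge0.
have mF := measurable_fun_fubini_tonelli_F (m2 := mu) _ mEe Ee0.
(* Tonelli moves the integral in [x] onto the excess, where symmetry turns the row bound into a
   column bound. *)
have J_le : (J <= (2^-1)%:E * J)%E.
  apply: (@le_trans _ _ (l%:E * \int[mu]_x \int[mu]_y (excess (A ^+ M) x y * e y)%:E)%E).
    rewrite -ge0_integralZl_EFin//; last by move=> x _; apply: integral_ge0 => y _; rewrite lee_fin mulr_ge0// excess_ge0.
    apply: ge0_le_integral => //.
    - by move=> y _; rewrite lee_fin.
    - exact/measurable_EFinP.
    - exact: measurable_funeM.
    - move=> x _; rewrite {1}/e EFin_max ge_max; apply/andP; split.
        by rewrite EFinB leeBlDl.
      by apply: mule_ge0; [rewrite lee_fin|apply: integral_ge0 => y _; exact: (Ee0 (x, y))].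
  rewrite (fubini_tonelli _ mEe Ee0)/=.
  apply: (@le_trans _ _ (l%:E * ((C / A)%:E * J))%E).
    rewrite lee_wpmul2l ?lee_fin// /J -ge0_integralZl_EFin//; last 3 first.
    - by move=> y _; rewrite lee_fin.
    - exact/measurable_EFinP.
    - by rewrite divr_ge0// ltW.
    apply: ge0_le_integral => //.
    - by move=> y _; apply: integral_ge0 => x _; rewrite lee_fin mulr_ge0// excess_ge0.
    - exact: (measurable_fun_fubini_tonelli_G (m1 := mu) _ mEe Ee0).
    - apply/measurable_EFinP; exact: measurable_funM.
    - move=> y _; under eq_integral do rewrite mulrC EFinM excess_sym.
      rewrite ge0_integralZl_EFin//; last 2 first.
      + by move=> x _; rewrite lee_fin excess_ge0.
      + exact/measurable_EFinP.
      by rewrite muleC lee_wpmul2r ?lee_fin ?excess_le.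
  by rewrite muleA -EFinM lee_wpmul2r// lee_fin.
have {J_le} Jeq0 : J = 0%E.
  move: J_fin J0 J_le; case: J => // r _; rewrite !lee_fin => r0 rr.
  by congr EFin; lra.
have e_ae : ae_eq mu setT (EFin \o e) (cst 0%E).
  apply/ae_eq_integral_abs => //; first exact/measurable_EFinP.
  rewrite -Jeq0; apply: eq_integral => x _.
  by rewrite gee0_abs// lee_fin.
(* The inequality [step] holds at every point and the integral in it vanishes, so the bound holds
   everywhere and not just almost everywhere. *)
exists (2 * b) => x; rewrite -lee_fin; apply: le_trans (step x) _.
rewrite (ge0_ae_eq_integral (g := cst 0%E))//; last 3 first.
- exact: mE.
- by move=> y _; rewrite lee_fin mulr_ge0// excess_ge0.
- by apply: filterS e_ae => y /(_ I) /= [->] _; rewrite mulr0.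
by rewrite integral0 mule0 adde0.
Qed.

Section growth.
Variables (eta : nat -> T -> R) (lam : nat -> R) (b : nat -> R).
Hypotheses (meta : forall k, measurable_fun setT (eta k))
  (eta_bounded : forall k x, `|eta k x| <= b k)
  (lam_ge0 : forall k, 0 <= lam k)
  (eta_eigen : forall k x, eta k x = lam k * \int[mu]_y (K x y * eta k y))
  (eta_orthonormal : forall j k, \int[mu]_y (eta j y * eta k y) = (j == k)%:R).

Let ieta k : mu.-integrable setT (EFin \o eta k).
Proof. exact: (bounded_integrable mu (meta k) (eta_bounded k)). Qed.

Lemma combination_square_integral (c : nat -> R) N :
  \int[mu]_y (\sum_(k < N) c k * eta k y) ^+ 2 = \sum_(k < N) c k ^+ 2.
Proof.
have iee j k : mu.-integrable setT (EFin \o (fun y => eta j y * eta k y)).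
  exact: (integrableM_bounded (ieta j) (meta k) (eta_bounded k)).
under eq_Rintegral => y _.
  rewrite expr2 big_distrl/=.
  under eq_bigr => j _.
    rewrite big_distrr/=.
    under eq_bigr => k _ do rewrite mulrACA.
    over.
  over.
rewrite (Rintegral_sum (F := fun j y =>
    \sum_(k < N) c j * c k * (eta j y * eta k y))); last first.
  move=> j; apply: (integrable_Rsum (F := fun k y => c j * c k * (eta j y * eta k y))).
  by move=> k; exact: integrable_Rscale.
apply: eq_bigr => j _.
rewrite (Rintegral_sum (F := fun k y => c j * c k * (eta j y * eta k y))); last first.
  by move=> k; exact: integrable_Rscale.
under eq_bigr => k _ do rewrite RintegralZl// eta_orthonormal.
rewrite (bigD1 j)//= eqxx mulr1 big1 ?addr0// => k kj.
by rewrite (_ : (_ == _) = false) ?mulr0//; apply/negbTE; rewrite eq_sym.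
Qed.

(** A bootstrap on the diagonal [Q] of the spectral projection: any upper bound [B] of [Q] improves
    to a fixed constant plus [B / 2]. The qualitative bounds [b k] only ensure that the supremum is
    finite and disappear from the estimate. Treating all squares at once keeps the constant
    independent of [N]. *)
Lemma eigenfunction_square_sum_le N (Lam : R) : 1 <= Lam ->
  (forall k, (k < N)%N -> lam k <= Lam) -> forall x,
  \sum_(k < N) eta k x ^+ 2 <=
    2 * (((1 + 4 * Lam * C) ^+ M) ^+ 2 * Lam ^+ 2 * fine (mu setT)).
Proof.
move=> Lam1 lamLam; pose Q x := \sum_(k < N) eta k x ^+ 2.
set A := 1 + 4 * Lam * C; set m := fine (mu setT).
have L0 : 0 < Lam := lt_le_trans ltr01 Lam1.
have A1 : 1 <= A by rewrite lerDl !mulr_ge0// ltW.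
have A0 : 0 < A := lt_le_trans ltr01 A1.
have AM0 : 0 <= A ^+ M by rewrite exprn_ge0// ltW.
have Q0 x : 0 <= Q x by apply: sumr_ge0 => k _; exact: sqr_ge0.
have step B : (forall x, Q x <= B) ->
    forall x, Q x <= (A ^+ M) ^+ 2 * Lam ^+ 2 * m + B / 2.
  move=> QB x.
  have B0 : 0 <= B := le_trans (Q0 x) (QB x).
  (* By the eigenvalue equation, [Q x] is the kernel at [x] applied to this combination. *)
  pose c k := eta k x * lam k; pose U y := \sum_(k < N) c k * eta k y.
  have mU : measurable_fun setT U.
    by apply: measurable_sum => k; exact: measurable_funM.
  have UB y : `|U y| <= Lam * B.
    apply: le_trans (ler_norm_sum _ _ _) _.
    apply: (@le_trans _ _ (\sum_(k < N) Lam * ((eta k x ^+ 2 + eta k y ^+ 2) / 2))).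
      apply: ler_sum => k _; rewrite !normrM -mulrA mulrCA (ger0_norm (lam_ge0 k)).
      apply: ler_pM; [exact: lam_ge0|by rewrite mulr_ge0|exact: lamLam|].
      rewrite -(real_normK (num_real (eta k x))) -(real_normK (num_real (eta k y))).
      have := sqr_ge0 (`|eta k x| - `|eta k y|); rewrite sqrrB; lra.
    rewrite -big_distrr/=; apply: ler_wpM2l; first exact: ltW.
    rewrite -big_distrl/= big_split/=.
    by have := QB x; have := QB y; rewrite /Q; lra.
  have KU : Q x = \int[mu]_y (K x y * U y).
    under eq_Rintegral => y _.
      rewrite /U big_distrr/=.
      under eq_bigr => k _ do rewrite mulrCA.
      over.
    have iKe k : mu.-integrable setT (EFin \o (fun y => K x y * eta k y)).
      exact: (integrableM_bounded (kernel_integrable x) (meta k) (eta_bounded k)).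
    rewrite (Rintegral_sum (F := fun k y => c k * (K x y * eta k y))); last first.
      by move=> k; exact: integrable_Rscale.
    apply: eq_bigr => k _; rewrite RintegralZl//.
    by rewrite /c -mulrA -eta_eigen expr2.
  have iU2 : mu.-integrable setT (EFin \o (fun y => U y ^+ 2)).
    apply: (@bounded_integrable _ _ _ _ _ ((Lam * B) ^+ 2)).
      by apply: measurable_funX.
    by move=> y; rewrite normrX lerXn2r// nnegrE// mulr_ge0// ltW.
  have iK : mu.-integrable setT (EFin \o (fun y => K x y * U y)).
    exact: (integrableM_bounded (kernel_integrable x) mU UB).
  have i1 : mu.-integrable setT (EFin \o (fun y => (A ^+ M) ^+ 2 * Lam ^+ 2
      + (4 * Lam ^+ 2)^-1 * U y ^+ 2)).
    apply: integrable_Radd => //; first exact: finite_measure_integrable_cst.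
    exact: integrable_Rscale.
  have i2 := excess_integrable x A1.
  rewrite KU; apply: (@le_trans _ _ (\int[mu]_y ((A ^+ M) ^+ 2 * Lam ^+ 2
      + (4 * Lam ^+ 2)^-1 * U y ^+ 2 + Lam * B * excess (A ^+ M) x y))).
    apply: le_Rintegral => //.
      by apply: integrable_Radd => //; exact: integrable_Rscale.
    move=> y _; apply: le_trans (ler_wpM2l (K_ge0 x y) (ler_norm (U y))) _.
    apply: le_trans (ler_wpM2r (normr_ge0 _) (kernel_le_excess (A ^+ M) x y)) _.
    rewrite mulrDl; apply: lerD; last first.
      by rewrite mulrC ler_wpM2r// excess_ge0.
    (* Young's inequality for the bounded part, weighted so that the integral of [U ^+ 2], at most
       [Lam ^+ 2 * B] by orthonormality, contributes only [B / 4]. The excess contributes the other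
       [B / 4], by the choice of [A]. *)
    have := sqr_ge0 (A ^+ M * Lam - `|U y| / (2 * Lam)).
    rewrite -(real_normK (num_real (U y))) sqrrB.
    have -> : A ^+ M * Lam * (`|U y| / (2 * Lam)) *+ 2 = A ^+ M * `|U y|.
      by field; rewrite gt_eqF.
    have -> : (`|U y| / (2 * Lam)) ^+ 2 = (4 * Lam ^+ 2)^-1 * `|U y| ^+ 2.
      by field; rewrite gt_eqF.
    rewrite exprMn; lra.
  rewrite RintegralD//; last exact: integrable_Rscale.
  rewrite RintegralD//; last 2 first.
  - exact: finite_measure_integrable_cst.
  - exact: integrable_Rscale.
  rewrite Rintegral_cst// !RintegralZl// combination_square_integral -addrA lerD2l.
  have -> : B / 2 = (4 * Lam ^+ 2)^-1 * (Lam ^+ 2 * B) + B / 4.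
    by field; rewrite gt_eqF.
  apply: lerD.
    apply: ler_wpM2l; first by rewrite invr_ge0; apply: mulr_ge0 => //; exact: sqr_ge0.
    apply: le_trans (ler_wpM2l (sqr_ge0 Lam) (QB x)).
    rewrite big_distrr/=; apply: ler_sum => k _; rewrite exprMn mulrC.
    by rewrite ler_wpM2r ?sqr_ge0// lerXn2r ?nnegrE ?lam_ge0 ?(ltW L0)// lamLam.
  apply: le_trans (ler_wpM2l _ (Rintegral_excess_le x A1)) _.
    by rewrite mulr_ge0// ltW.
  rewrite (mulrC Lam) -mulrA ler_wpM2l// mulrA ler_pdivrMr// /A.
  by have := mulr_ge0 (ltW L0) C0; lra.
move=> x; have [B QB] : exists B, forall x, Q x <= B.
  exists (\sum_(k < N) b k ^+ 2) => y; apply: ler_sum => k _.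
  rewrite -(real_normK (num_real (eta k y))) lerXn2r ?nnegrE//.
  exact: le_trans (eta_bounded k y).
pose S := sup (range Q).
have QS y : Q y <= S.
  apply: ub_le_sup; last by exists y.
  by exists B => _ [z _ <-].
have : S <= (A ^+ M) ^+ 2 * Lam ^+ 2 * m + S / 2.
  apply: sup_le_ub; first by exists (Q x), x.
  by move=> _ [y _ <-]; exact: step.
by have := QS x; rewrite -/(Q x); lra.
Qed.

(** Integrating the bound on the sum of squares over the finite measure leaves [N] on the left, by
    orthonormality: only few eigenvalues can be small. *)
Lemma eigenvalue_count_le N (Lam : R) : 1 <= Lam ->
  (forall k, (k < N)%N -> lam k <= Lam) ->
  N%:R <= 2 * (((1 + 4 * Lam * C) ^+ M) ^+ 2 * Lam ^+ 2 * fine (mu setT)) *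
    fine (mu setT).
Proof.
move=> Lam1 lamLam.
have -> : N%:R = \sum_(k < N) \int[mu]_y (eta k y ^+ 2).
  under eq_bigr => k _ do [under eq_Rintegral do rewrite expr2];
    rewrite ?eta_orthonormal.
  under eq_bigr => k _ do rewrite eta_orthonormal eqxx.
  by rewrite sumr_const card_ord.
have i2 k : mu.-integrable setT (EFin \o (fun y => eta k y ^+ 2)).
  under eq_fun do rewrite expr2.
  exact: (integrableM_bounded (ieta k) (meta k) (eta_bounded k)).
rewrite -(Rintegral_sum (F := fun k y => eta k y ^+ 2))// -Rintegral_cst//.
apply: le_Rintegral => //.
- exact: (integrable_Rsum N i2).
- exact: finite_measure_integrable_cst.
- by move=> x _; exact: eigenfunction_square_sum_le.
Qed.

(** The exponent collects [((1 + 4 * Lam * C) ^+ M) ^+ 2 * Lam ^+ 2], with [Lam] the maximum of 1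
    and [lam k], and with [N = k + 1]. The last term of the sum of squares bounds [eta k], and the
    count bounds [k + 1]. *)
Lemma eigenfunction_growth : nondecreasing_seq lam -> exists D, exists b' : R^nat,
  [/\ 0 <= D, forall k, 0 <= b' k, forall k x, `|eta k x| <= b' k &
    forall k, k.+1%:R <= D * Num.max 1 (lam k) ^+ (2 * M + 2) /\
              b' k ^+ 2 <= D * Num.max 1 (lam k) ^+ (2 * M + 2)].
Proof.
move=> ndlam; set P := (2 * M + 2)%N; set m := fine (mu setT).
have m0 : 0 <= m by exact: fine_ge0.
pose L k := Num.max 1 (lam k).
have L1 k : 1 <= L k by rewrite le_max lexx.
have L0 k : 0 <= L k := le_trans ler01 (L1 k).
pose D0 := 2 * ((1 + 4 * C) ^+ M) ^+ 2 * m.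
have C41 : 0 <= 1 + 4 * C by rewrite addr_ge0// mulr_ge0.
have D00 : 0 <= D0 by apply: mulr_ge0 => //; apply: mulr_ge0 => //; exact: sqr_ge0.
have bound k : 2 * (((1 + 4 * L k * C) ^+ M) ^+ 2 * L k ^+ 2 * m) <= D0 * L k ^+ P.
  rewrite (_ : D0 * _ = 2 * ((((1 + 4 * C) * L k) ^+ M) ^+ 2 * L k ^+ 2 * m)).
    apply: ler_wpM2l => //; apply: ler_wpM2r => //; apply: ler_wpM2r; first exact: sqr_ge0.
    have h : 0 <= 1 + 4 * L k * C by rewrite addr_ge0// !mulr_ge0.
    rewrite lerXn2r ?nnegrE ?exprn_ge0 ?mulr_ge0//.
    rewrite lerXn2r ?nnegrE ?mulr_ge0//.
    by have := L1 k; lra.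
  rewrite /D0 /P exprD exprM exprAC !exprMn.
  by move: ((1 + 4 * C) ^+ M) (L k ^+ M) (L k) => a l x; ring.
have lamL k j : (j < k.+1)%N -> lam j <= L k.
  by rewrite ltnS => jk; rewrite le_max (ndlam _ _ jk) orbT.
have b'0 k : 0 <= D0 * L k ^+ P by rewrite mulr_ge0// exprn_ge0.
(* The count carries one more factor [m] than the bound on [eta k]; [1 + m] serves both. *)
exists (D0 * (1 + m)), (fun k => Num.sqrt (D0 * L k ^+ P)).
split; first by rewrite mulr_ge0// addr_ge0.
- by move=> k; exact: sqrtr_ge0.
- move=> k x; rewrite -sqrtr_sqr ler_wsqrtr//.
  apply: le_trans (bound k).
  apply: le_trans (eigenfunction_square_sum_le (L1 k) (lamL k) x).
  by rewrite big_ord_recr/= lerDr; apply: sumr_ge0 => j _; exact: sqr_ge0.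
- move=> k; rewrite sqr_sqrtr//; split.
    apply: le_trans (eigenvalue_count_le (L1 k) (lamL k)) _.
    apply: le_trans (ler_wpM2r m0 (bound k)) _.
    by have := mulr_ge0 m0 (b'0 k); have := b'0 k; lra.
  by have := mulr_ge0 m0 (b'0 k); lra.
Qed.

End growth.

End kernel.

(** * Summability of the heat series at positive times *)

Section growth_summable.
Context {R : realType}.

Lemma is_cvg_series_invn2 : cvgn (series (fun k : nat => (k.+1%:R ^+ 2)^-1 : R)).
Proof.
apply: nondecreasing_is_cvgn.
  by apply: nondecreasing_series => k _; rewrite invr_ge0 sqr_ge0.
exists 2 => _ [n _ <-]; rewrite /series/=.
case: n => [|n]; first by rewrite big_geq.
(* The telescoping correction makes the bound inductive. *)
suff h : \sum_(0 <= k < n.+1) (k.+1%:R ^+ 2)^-1 <= 2 - n.+1%:R^-1 :> R.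
  by apply: le_trans h _; rewrite gerBl invr_ge0.
elim: n => [|n ih]; first by rewrite big_nat1 expr1n invr1; lra.
rewrite big_nat_recr//=; apply: le_trans (lerD ih (lexx _)) _.
have n0 : (0 : R) < n.+1%:R by [].
rewrite -(natr1 n.+1); set x : R := n.+1%:R.
rewrite -/x in n0.
have -> : 2 - x^-1 + ((x + 1) ^+ 2)^-1 = 2 - (x + 1)^-1 - (x * (x + 1) ^+ 2)^-1.
  by field; rewrite !gt_eqF// addr_gt0.
by rewrite gerBl invr_ge0 mulr_ge0 ?sqr_ge0// ltW.
Qed.

(** The exponential beats every power of [lam k], and a power of [lam k] beats [k], so the terms are
    at most a multiple of the inverse square of [k + 1]. *)
Lemma growth_summable (lam b : R^nat) (D : R) P : (forall k, 0 <= lam k) ->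
  (forall k, k.+1%:R <= D * Num.max 1 (lam k) ^+ P /\
             b k ^+ 2 <= D * Num.max 1 (lam k) ^+ P) ->
  forall t, 0 < t -> cvgn (series (fun k => expR (- lam k * t) * b k ^+ 2)).
Proof.
(* Of the powers of [L k], [P] absorb [b k ^+ 2] and [2 * P] absorb the square of [k + 1]; the
   successor makes [J] a legitimate divisor. The choice of [c] gives [c * L k <= 1 + lam k * t / J],
   whose [J]-th power is below the exponential. *)
move=> lam0 hD t t0; pose J := (3 * P).+1; pose c : R := Num.min 1 (t / J%:R).
have J0 : (0 : R) < J%:R by [].
have c0 : 0 < c by rewrite lt_min ltr01 divr_gt0.
pose L k := Num.max 1 (lam k).
have L1 k : 1 <= L k by rewrite le_max lexx.
have L0 k : 0 < L k := lt_le_trans ltr01 (L1 k).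
have expE k : (c * L k) ^+ J <= expR (lam k * t).
  have -> : lam k * t = (lam k * t / J%:R) * J%:R by field; rewrite gt_eqF.
  rewrite [X in expR X]mulrC expRM_natl.
  apply: lerXn2r; rewrite ?nnegrE ?expR_ge0 ?mulr_ge0 ?(ltW c0) ?(ltW (L0 k))//.
  apply: le_trans (expR_ge1Dx _).
  have [l1|l1] := leP (lam k) 1.
    rewrite /L max_l// mulr1 (le_trans (_ : _ <= 1)) ?ge_min ?lexx//.
    by rewrite lerDl divr_ge0// mulr_ge0// ltW.
  rewrite /L max_r ?(ltW l1)// (le_trans (_ : _ <= lam k * t / J%:R)) ?lerDr//.
  by rewrite mulrC -mulrA ler_wpM2l ?lam0// ge_min lexx orbT.
pose u k := D * D ^+ 2 / c ^+ J * (k.+1%:R ^+ 2)^-1.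
apply: (@series_le_cvg _ _ u).
- by move=> k; rewrite mulr_ge0 ?expR_ge0 ?sqr_ge0.
- move=> k; rewrite mulr_ge0 ?invr_ge0 ?sqr_ge0//.
  have D0 : 0 <= D.
    have [h _] := hD 0%N; rewrite -(pmulr_lge0 _ (exprn_gt0 P (L0 0%N))).
    by apply: le_trans h.
  by rewrite divr_ge0 ?exprn_ge0 ?mulr_ge0 ?sqr_ge0// ltW.
- move=> k; have [h1 h2] := hD k; rewrite -/(L k) in h1 h2.
  have LP0 : 0 < L k ^+ P by rewrite exprn_gt0.
  have D0 : 0 <= D.
    by rewrite -(pmulr_lge0 _ LP0); apply: le_trans h1.
  rewrite mulNr expRN ler_pdivrMl ?expR_gt0//.
  apply: le_trans h2 _.
  have cJ : 0 < c ^+ J by rewrite exprn_gt0.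
  apply: (@le_trans _ _ ((c * L k) ^+ J * u k)); last first.
    apply: ler_wpM2r (expE k).
    by rewrite mulr_ge0 ?invr_ge0 ?sqr_ge0// divr_ge0 ?mulr_ge0 ?sqr_ge0// ltW.
  rewrite exprMn /u.
  rewrite [leRHS](_ : _ = D * (D ^+ 2 * L k ^+ J / k.+1%:R ^+ 2)); last first.
    have k0 : k.+1%:R != 0 :> R by rewrite pnatr_eq0.
    move: k0 (lt0r_neq0 cJ); move: (c ^+ J) (L k ^+ J) (k.+1%:R : R) => x y z z0 x0.
    by field; rewrite x0 z0.
  rewrite ler_wpM2l// ler_pdivlMr ?exprn_gt0//.
  apply: (@le_trans _ _ (L k ^+ P * (D * L k ^+ P) ^+ 2)).
    by rewrite ler_wpM2l ?(ltW LP0)// lerXn2r ?nnegrE ?mulr_ge0// ltW.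
  rewrite exprMn mulrCA ler_wpM2l ?sqr_ge0//.
  rewrite -exprM -exprD ler_weXn2l//.
  by rewrite /J; lia.
- by apply: is_cvg_seriesZ; exact: is_cvg_series_invn2.
Qed.

End growth_summable.

(** * Dirichlet series and heat kernels *)

Lemma nneseries_lty {R : realType} (v : R^nat) : (forall k, 0 <= v k) ->
  cvgn (series v) -> (\sum_(k <oo) (v k)%:E < +oo)%E.
Proof.
move=> v0 cv; rewrite (_ : (\sum_(k <oo) (v k)%:E)%E = (rsum v)%:E) ?ltry//.
rewrite /rsum -EFin_lim//.
by apply: congr_lim; apply/funext => n /=; rewrite /series/= sumEFin.
Qed.

Lemma integral_exponential_tail {R : realType} (l e : R) : 0 < l ->
  (\int[@lebesgue_measure R]_(x in `[e, +oo[) (expR (- l * x))%:E)%E =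
  (expR (- l * e) / l)%:E.
Proof.
move=> l0; have l_neq0 : l != 0 by rewrite gt_eqF.
pose F (x : R) : R := - (l^-1 * expR (- l * x)).
have dF (x : R) : is_derive x 1 F (expR (- l * x)).
  apply: is_derive_eq; rewrite /GRing.scale/=; move: (expR _) => y; field.
  by [].
have cF x : F y @[y --> x] --> F x.
  apply: differentiable_continuous; apply/derivable1_diffP.
  exact: (@ex_derive _ _ _ _ _ _ _ (dF x)).
rewrite (@ge0_continuous_FTC2y R _ F e 0).
- by rewrite sub0e -EFinN /F opprK mulrC.
- by move=> x _; rewrite expR_ge0.
- apply: continuous_subspaceT => x; apply: continuous_comp; last exact: continuous_expR.
  exact: mulrl_continuous.
- rewrite -oppr0 -[X in - X](mulr0 l^-1); apply: cvgN; apply: cvgMr.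
  rewrite (_ : (fun x => expR (- l * x)) =
               (fun z => expR (- z)) \o (fun z => l * z)); last first.
    by apply/funext => x; rewrite /= mulNr.
  apply: (@cvg_comp _ _ _ _ _ _ (pinfty_nbhs R)); last exact: cvgr_expR.
  exact: gt0_cvgMry.
- by move=> x _; exact: (@ex_derive _ _ _ _ _ _ _ (dF x)).
- exact/cvg_at_right_filter/cF.
- by move=> x _; rewrite derive1E derive_val.
Qed.

Section dirichlet.
Context {R : realType} (lam b : R^nat).
Hypotheses (lam0_gt0 : 0 < lam 0%N) (lam_ge : forall k, lam 0%N <= lam k)
  (b_sum : forall t, 0 < t -> cvgn (series (fun k => expR (- lam k * t) * b k ^+ 2))).
Implicit Types (c : R^nat) (t A : R).

Let lam_gt0 k : 0 < lam k. Proof. exact: lt_le_trans (lam_ge k). Qed.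

Definition dirichlet t c : R := rsum (fun k => expR (- lam k * t) * c k).

Lemma dirichlet_term_le A c t : (forall k, `|c k| <= A * b k ^+ 2) ->
  forall k, `|expR (- lam k * t) * c k| <= A * (expR (- lam k * t) * b k ^+ 2).
Proof.
move=> cA k; rewrite normrM (ger0_norm (expR_ge0 _)) mulrCA.
by apply: ler_wpM2l; [exact: expR_ge0|exact: cA].
Qed.

Lemma is_cvg_dirichlet_bound A t : 0 < t ->
  cvgn (series (fun k => A * (expR (- lam k * t) * b k ^+ 2))).
Proof. by move=> t0; apply: is_cvg_seriesZ; exact: b_sum. Qed.

Lemma is_cvg_dirichlet A c t : (forall k, `|c k| <= A * b k ^+ 2) -> 0 < t ->
  cvgn (series (fun k => expR (- lam k * t) * c k)).
Proof.
move=> cA t0.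
exact: (cvgP _ (cvg_rsum (dirichlet_term_le t cA) (is_cvg_dirichlet_bound t0))).
Qed.

Lemma dirichletB A A' c c' t : (forall k, `|c k| <= A * b k ^+ 2) ->
  (forall k, `|c' k| <= A' * b k ^+ 2) -> 0 < t ->
  dirichlet t (fun k => c k - c' k) = dirichlet t c - dirichlet t c'.
Proof.
move=> cA cA' t0; rewrite /dirichlet -rsumB.
- by apply: eq_rsum => k; rewrite mulrBr.
- exact: is_cvg_dirichlet cA t0.
- exact: is_cvg_dirichlet cA' t0.
Qed.

Lemma dirichletZ A c t r : (forall k, `|c k| <= A * b k ^+ 2) -> 0 < t ->
  dirichlet t (fun k => r * c k) = r * dirichlet t c.
Proof.
move=> cA t0; rewrite /dirichlet -rsumZ; last exact: is_cvg_dirichlet cA t0.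
by apply: eq_rsum => k; rewrite mulrCA.
Qed.

Lemma norm_dirichlet_le A c t : (forall k, `|c k| <= A * b k ^+ 2) -> 0 < t ->
  `|dirichlet t c| <= A * dirichlet t (fun k => b k ^+ 2).
Proof.
move=> cA t0; rewrite /dirichlet -rsumZ; last exact: b_sum.
by apply: norm_rsum_le; [exact: dirichlet_term_le|exact: is_cvg_dirichlet_bound].
Qed.

(** Time is split as [(t - 1) + 1]: the first part decays at the rate of the smallest eigenvalue,
    and one unit of time is kept for the summability of the series. *)
Lemma dirichlet_decay A c t : 0 <= A -> (forall k, `|c k| <= A * b k ^+ 2) -> 1 <= t ->
  `|dirichlet t c| <= expR (- lam 0%N * (t - 1)) * (A * dirichlet 1 (fun k => b k ^+ 2)).
Proof.
move=> A0 cA t1; rewrite /dirichlet -rsumZ; last exact: b_sum.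
rewrite -rsumZ; last exact: is_cvg_dirichlet_bound.
apply: norm_rsum_le; last first.
  by apply: is_cvg_seriesZ; exact: is_cvg_dirichlet_bound.
move=> k; apply: le_trans (dirichlet_term_le t cA k) _.
rewrite [leRHS](_ : _ = A * (expR (- lam 0%N * (t - 1)) *
  expR (- lam k * 1) * b k ^+ 2)); last by ring.
rewrite ler_wpM2l// ler_wpM2r ?sqr_ge0// -expRD ler_expR mulr1.
by rewrite !mulNr -opprD lerN2; have := lam_ge k; have := ler_wpM2r (_ : 0 <= t - 1) (lam_ge k); rewrite subr_ge0 => /(_ t1); lra.
Qed.

(** Integrating term by term divides the coefficients by [lam k], which is how time integrals of
    heat kernels become Green kernels. The lower end stays positive because summability is given at
    positive times; the majorants are summed with [lam 0 <= lam k]. *)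
Lemma integrable_dirichlet_tail A c e :
  (forall k, `|c k| <= A * b k ^+ 2) -> 0 < e ->
  (@lebesgue_measure R).-integrable `[e, +oo[ (fun s => (dirichlet s c)%:E) /\
  \int[@lebesgue_measure R]_(s in `[e, +oo[) dirichlet s c =
  dirichlet e (fun k => c k / lam k).
Proof.
move=> cA e0.
have mexp k : measurable_fun `[e, +oo[ (fun s : R => expR (- lam k * s)).
  by apply: measurableT_comp => //; exact: measurable_funM.
have s_gt0 s : `[e, +oo[%classic s -> 0 < s.
  by rewrite /= in_itv/= andbT => /(lt_le_trans e0).
have Ab0 k : 0 <= A * b k ^+ 2 by apply: le_trans (cA k).
have intexp k : (@lebesgue_measure R).-integrable `[e, +oo[ (fun s => (expR (- lam k * s))%:E).
  apply/integrableP; split; first by apply/measurable_EFinP; exact: mexp.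
  under eq_integral do rewrite gee0_abs ?lee_fin ?expR_ge0//.
  by rewrite integral_exponential_tail// ltry.
have F1 k : measurable_fun `[e, +oo[ (fun s => expR (- lam k * s) * c k).
  exact: measurable_funM.
have H1 k : measurable_fun `[e, +oo[ (fun s => A * (expR (- lam k * s) * b k ^+ 2)).
  by apply: measurable_funM => //; exact: measurable_funM.
have dom k s : `[e, +oo[%classic s ->
    `|expR (- lam k * s) * c k| <= A * (expR (- lam k * s) * b k ^+ 2).
  by move=> _; exact: dirichlet_term_le.
have cH s : `[e, +oo[%classic s ->
    cvgn (series (fun k => A * (expR (- lam k * s) * b k ^+ 2))).
  by move=> /s_gt0; exact: is_cvg_dirichlet_bound.
have sH : (\sum_(k <oo) \int[@lebesgue_measure R]_(s in `[e, +oo[)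
    (A * (expR (- lam k * s) * b k ^+ 2))%:E < +oo)%E.
  apply: (@le_lt_trans _ _ (\sum_(k <oo)
      ((lam 0%N)^-1 * (A * (expR (- lam k * e) * b k ^+ 2)))%:E)%E).
    apply: lee_nneseries => [k _ _|k _].
      by apply: integral_ge0 => s _; rewrite lee_fin mulrCA mulr_ge0// expR_ge0.
    under eq_integral do rewrite mulrCA mulrC EFinM.
    rewrite ge0_integralZl_EFin//; last by apply/measurable_EFinP; exact: mexp.
    rewrite integral_exponential_tail// -EFinM lee_fin.
    rewrite [leRHS](_ : _ = (A * b k ^+ 2) * (expR (- lam k * e) / lam 0%N)); last by ring.
    rewrite ler_wpM2l// ler_wpM2l ?expR_ge0// lef_pV2 ?posrE//.
  apply: nneseries_lty => [k|].
    by rewrite mulr_ge0 ?invr_ge0 ?(ltW lam0_gt0)// mulrCA mulr_ge0// expR_ge0.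
  by apply: is_cvg_seriesZ; exact: is_cvg_dirichlet_bound.
pose F k (s : R) := expR (- lam k * s) * c k.
pose H k (s : R) := A * (expR (- lam k * s) * b k ^+ 2).
split.
  exact: (@integrable_rsum _ _ R (@lebesgue_measure R) `[e, +oo[%classic
    (measurable_itv _) F H F1 H1 dom cH sH).
have /cvg_lim <- // : series (fun k => \int[@lebesgue_measure R]_(s in `[e, +oo[) F k s) @ \oo -->
    \int[@lebesgue_measure R]_(s in `[e, +oo[) dirichlet s c.
  exact: (@Rintegral_rsum _ _ R (@lebesgue_measure R) `[e, +oo[%classic
    (measurable_itv _) F H F1 H1 dom cH sH).
rewrite -/(rsum _); apply: eq_rsum => k; rewrite /F.
rewrite RintegralZr//; last exact: intexp.
by rewrite /Rintegral integral_exponential_tail//= mulrAC mulrA.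
Qed.

End dirichlet.

Section heat.
Context d (T : measurableType d) (R : realType).
Variables (mu : {finite_measure set T -> \bar R}).
Variables (eta : nat -> T -> R) (lam b : R^nat).
Hypotheses (lam0_gt0 : 0 < lam 0%N) (lam_ge : forall k, lam 0%N <= lam k)
  (b_sum : forall t, 0 < t -> cvgn (series (fun k => expR (- lam k * t) * b k ^+ 2)))
  (b_ge0 : forall k, 0 <= b k)
  (meta : forall k, measurable_fun setT (eta k))
  (eta_bounded : forall k x, `|eta k x| <= b k).
Local Notation leb := (@lebesgue_measure R).
Local Notation dirichlet := (dirichlet lam).
Implicit Types (v g : T -> R) (a : R^nat) (A B t e : R).

Definition coef v k : R := \int[mu]_y (v y * eta k y).

(** The coefficients are arbitrary: those of a function give its heat flow, [eta ^~ x] gives the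
    normalised heat kernel at [x], and the boundary values of the [eta k] give its boundary
    trace. *)
Definition heat t a y : R := dirichlet t (fun k => a k * eta k y).

Lemma integrable_Rnorm v : mu.-integrable setT (EFin \o v) ->
  mu.-integrable setT (EFin \o (fun x => `|v x|)).
Proof. exact: integrable_norm. Qed.

Lemma integrable_measurable v : mu.-integrable setT (EFin \o v) ->
  measurable_fun setT v.
Proof. by move=> iv; exact/measurable_EFinP/(measurable_int _ iv). Qed.

Lemma coef_le v k : mu.-integrable setT (EFin \o v) ->
  `|coef v k| <= \int[mu]_y `|v y| * b k.
Proof.
move=> iv.
have ive : mu.-integrable setT (EFin \o (fun y => v y * eta k y)).
  exact: (integrableM_bounded iv (meta k) (eta_bounded k)).
apply: le_trans (le_normr_Rintegral measurableT ive) _.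
rewrite -RintegralZr//; last exact: integrable_Rnorm.
apply: le_Rintegral => //.
- exact: integrable_Rnorm.
- by apply: (integrableM_bounded (B := `|b k|)) => //; exact: integrable_Rnorm.
- by move=> y _; rewrite normrM ler_wpM2l.
Qed.

Lemma coef_mul_le v g k : mu.-integrable setT (EFin \o v) ->
  mu.-integrable setT (EFin \o g) ->
  `|coef v k * coef g k| <= (\int[mu]_y `|v y| * \int[mu]_y `|g y|) * b k ^+ 2.
Proof.
by move=> iv ig; rewrite normrM expr2 mulrACA ler_pM// coef_le.
Qed.

Lemma heat_term_le A a y : (forall k, `|a k| <= A * b k) ->
  forall k, `|a k * eta k y| <= A * b k ^+ 2.
Proof. by move=> aA k; rewrite normrM expr2 mulrA ler_pM. Qed.

Let exp_term_le A a t y : (forall k, `|a k| <= A * b k) ->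
  forall k, `|expR (- lam k * t) * (a k * eta k y)| <=
    A * (expR (- lam k * t) * b k ^+ 2).
Proof.
move=> aA k; exact: (@dirichlet_term_le _ lam b A _ t (heat_term_le y aA)).
Qed.

Lemma measurable_heat2 A a : (forall k, `|a k| <= A * b k) ->
  measurable_fun ((`]0, +oo[%classic : set R) `*` [set: T]) (fun p : R * T => heat p.1 a p.2).
Proof.
move=> aA.
apply: (@measurable_rsum _ _ _ _
  (fun k (p : R * T) => expR (- lam k * p.1) * (a k * eta k p.2))
  (fun k (p : R * T) => A * (expR (- lam k * p.1) * b k ^+ 2))).
- move=> k; apply: measurable_funM.
    apply: measurableT_comp => //; apply: measurable_funM => //.
    exact: measurable_funTS.
  apply: measurable_funM => //; apply: measurable_funTS.
  exact: (measurableT_comp (meta k)).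
- by move=> k p _; exact: exp_term_le.
- move=> p [/=]; rewrite in_itv/= andbT => p0 _.
  exact: is_cvg_dirichlet_bound.
Qed.

Lemma measurable_heat A a t : (forall k, `|a k| <= A * b k) -> 0 < t ->
  measurable_fun setT (heat t a).
Proof.
move=> aA t0.
apply: (@measurable_rsum _ _ _ _
  (fun k y => expR (- lam k * t) * (a k * eta k y))
  (fun k y => A * (expR (- lam k * t) * b k ^+ 2))) => //.
- by move=> k; apply: measurable_funM => //; exact: measurable_funM.
- by move=> k p _; exact: exp_term_le.
- by move=> p _; exact: is_cvg_dirichlet_bound.
Qed.

Lemma heat_bounded A a t y : (forall k, `|a k| <= A * b k) -> 0 < t ->
  `|heat t a y| <= A * dirichlet t (fun k => b k ^+ 2).
Proof.
by move=> aA t0; apply: (norm_dirichlet_le b_sum) => //; exact: heat_term_le.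
Qed.

(** The absolutely convergent series may be integrated against [v] term by term. Signs and
    comparisons of heat flows are all tested through this pairing. *)
Lemma integral_heat A a v t : (forall k, `|a k| <= A * b k) ->
  mu.-integrable setT (EFin \o v) -> 0 < t ->
  \int[mu]_y (heat t a y * v y) = dirichlet t (fun k => a k * coef v k).
Proof.
move=> aA iv t0; have mv := integrable_measurable iv.
have A0 : 0 <= A * b 0%N by apply: le_trans (aA 0%N).
pose F k y := expR (- lam k * t) * (a k * eta k y) * v y.
pose H k y := A * (expR (- lam k * t) * b k ^+ 2) * `|v y|.
have F1 k : measurable_fun setT (F k).
  by apply: measurable_funM => //; apply: measurable_funM => //; exact: measurable_funM.
have H1 k : measurable_fun setT (H k).
  by apply: measurable_funM => //; exact: measurableT_comp.
have FH k x : [set: T] x -> `|F k x| <= H k x.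
  move=> _; rewrite /F normrM ler_wpM2r//.
  by exact: exp_term_le.
have Ab0 k : 0 <= A * (expR (- lam k * t) * b k ^+ 2).
  rewrite mulrCA mulr_ge0 ?expR_ge0// expr2 mulrA mulr_ge0//.
  exact: le_trans (aA k).
have cH x : [set: T] x -> cvgn (series (H ^~ x)).
  move=> _; rewrite (_ : H ^~ x = `|v x| *: (fun k => A * (expR (- lam k * t) * b k ^+ 2))).
    by apply: is_cvg_seriesZ; exact: is_cvg_dirichlet_bound.
  by apply/funext => k; rewrite /H mulrC.
have iH : (\sum_(k <oo) \int[mu]_x (H k x)%:E < +oo)%E.
  apply: (@le_lt_trans _ _ (\sum_(k <oo)
      (\int[mu]_x `|v x| * (A * (expR (- lam k * t) * b k ^+ 2)))%:E)%E).
    apply: lee_nneseries => [k _ _|k _].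
      by apply: integral_ge0 => y _; rewrite lee_fin mulr_ge0.
    under eq_integral do rewrite EFinM.
    rewrite ge0_integralZl_EFin//; last by apply/measurable_EFinP; exact: measurableT_comp.
    rewrite muleC EFinM fineK//.
    exact: (integrable_fin_num measurableT (integrable_Rnorm iv)).
  apply: nneseries_lty => [k|].
    by rewrite mulr_ge0// Rintegral_ge0.
  by apply: is_cvg_seriesZ; exact: is_cvg_dirichlet_bound.
have /cvg_lim h := Rintegral_rsum measurableT F1 H1 FH cH iH.
transitivity (\int[mu]_y rsum (F ^~ y)).
  apply: eq_Rintegral => y _; rewrite mulrC /heat /dirichlet -rsumZ.
    by apply: eq_rsum => k; rewrite /F mulrC.
  exact: is_cvg_dirichlet (heat_term_le y aA) t0.
rewrite -h//; apply: eq_rsum => k; rewrite /F.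
have iev : mu.-integrable setT (EFin \o (fun y => v y * eta k y)).
  exact: (integrableM_bounded iv (meta k) (eta_bounded k)).
rewrite (_ : expR _ * _ = expR (- lam k * t) * a k * coef v k); last by rewrite mulrA.
by rewrite -RintegralZl//; apply: eq_Rintegral => y _; ring.
Qed.

Lemma max0_bounded (f : T -> R) B : measurable_fun setT f ->
  (forall x, `|f x| <= B) ->
  measurable_fun setT (fun y => Num.max (f y) 0) /\
  forall y, 0 <= Num.max (f y) 0 <= B.
Proof.
move=> mf fB; split=> [|y]; first exact: measurable_maxr.
rewrite le_max lexx orbT/= ge_max (le_trans (ler_norm _))//=.
exact: le_trans (fB y).
Qed.

(** Against its own positive part, [f] integrates to the square of that part. *)
Lemma ae_le0_test (f : T -> R) B : measurable_fun setT f ->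
  (forall x, `|f x| <= B) -> \int[mu]_y (f y * Num.max (f y) 0) <= 0 ->
  {ae mu, forall y, f y <= 0}.
Proof.
move=> mf fB; pose g y := Num.max (f y) 0.
have [mg gB] := max0_bounded mf fB.
have gB' y : `|g y| <= B by case/andP: (gB y) => g0 ?; rewrite ger0_norm.
have ig := bounded_integrable mu mg gB'.
have -> : \int[mu]_y (f y * Num.max (f y) 0) = \int[mu]_y (g y ^+ 2).
  apply: eq_Rintegral => y _; rewrite /g.
  by case: (leP (f y) 0) => h; rewrite ?mulr0 ?expr0n ?expr2.
move=> g2.
have ig2 : mu.-integrable setT (EFin \o (fun y => g y ^+ 2)).
  by under eq_fun do rewrite expr2; exact: (integrableM_bounded ig mg gB').
have : ae_eq mu setT (EFin \o (fun y => g y ^+ 2)) (cst 0%E).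
  apply/ae_eq_integral_abs => //; first exact: measurable_int ig2.
  rewrite (eq_integral (fun y => (g y ^+ 2)%:E)); last first.
    by move=> y _; rewrite gee0_abs// lee_fin sqr_ge0.
  apply/eqP; rewrite eq_le; apply/andP; split; last first.
    by apply: integral_ge0 => y _; rewrite lee_fin sqr_ge0.
  by rewrite -(fineK (integrable_fin_num measurableT ig2)) lee_fin.
apply: filterS => y /(_ I) /= [] /eqP; rewrite sqrf_eq0 => /eqP gy.
by rewrite -gy /g le_max lexx.
Qed.

Hypothesis parseval : forall v B, measurable_fun setT v ->
  (forall x, `|v x| <= B) ->
  series (fun k => coef v k ^+ 2) @ \oo --> \int[mu]_y (v y ^+ 2).

Lemma coefD v g k : mu.-integrable setT (EFin \o v) ->
  mu.-integrable setT (EFin \o g) ->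
  coef (fun y => v y + g y) k = coef v k + coef g k.
Proof.
move=> iv ig; rewrite /coef -RintegralD//; last 2 first.
- exact: (integrableM_bounded iv (meta k) (eta_bounded k)).
- exact: (integrableM_bounded ig (meta k) (eta_bounded k)).
by apply: eq_Rintegral => y _; rewrite mulrDl.
Qed.

(** Polarisation of the Parseval identity. *)
Lemma parseval_pair v g B B' : measurable_fun setT v -> measurable_fun setT g ->
  (forall x, `|v x| <= B) -> (forall x, `|g x| <= B') ->
  series (fun k => coef v k * coef g k) @ \oo --> \int[mu]_y (v y * g y).
Proof.
move=> mv mg vB gB.
have iv := bounded_integrable mu mv vB.
have ig := bounded_integrable mu mg gB.
have vgB x : `|v x + g x| <= B + B' by rewrite (le_trans (ler_normD _ _))// lerD.
have h1 := parseval mv vB; have h2 := parseval mg gB.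
have h3 := parseval (measurable_funD mv mg) vgB.
have i1 : mu.-integrable setT (EFin \o (fun y => v y ^+ 2)).
  by under eq_fun do rewrite expr2; exact: (integrableM_bounded iv mv vB).
have i2 : mu.-integrable setT (EFin \o (fun y => g y ^+ 2)).
  by under eq_fun do rewrite expr2; exact: (integrableM_bounded ig mg gB).
have i12 : mu.-integrable setT (EFin \o (fun y => v y * g y)).
  exact: (integrableM_bounded iv mg gB).
rewrite (_ : \int[mu]_y (v y * g y) = 2^-1 *: (\int[mu]_y (v y + g y) ^+ 2 -
    \int[mu]_y (v y ^+ 2) - \int[mu]_y (g y ^+ 2))); last first.
  under [in RHS]eq_Rintegral do rewrite sqrrD.
  rewrite RintegralD//; last by apply: integrable_Radd => //; exact: (integrable_Radd measurableT i12 i12).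
  rewrite RintegralD//; last by exact: (integrable_Radd measurableT i12 i12).
  under [X in _ + X + _ - _ - _]eq_Rintegral do rewrite mulr2n.
  by rewrite RintegralD// /GRing.scale/=; field.
rewrite (_ : series _ = fun n => 2^-1 *: (series (fun k => coef (fun y => v y + g y) k ^+ 2) n -
    series (fun k => coef v k ^+ 2) n - series (fun k => coef g k ^+ 2) n)).
  by apply: cvgZr; apply: cvgB => //; exact: cvgB.
apply/funext => n; rewrite /series/= -!sumrB /GRing.scale/= big_distrr/=.
by apply: eq_bigr => k _; rewrite coefD//; field.
Qed.

(** The terms are dominated by half the sum of the squared coefficients, summable by Parseval. Both
    functions are bounded here; [dirichlet_weak_cvg0] replaces [g] by an integrable function. *)
Lemma dirichlet_cvg0 v g B B' : measurable_fun setT v -> measurable_fun setT g ->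
  (forall x, `|v x| <= B) -> (forall x, `|g x| <= B') ->
  dirichlet e (fun k => coef v k * coef g k) @[e --> 0^'+] --> \int[mu]_y (v y * g y).
Proof.
move=> mv mg vB gB.
have <- : rsum (fun k => coef v k * coef g k) = \int[mu]_y (v y * g y).
  by apply/cvg_lim => //; exact: parseval_pair vB gB.
apply: (@cvg_rsum_dominated _ _ _ _ _ _
    (2^-1 *: (fun k => coef v k ^+ 2 + coef g k ^+ 2))).
- move=> k; rewrite -[X in _ --> X]mul1r; apply: cvgM; last exact: cvg_cst.
  apply: cvg_at_right_filter; rewrite -expR0 -[X in expR X](mulr0 (- lam k)).
  apply: continuous_cvg; first exact: continuous_expR.
  by apply: cvgMr; exact: cvg_id.
- near=> e => k; rewrite normrM ger0_norm ?expR_ge0//.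
  have e0 : 0 < e by near: e; exact: nbhs_right_gt.
  apply: (@le_trans _ _ (1 * `|coef v k * coef g k|)).
    rewrite ler_wpM2r// -expR0 ler_expR mulNr oppr_le0 mulr_ge0 ?ltW//.
    exact: lt_le_trans (lam_ge k).
  rewrite mul1r normrM.
  rewrite [leRHS](_ : _ = 2^-1 * (coef v k ^+ 2 + coef g k ^+ 2))//.
  rewrite -(real_normK (num_real (coef v k))) -(real_normK (num_real (coef g k))).
  by have := sqr_ge0 (`|coef v k| - `|coef g k|); rewrite sqrrB; lra.
- apply: is_cvg_seriesZ; apply: is_cvg_seriesD.
    exact: cvgP _ (parseval mv vB).
  exact: cvgP _ (parseval mg gB).
Unshelve. all: by end_near. Qed.

Hypothesis heat_ge0 : forall t B v, 0 < t -> measurable_fun setT v ->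
  (forall x, 0 <= v x <= B) -> forall y, 0 <= heat t (coef v) y.

(** The pairing of the kernel at [x] with a nonnegative bounded [g] is the heat flow of [g] at [x],
    hence nonnegative. Taking for [g] the negative part of the kernel forces that part to vanish
    almost everywhere. *)
Lemma heat_eigen_ae_ge0 t x : 0 < t ->
  {ae mu, forall y, 0 <= heat t (eta ^~ x) y}.
Proof.
move=> t0.
have eb k : `|eta k x| <= 1 * b k by rewrite mul1r.
have mh := measurable_heat eb t0; have hb y := heat_bounded y eb t0.
pose f y := - heat t (eta ^~ x) y.
have mf : measurable_fun setT f.
  by rewrite (_ : f = (fun y => -1 * heat t (eta ^~ x) y));
    [exact: measurable_funM|apply/funext => y; rewrite mulN1r].
have fb y : `|f y| <= 1 * dirichlet t (fun k => b k ^+ 2) by rewrite normrN.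
have [mg gB] := max0_bounded mf fb.
have ig : mu.-integrable setT (EFin \o (fun y => Num.max (f y) 0)).
  apply: (bounded_integrable mu mg (B := 1 * dirichlet t (fun k => b k ^+ 2))) => y.
  by case/andP: (gB y) => g0 ?; rewrite ger0_norm.
have : {ae mu, forall y, f y <= 0}.
  apply: (ae_le0_test mf fb).
  under eq_Rintegral do rewrite /f mulNr -mulN1r.
  rewrite RintegralZl//; last first.
    apply: (integrableM_bounded (bounded_integrable mu mh hb) mg) => y.
    by case/andP: (gB y) => g0 gb; rewrite ger0_norm//; exact: gb.
  rewrite (integral_heat eb ig t0) mulN1r oppr_le0.
  have := heat_ge0 t0 mg gB x; rewrite /heat.
  by congr (_ <= _); apply: eq_rsum => k; rewrite mulrCA (mulrC (eta k x)) mulrCA.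
by apply: filterS => y; rewrite oppr_le0.
Qed.

Let norm_itv (B x : R) : 0 <= x <= B -> `|x| <= B.
Proof. by move=> /andP[x0 xB]; rewrite ger0_norm. Qed.

Let coefb v B : measurable_fun setT v -> (forall x, `|v x| <= B) ->
  forall k, `|coef v k| <= \int[mu]_y `|v y| * b k.
Proof. by move=> mv vB k; apply: coef_le; exact: bounded_integrable mv vB. Qed.

Section supersolution.
Variables (psi : T -> R) (c1 C1 : R).
Hypotheses (mpsi : measurable_fun setT psi) (psi_le : forall x, 0 <= psi x <= C1)
  (c1_gt0 : 0 < c1) (psi_ge : {ae mu, forall x, c1 <= psi x})
  (coef_psi : forall k, coef psi k = coef (cst 1) k / lam k).

Let psi_norm x : `|psi x| <= C1. Proof. exact: norm_itv. Qed.

Let ipsi : mu.-integrable setT (EFin \o psi).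
Proof. exact: bounded_integrable mpsi psi_norm. Qed.

Let i1 : mu.-integrable setT (EFin \o cst 1).
Proof. exact: finite_measure_integrable_cst. Qed.

(** The coefficients of [psi] are those of 1 divided by [lam k], so the pairing is the integral over
    [[e, +oo[] of pairings of the heat flow of 1 with [g], which are nonnegative. It therefore grows
    as [e] decreases, and its limit at 0 is the right-hand side. *)
Let heat_psi_test e B g : 0 < e -> measurable_fun setT g ->
  (forall x, 0 <= g x <= B) ->
  \int[mu]_y (heat e (coef psi) y * g y) <= \int[mu]_y (psi y * g y).
Proof.
move=> e0 mg gB; have gB' x := norm_itv (gB x).
have ig := bounded_integrable mu mg gB'.
rewrite (integral_heat (coefb mpsi psi_norm))//.
apply: (@ler_cvg_to _ 0^'+ _ _ (cst (dirichlet e (fun k => coef psi k * coef g k)))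
   _ _ _ (cvg_cst _) (dirichlet_cvg0 mpsi mg psi_norm gB')).
near=> e'.
have e'0 : 0 < e' by near: e'; exact: nbhs_right_gt.
have e'e : e' <= e by near: e'; exact: nbhs_right_le.
pose c k := coef (cst 1) k * coef g k.
have cE : (fun k => coef psi k * coef g k) = (fun k => c k / lam k).
  by apply/funext => k; rewrite coef_psi /c mulrAC.
have cb k := coef_mul_le k i1 ig.
have [h1 h1'] := integrable_dirichlet_tail lam0_gt0 lam_ge b_sum cb e0.
have [h2 h2'] := integrable_dirichlet_tail lam0_gt0 lam_ge b_sum cb e'0.
rewrite /cst/= cE -h1' -h2' -lee_fin !fineK; last 2 first.
- by apply: integrable_fin_num.
- by apply: integrable_fin_num.
apply: ge0_subset_integral => //.
- exact: measurable_int h2.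
- move=> s; rewrite /= in_itv/= andbT => es; have s0 := lt_le_trans e'0 es.
  rewrite lee_fin -(integral_heat (A := \int[mu]_y `|cst 1 y|))//; last first.
    by move=> k; exact: coef_le.
  apply: Rintegral_ge0 => y _; apply: mulr_ge0; last by case/andP : (gB y).
  apply: (heat_ge0 (B := 1)) => //= x; by rewrite ler01 lexx.
- by move=> s; rewrite /= !in_itv/= !andbT; exact: le_trans.
Unshelve. all: by end_near. Qed.

Let heat_psi_le e : 0 < e -> {ae mu, forall y, heat e (coef psi) y <= psi y}.
Proof.
move=> e0; pose f y := heat e (coef psi) y - psi y.
have cb := coefb mpsi psi_norm.
have mh := measurable_heat cb e0.
have mf : measurable_fun setT f by exact: measurable_funB.
pose D := \int[mu]_y `|psi y| * dirichlet e (fun k => b k ^+ 2).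
have hD y : `|heat e (coef psi) y| <= D by exact: heat_bounded.
have fD y : `|f y| <= D + C1 by rewrite (le_trans (ler_normB _ _))// lerD.
have [mg gD] := max0_bounded mf fD.
have gD' x := norm_itv (gD x).
have ihg : mu.-integrable setT (EFin \o (fun y => heat e (coef psi) y * Num.max (f y) 0)).
  exact: (integrableM_bounded (bounded_integrable mu mh hD) mg gD').
have ipg : mu.-integrable setT (EFin \o (fun y => psi y * Num.max (f y) 0)).
  exact: (integrableM_bounded ipsi mg gD').
have : {ae mu, forall y, f y <= 0}.
  apply: (ae_le0_test mf fD); have := heat_psi_test e0 mg gD.
  rewrite -subr_le0 -RintegralB//; apply: le_trans; rewrite le_eqVlt.
  by apply/orP; left; apply/eqP; apply: eq_Rintegral => y _; rewrite -mulrBl.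
by apply: filterS => y; rewrite subr_le0.
Qed.

(** [c1^-1 * psi - v] is nonnegative almost everywhere, so the flow of [v] stays below that of
    [c1^-1 * psi], and [psi] decreases under the flow. The positive part [w] repairs the null set
    where [psi >= c1] may fail, as [heat_ge0] asks for a sign at every point. *)
Let heat_ae_le e v : 0 < e -> measurable_fun setT v ->
  (forall x, 0 <= v x <= 1) ->
  {ae mu, forall y, heat e (coef v) y <= C1 / c1}.
Proof.
move=> e0 mv v01; have v1 x := norm_itv (v01 x).
have iv := bounded_integrable mu mv v1.
pose w y := Num.max (c1^-1 * psi y - v y) 0.
have mw : measurable_fun setT w.
  by apply: measurable_maxr => //; apply: measurable_funB => //; exact: measurable_funM.
have w1 y : 0 <= w y <= c1^-1 * C1.
  rewrite le_max lexx orbT/= ge_max; apply/andP; split.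
    rewrite lerBlDr (le_trans (_ : _ <= c1^-1 * C1)) ?lerDl//.
      by rewrite ler_wpM2l ?invr_ge0 ?(ltW c1_gt0)//; case/andP : (psi_le y).
    by case/andP : (v01 y).
  rewrite mulr_ge0 ?invr_ge0 ?(ltW c1_gt0)//.
  by case/andP : (psi_le y); exact: le_trans.
have icp : mu.-integrable setT (EFin \o (fun y => c1^-1 * psi y)).
  exact: integrable_Rscale.
have coefw k : coef w k = c1^-1 * coef psi k - coef v k.
  rewrite /coef -RintegralZl//; last exact: (integrableM_bounded ipsi (meta k) (eta_bounded k)).
  rewrite -RintegralB//; last 2 first.
  - exact: (integrable_Rscale _ measurableT (integrableM_bounded ipsi (meta k) (eta_bounded k))).
  - exact: (integrableM_bounded iv (meta k) (eta_bounded k)).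
  rewrite /Rintegral; congr fine; apply: ae_eq_integral => //.
  - by apply/measurable_EFinP; exact: measurable_funM.
  - apply/measurable_EFinP; apply: measurable_funB; last exact: measurable_funM.
    by apply: measurable_funM => //; exact: measurable_funM.
  - apply: filterS psi_ge => y py _; congr EFin; rewrite mulrA -mulrBl /w.
    rewrite max_l// subr_ge0 (le_trans (_ : _ <= 1))//; first by case/andP : (v01 y).
    by rewrite ler_pdivlMl// mulr1.
have hw y := heat_ge0 e0 mw w1 y.
have hv y : heat e (coef v) y <= c1^-1 * heat e (coef psi) y.
  rewrite -subr_ge0 -(dirichletZ b_sum (A := \int[mu]_y `|psi y|))//; last first.
    exact: (heat_term_le _ (coefb mpsi psi_norm)).
  rewrite -(dirichletB b_sum (A := c1^-1 * \int[mu]_y `|psi y|) (A' := \int[mu]_y `|v y|))//.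
  - rewrite (_ : (fun k => _) = (fun k => coef w k * eta k y)); first exact: hw.
    by apply/funext => k; rewrite coefw mulrBl mulrA.
  - move=> k; rewrite normrM ger0_norm ?invr_ge0 ?(ltW c1_gt0)// -mulrA.
    rewrite ler_wpM2l ?invr_ge0 ?(ltW c1_gt0)//.
    exact: (heat_term_le _ (coefb mpsi psi_norm)).
  - exact: (heat_term_le _ (coefb mv v1)).
apply: filterS (heat_psi_le e0) => y hy.
apply: le_trans (hv y) _; rewrite mulrC ler_wpM2r ?invr_ge0 ?(ltW c1_gt0)//.
by apply: le_trans hy _; case/andP : (psi_le y).
Qed.

(* The supersolution psi keeps the heat flow of a bounded function bounded
   uniformly in time, so that L^2 convergence as e tends to 0 extends to
   pairings with an integrable g. *)
Lemma dirichlet_weak_cvg0 v g : measurable_fun setT v ->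
  (forall x, 0 <= v x <= 1) -> (forall x, 0 <= g x) ->
  mu.-integrable setT (EFin \o g) ->
  dirichlet e (fun k => coef v k * coef g k) @[e --> 0^'+] --> \int[mu]_y (v y * g y).
Proof.
move=> mv v01 g0 ig; have mg := integrable_measurable ig.
have v1 x := norm_itv (v01 x).
have cb := coefb mv v1.
have C10 : 0 <= C1 / c1.
  have /andP[p0 p1] := psi_le point; rewrite divr_ge0 ?(ltW c1_gt0)//.
  exact: le_trans p1.
(* [D] bounds the distance of [v] to its heat flow almost everywhere, at every positive time, so
   cutting [g] at height [n] costs at most [D] times the integral of [g - gn n], whatever the
   time. *)
pose D := C1 / c1 + 1; have D0 : 0 < D by rewrite ltr_wpDl.
pose gn n x := Num.min (g x) n%:R.
have gn_le n x : gn n x <= g x by rewrite ge_min lexx.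
have gn0 n x : 0 <= gn n x by rewrite le_min g0/=.
have gnn n x : 0 <= gn n x <= n%:R by rewrite gn0 ge_min lexx orbT.
have gnn' n x := norm_itv (gnn n x).
have mgn n : measurable_fun setT (gn n) by exact: measurable_minr.
have ign n := bounded_integrable mu (mgn n) (gnn' n).
have cvgn_gn : (\int[mu]_x (gn n x)%:E)%E @[n --> \oo] --> (\int[mu]_x (g x)%:E)%E.
  apply: (@dominated_cvg _ _ _ _ _ measurableT _ _ (EFin \o g)) => //.
  - by move=> n; exact/measurable_EFinP.
  - move=> x _; apply: cvg_near_cst.
    have := nbhs_infty_ger (g x).
    by apply: filterS => n gxn; rewrite /gn min_l.
  - by move=> n x _; rewrite /= lee_fin ger0_norm ?gn_le.
have {}cvgn_gn : \int[mu]_x gn n x @[n --> \oo] --> \int[mu]_x g x.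
  apply: fine_cvg; rewrite fineK//; exact: (integrable_fin_num measurableT ig).
apply/cvgrPdist_le => e e0.
have e2 : 0 < e / 2 / D by rewrite !divr_gt0.
have [n _ /(_ n (leqnn n)) gnE] : \forall n \near \oo,
    `|\int[mu]_x g x - \int[mu]_x gn n x| <= e / 2 / D.
  by move/cvgrPdist_le : cvgn_gn; exact.
have /cvgrPdist_le/(_ _ (divr_gt0 e0 (ltr0Sn _ 1))) := dirichlet_cvg0 mv (mgn n) v1 (gnn' n).
move=> vgn; near=> t.
have t0 : 0 < t by near: t; exact: nbhs_right_gt.
have mh := measurable_heat cb t0.
have hb y := heat_bounded y cb t0.
rewrite -(integral_heat cb ig t0).
have : `|\int[mu]_y (v y * gn n y) - dirichlet t (fun k => coef v k * coef (gn n) k)| <= e / 2.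
  by near: t.
rewrite -(integral_heat cb (ign n) t0).
have ivg : mu.-integrable setT (EFin \o (fun y => v y * g y)).
  by under eq_fun do rewrite mulrC; exact: (integrableM_bounded ig mv v1).
have ivgn : mu.-integrable setT (EFin \o (fun y => v y * gn n y)).
  by under eq_fun do rewrite mulrC; exact: (integrableM_bounded (ign n) mv v1).
have ihg : mu.-integrable setT (EFin \o (fun y => heat t (coef v) y * g y)).
  by under eq_fun do rewrite mulrC; exact: (integrableM_bounded ig mh hb).
have ihgn : mu.-integrable setT (EFin \o (fun y => heat t (coef v) y * gn n y)).
  by under eq_fun do rewrite mulrC; exact: (integrableM_bounded (ign n) mh hb).
have idg := integrable_Rsub measurableT ig (ign n).
move: gnE; rewrite -RintegralB// ger0_norm; last first.
  by apply: Rintegral_ge0 => x _; rewrite subr_ge0.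
move=> gnE; rewrite -!RintegralB// => hn.
pose F y := (g y - gn n y) * (v y - heat t (coef v) y).
have iF : mu.-integrable setT (EFin \o F).
  apply: (integrableM_bounded idg); first exact: measurable_funB.
  by move=> y; rewrite (le_trans (ler_normB _ _))//; apply: lerD; [exact: v1|exact: hb].
rewrite (_ : \int[mu]_y (v y * g y - heat t (coef v) y * g y) =
   \int[mu]_y (v y * gn n y - heat t (coef v) y * gn n y) + \int[mu]_y F y); last first.
  rewrite -RintegralD//; last exact: integrable_Rsub.
  by apply: eq_Rintegral => y _; rewrite /F; ring.
rewrite (splitr e) (le_trans (ler_normD _ _))// lerD//.
apply: le_trans (le_normr_Rintegral measurableT iF) _.
apply: (@le_trans _ _ (\int[mu]_y (D * (g y - gn n y)))); last first.
  by rewrite RintegralZl// mulrC -ler_pdivlMr.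
have iF' := integrable_Rnorm iF.
have iD := integrable_Rscale D measurableT idg.
rewrite -lee_fin !fineK; last 2 first.
- exact: (integrable_fin_num measurableT iD).
- exact: (integrable_fin_num measurableT iF').
apply: ae_ge0_le_integral => //.
- exact: measurable_int iF'.
- by move=> y _; rewrite lee_fin mulr_ge0 ?(ltW D0)// subr_ge0.
- exact: measurable_int iD.
apply: filterS (heat_ae_le t0 mv v01) => y hy _.
rewrite lee_fin normrM (ger0_norm (_ : 0 <= g y - _)) ?subr_ge0//.
rewrite mulrC ler_wpM2r ?subr_ge0// /D.
have := heat_ge0 t0 mv v01 y; have := v01 y; case/andP => ? ? ?.
by rewrite ler_norml; apply/andP; split; lra.
Unshelve. all: by end_near. Qed.

(* Tested against 0 <= v <= 1, the time integral over `[e, +oo[ equals the pairing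
   of the coefficients of v and g damped by expR (- lam e), which tends to the
   integral of v g as e tends to 0. *)
Lemma heat_integral a g : (forall k, `|a k| <= b k) -> (forall x, 0 <= g x) ->
  mu.-integrable setT (EFin \o g) -> (forall k, coef g k = a k / lam k) ->
  (forall s y, 0 < s -> 0 <= heat s a y) ->
  {ae mu, forall y, (\int[leb]_(s in `]0%R, +oo[) (heat s a y)%:E = (g y)%:E)%E}.
Proof.
move=> ab g0 ig ga h0.
have ab' k : `|a k| <= 1 * b k by rewrite mul1r.
pose D := (`]0, +oo[%classic : set R) `*` [set: T].
have mD : measurable D by apply: measurableX.
(* Extended by 0 to nonpositive times, where the series is not controlled, so that Tonelli applies
   on the full product. *)
pose Q := (fun p : R * T => (heat p.1 a p.2)%:E) \_ D.
have mQ : measurable_fun setT Q.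
  by apply/(measurable_restrictT _ mD)/measurable_EFinP; exact: measurable_heat2.
have QE s y : Q (s, y) = ((fun s => (heat s a y)%:E) \_ `]0, +oo[) s.
  rewrite /Q /D /patch; congr (if _ then _ else _).
  by apply/idP/idP; rewrite !inE /=; [case|].
have Q0 p : (0 <= Q p)%E.
  rewrite /Q /patch; case: ifPn => //; rewrite inE /D/= in_itv/= andbT => -[p0 _].
  by rewrite lee_fin h0.
have GE y : (\int[leb]_(s in `]0%R, +oo[) (heat s a y)%:E = \int[leb]_s Q (s, y))%E.
  by rewrite integral_mkcond; apply: eq_integral => s _; rewrite QE.
have mG : measurable_fun setT (fun y => \int[leb]_s Q (s, y))%E.
  exact: (measurable_fun_fubini_tonelli_G (m1 := leb) _ mQ Q0).
(* It suffices to compare the integrals over every measurable set, that is, to test against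
   indicators. *)
have : ae_eq mu setT (EFin \o g) (fun y => \int[leb]_s Q (s, y))%E.
  apply: integral_ae_eq => // B _ mB.
  pose v : T -> R := \1_B.
  have mv : measurable_fun setT v by exact: measurable_indic.
  have v01 x : 0 <= v x <= 1 by rewrite /v indicE; case: (x \in B); rewrite ?lexx ler01.
  have v1 x := norm_itv (v01 x).
  have iv := bounded_integrable mu mv v1.
  have -> : (\int[mu]_(x in B) (EFin \o g) x = (\int[mu]_y (v y * g y))%:E)%E.
    rewrite integral_mkcond fineK; last first.
      apply: integrable_fin_num => //; under eq_fun do rewrite mulrC.
      exact: (integrableM_bounded ig mv v1).
    apply: eq_integral => y _; rewrite /patch /v indicE.
    by case: (y \in B); rewrite /= ?mul1r ?mul0r.
  pose QB (p : R * T) := (Q p * (v p.2)%:E)%E.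
  have mQB : measurable_fun setT QB.
    by apply: emeasurable_funM => //; apply/measurable_EFinP; exact: measurableT_comp.
  have QB0 p : (0 <= QB p)%E.
    by rewrite mule_ge0// lee_fin; case/andP : (v01 p.2).
  pose F s := dirichlet s (fun k => a k * coef v k).
  have FE s : 0 < s -> \int[mu]_y (heat s a y * v y) = F s.
    by move=> s0; rewrite (integral_heat ab' iv s0).
  have cF k : `|a k * coef v k| <= \int[mu]_y `|v y| * b k ^+ 2.
    rewrite normrM expr2 mulrA mulrC ler_pM//; exact: (coefb mv v1).
  transitivity (\int[mu]_y \int[leb]_s QB (s, y))%E; last first.
    rewrite [RHS]integral_mkcond; apply: eq_integral => y _; rewrite /patch /QB/= /v indicE.
    case: (y \in B) => /=; first by under eq_integral do rewrite mule1.
    by under eq_integral do rewrite mule0; rewrite integral0.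
  transitivity (\int[leb]_s \int[mu]_y QB (s, y))%E; last first.
    exact: (fubini_tonelli (m1 := leb) (m2 := mu) _ mQB QB0).
  transitivity (\int[leb]_(s in `]0%R, +oo[) (F s)%:E)%E; last first.
    rewrite integral_mkcond; apply: eq_integral => s _; rewrite /patch.
    case: ifPn => [|sn]; last first.
      rewrite (eq_integral (cst 0%E)) ?integral0// => y _.
      by rewrite /QB QE /patch (negbTE sn) mul0e.
    rewrite inE/= in_itv/= andbT => s0.
    rewrite -FE// fineK; last first.
      apply: integrable_fin_num => //; under eq_fun do rewrite mulrC.
      exact: (integrableM_bounded iv (measurable_heat ab' s0) (fun y => heat_bounded y ab' s0)).
    apply: eq_integral => y _; rewrite /QB QE /patch mem_set//=.
    by rewrite in_itv/= andbT.
  (* These half-lines exhaust []0, +oo[]. Monotone convergence gives one limit of the truncated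
     integrals; the Dirichlet tail formula together with [dirichlet_weak_cvg0] gives the other. *)
  pose En n : set R := `[n.+1%:R^-1, +oo[%classic.
  have n0 n : (0 : R) < n.+1%:R^-1 by rewrite invr_gt0.
  have UE : \bigcup_n En n = `]0, +oo[%classic.
    apply/seteqP; split => s /=.
      by case=> n _; rewrite /En/= !in_itv/= !andbT; exact: lt_le_trans.
    rewrite in_itv/= andbT => s0.
    have [n _ /(_ n (leqnn n)) ns] := near_infty_natSinv_lt (PosNum s0).
    by exists n => //; rewrite /En/= in_itv/= andbT ltW.
  have Fpos s : 0 < s -> 0 <= F s.
    move=> s0; rewrite -FE//; apply: Rintegral_ge0 => y _.
    by rewrite mulr_ge0 ?h0//; case/andP : (v01 y).
  have mF : measurable_fun (`]0, +oo[%classic : set R) (EFin \o F).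
    apply/measurable_EFinP.
    apply: (@measurable_rsum _ _ _ _
      (fun k s => expR (- lam k * s) * (a k * coef v k))
      (fun k s => \int[mu]_y `|v y| * (expR (- lam k * s) * b k ^+ 2))).
    - by move=> k; apply: measurable_funM => //; apply: measurableT_comp => //.
    - by move=> k s _; exact: (@dirichlet_term_le _ lam b _ _ s cF).
    - move=> s /=; rewrite in_itv/= andbT => s0.
      exact: is_cvg_dirichlet_bound.
  have EnS n : En n `<=` `]0, +oo[%classic.
    by move=> s; rewrite /En/= !in_itv/= !andbT; exact: lt_le_trans.
  have mFn n : measurable_fun (En n) (EFin \o F).
    exact: (measurable_funS (measurable_itv _) (@EnS n) mF).
  have cvg1 : (\int[leb]_(s in En n) (F s)%:E)%E @[n --> \oo] -->
      (\int[leb]_(s in \bigcup_n En n) (F s)%:E)%E.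
    apply: ge0_nondecreasing_set_cvg_integral => //.
    - apply/nondecreasing_seqP => n; apply/subsetPset => s.
      rewrite /En/= !in_itv/= !andbT; apply: le_trans.
      by rewrite lef_pV2 ?posrE// ler_nat.
    - by move=> n; rewrite /En; exact: measurable_itv.
    - move=> n s /EnS; rewrite /= in_itv/= andbT => s0.
      by rewrite lee_fin Fpos.
  have cvg2 : (\int[leb]_(s in En n) (F s)%:E)%E @[n --> \oo] -->
      (\int[mu]_y (v y * g y))%:E.
    rewrite (_ : (fun n => _) = EFin \o
        (fun n => dirichlet n.+1%:R^-1 (fun k => coef v k * coef g k))); last first.
      apply/funext => n /=.
      have [i1' e1] := integrable_dirichlet_tail lam0_gt0 lam_ge b_sum cF (n0 n).
      rewrite /En -[LHS]fineK; last by apply: integrable_fin_num.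
      rewrite -/(Rintegral _ _ _) e1; congr EFin; apply: eq_rsum => k.
      by rewrite ga; congr (_ * _); rewrite mulrCA mulrA.
    apply: cvg_EFin; first exact: nearW.
    have /cvg_at_rightP := dirichlet_weak_cvg0 mv v01 g0 ig.
    apply; split => //; exact: cvg_harmonic.
  by rewrite -UE; apply: (cvg_unique _ cvg2 cvg1).
by apply: filterS => y /(_ I) /= ->; rewrite GE.
Qed.

End supersolution.

End heat.

(** * Potentials of time-integrated kernels *)

Section reflection.
Context {R : realType}.
Local Notation leb := (@lebesgue_measure R).

Let refl (t : R) : measurableTypeR R -> measurableTypeR R := fun s : R => t - s.

Let mrefl t : measurable_fun setT (refl t).
Proof. exact: measurable_funB. Qed.

(** Reflection turns []a, b]] into [[t - b, t - a[], of the same length, and half-open intervals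
    determine Lebesgue measure. *)
Let pushforward_reflection t (A : set R) : measurable A ->
  pushforward leb (refl t) A = leb A.
Proof.
pose m := measure_function_pushforward__canonical__measure_function_Measure leb (mrefl t).
move=> mA; apply/esym/(@lebesgue_measure_unique R m) => // _ [[a b]] _ <-.
rewrite /m/= /pushforward (_ : refl t @^-1` _ = `[t - b, t - a[%classic).
  rewrite !lebesgue_measure_itv/= !lte_fin ltrD2l ltrN2; case: ifP => // _.
  by rewrite -!EFinD; congr EFin; ring.
apply/seteqP; split => s /=; rewrite /refl !in_itv/= => /andP[h1 h2];
  apply/andP; split; lra.
Qed.

(** The positive and negative parts are reflected separately, so the identity extends to
    non-integrable [F], with the same default value on both sides. *)
Lemma Rintegral_reflection (F : R -> R) (t : R) : measurable_fun setT F ->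
  \int[leb]_(r in `[0, t]) F (t - r) = \int[leb]_(s in `[0, t]) F s.
Proof.
move=> mF; have mEF : measurable_fun setT (EFin \o F) by exact/measurable_EFinP.
have E (f : R -> \bar R) : measurable_fun setT f -> (forall s, 0 <= f s)%E ->
    (\int[leb]_(r in `[0%R, t]) f (t - r)%R = \int[leb]_(s in `[0%R, t]) f s)%E.
  move=> mf f0.
  rewrite -[RHS](_ : (\int[pushforward leb (refl t)]_(s in `[0%R, t]) f s)%E = _).
    rewrite (ge0_integral_pushforward (mrefl t))//=; last exact: measurable_funTS.
    congr integral; apply/seteqP; split => s /=; rewrite /refl !in_itv/= => /andP[h1 h2];
      apply/andP; split; lra.
  apply: eq_measure_integral => A mA _; exact: pushforward_reflection.
rewrite /Rintegral; congr fine; rewrite integralE [RHS]integralE.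
congr (_ - _)%E.
  transitivity (\int[leb]_(r in `[0%R, t]) ((EFin \o F)^\+ (t - r)%R))%E.
    by apply: eq_integral => r _; rewrite !funeposE.
  rewrite (E _ (measurable_funepos mEF))//.
transitivity (\int[leb]_(r in `[0%R, t]) ((EFin \o F)^\- (t - r)%R))%E.
  by apply: eq_integral => r _; rewrite !funenegE.
by rewrite (E _ (measurable_funeneg mEF)).
Qed.

End reflection.

Section partial_integral.
Context d1 d2 (T1 : measurableType d1) (T2 : measurableType d2) (R : realType).
Variable m2 : {sigma_finite_measure set T2 -> \bar R}.

(** Tonelli makes the integrals of the two parts measurable; [fine] of their difference is
    measurable too, also where a section fails to be integrable. *)
Lemma measurable_partial_Rintegral (f : T1 * T2 -> R) : measurable_fun setT f ->
  measurable_fun setT (fun x => \int[m2]_y f (x, y)).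
Proof.
move=> mf; apply: (measurableT_comp (f := fine)) => //.
have mef : measurable_fun setT (EFin \o f) by exact/measurable_EFinP.
under eq_fun do rewrite integralE.
apply: emeasurable_funB.
- apply: (eq_measurable_fun (fubini_F m2 ((EFin \o f)^\+)%E)).
    by move=> x _; apply: eq_integral => y _; rewrite !funeposE.
  by apply: measurable_fun_fubini_tonelli_F => //; exact: measurable_funepos.
- apply: (eq_measurable_fun (fubini_F m2 ((EFin \o f)^\-)%E)).
    by move=> x _; apply: eq_integral => y _; rewrite !funenegE.
  by apply: measurable_fun_fubini_tonelli_F => //; exact: measurable_funeneg.
Qed.

End partial_integral.

Section ae_swap.
Context d1 d2 (T1 : measurableType d1) (T2 : measurableType d2) (R : realType).
Variables (m1 : {sigma_finite_measure set T1 -> \bar R})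
  (m2 : {sigma_finite_measure set T2 -> \bar R}).

(** Tonelli for the indicator of the set where [f] and [g] differ: its integral vanishes in one
    order, hence in the other. It turns identities known at a fixed time or source point into
    identities at a fixed [x]. *)
Lemma ae_swap (f g : T1 * T2 -> \bar R) : measurable_fun setT f -> measurable_fun setT g ->
  {ae m1, forall x, {ae m2, forall y, f (x, y) = g (x, y)}} ->
  {ae m2, forall y, {ae m1, forall x, f (x, y) = g (x, y)}}.
Proof.
move=> mf mg fg; pose N := [set p | f p != g p].
have mN : measurable N.
  by rewrite -[N]setTI; exact: measurable_neqe.
pose i p : \bar R := (\1_N p)%:E.
have mi : measurable_fun setT i by apply/measurable_EFinP; exact: measurable_indic.
have i0 p : (0 <= i p)%E by rewrite lee_fin.
have z1 : (\int[m1]_x \int[m2]_y i (x, y))%E = 0%E.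
  rewrite (ge0_ae_eq_integral (g := cst 0%E)) ?integral0//.
  - exact: (measurable_fun_fubini_tonelli_F (m2 := m2) _ mi).
  - by move=> x _; apply: integral_ge0.
  apply: filterS fg => x fgx _.
  rewrite (ge0_ae_eq_integral (g := cst 0%E)) ?integral0//.
  - exact: (measurable_fun_pair2 x mi).
  - apply: filterS fgx => y fgy _; rewrite /i indicE.
    by rewrite memNset// /N/= fgy eqxx.
have mG : measurable_fun setT (fun y => \int[m1]_x i (x, y))%E.
  exact: (measurable_fun_fubini_tonelli_G (m1 := m1) _ mi).
move: z1; rewrite (fubini_tonelli _ mi i0) => z2.
have : ae_eq m2 setT (fun y => \int[m1]_x i (x, y))%E (cst 0%E).
  apply/ae_eq_integral_abs => //; rewrite -[RHS]z2.
  by apply: eq_integral => y _; rewrite gee0_abs//; exact: integral_ge0.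
apply: filterS => y /(_ I) /= zy.
have : ae_eq m1 setT (fun x => i (x, y)) (cst 0%E).
  apply/ae_eq_integral_abs => //; first exact: (measurable_fun_pair1 y mi).
  rewrite -[RHS]zy; by apply: eq_integral => x _; rewrite gee0_abs.
apply: filterS => x /(_ I) /=; rewrite /i indicE => -[].
by case: (boolP ((x, y) \in N)) => //=; [move=> _ /eqP; rewrite oner_eq0|
  rewrite notin_setE /N/= => /negP; rewrite negbK => /eqP].
Qed.

End ae_swap.

Section potential.
Context d1 d2 (E : measurableType d1) (T : measurableType d2) (R : realType).
Variables (nu : {finite_measure set E -> \bar R}) (mu : {finite_measure set T -> \bar R}).
Variables (q : R -> E -> T -> R) (g : E -> T -> R) (e : E -> R) (C : R).
Local Notation leb := (@lebesgue_measure R).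
Hypotheses (mq : measurable_fun setT (fun p : (R * E) * T => q p.1.1 p.1.2 p.2))
  (q_ge0 : forall s z x, 0 <= q s z x) (q0 : forall s z x, s <= 0 -> q s z x = 0)
  (mg : measurable_fun setT (fun p : E * T => g p.1 p.2))
  (g_le : forall z, (\int[mu]_x (g z x)%:E <= C%:E)%E)
  (qg : forall z, {ae mu, forall x, (\int[leb]_s (q s z x)%:E = (g z x)%:E)%E})
  (me : measurable_fun setT e) (e1 : forall z, `|e z| <= 1).

(** [nu] with the factor [e], bounded by 1, stands for a finite signed measure; since [q] is
    nonnegative, every estimate reduces to [nu] alone. *)
Definition potential_part (t : R) (x : T) : R :=
  \int[leb]_(s in `[0, t]) \int[nu]_z (q s z x * e z).
Definition potential (x : T) : R := \int[nu]_z (g z x * e z).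

Let mq_szx (f : (R * E) * T -> R) : measurable_fun setT f ->
  measurable_fun setT (fun p : (T * R) * E => f ((p.1.2, p.2), p.1.1)).
Proof.
move=> mf; apply: (measurableT_comp mf); apply: measurable_fun_pair => /=.
  apply: measurable_fun_pair => //; exact: measurableT_comp.
exact: measurableT_comp.
Qed.

Let mswap (f : E * T -> R) : measurable_fun setT f ->
  measurable_fun setT (fun p : T * E => f (p.2, p.1)).
Proof. by move=> mf; apply: (measurableT_comp mf); exact: measurable_fun_pair. Qed.

Let mqe : measurable_fun setT (fun p : (T * R) * E => q p.1.2 p.2 p.1.1 * e p.2).
Proof.
apply: measurable_funM; first exact: (mq_szx mq).
exact: measurableT_comp.
Qed.

Let mqTR : measurable_fun setT (fun p : (T * R) * E => (q p.1.2 p.2 p.1.1)%:E).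
Proof. by apply/measurable_EFinP; exact: (mq_szx mq). Qed.

Lemma measurable_potential : measurable_fun setT potential.
Proof.
apply: (measurable_partial_Rintegral nu (f := fun p : T * E => g p.2 p.1 * e p.2)).
apply: measurable_funM; first exact: (mswap mg).
exact: measurableT_comp.
Qed.

Let minner : measurable_fun setT (fun p : T * R => \int[nu]_z (q p.2 z p.1 * e z)).
Proof. exact: (measurable_partial_Rintegral nu mqe). Qed.

Lemma measurable_potential_part t : measurable_fun setT (potential_part t).
Proof.
rewrite /potential_part; under eq_fun do rewrite Rintegral_mkcond.
have m0 : measurable (`[0, t]%classic : set R) by [].
have mi : measurable_fun setT (fun s : R => \1_(`[0, t]%classic : set R) s : R).
  exact: measurable_indic.
rewrite (_ : (fun x => _) = fun x => \int[leb]_s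
    (\int[nu]_z (q s z x * e z) * \1_(`[0, t]%classic : set R) s)).
  apply: (measurable_partial_Rintegral leb (f := fun p : T * R =>
    \int[nu]_z (q p.2 z p.1 * e z) * \1_(`[0, t]%classic : set R) p.2)).
  by apply: measurable_funM => //; exact: measurableT_comp.
apply/funext => x; apply: eq_Rintegral => s _.
by rewrite /patch indicE; case: ifP; rewrite ?mulr1 ?mulr0.
Qed.

Let hz (x : T) (s : R) : \bar R := (\int[nu]_z (q s z x)%:E)%E.

Let mhz : measurable_fun setT (fun p : T * R => hz p.1 p.2).
Proof.
apply: (measurable_fun_fubini_tonelli_F (m2 := nu) (fun p : (T * R) * E => (q p.1.2 p.2 p.1.1)%:E)) => //.
by move=> p; rewrite lee_fin.
Qed.

Let hz0 x s : (0 <= hz x s)%E.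
Proof. by apply: integral_ge0 => z _; rewrite lee_fin. Qed.

(** Total mass at time [s]: it majorises what that time contributes to the norm in the space of
    integrable functions. *)
Let W (s : R) : \bar R := (\int[mu]_x hz x s)%E.

Let mW : measurable_fun setT W.
Proof.
exact: (measurable_fun_fubini_tonelli_G (m1 := mu) _ mhz (fun p => hz0 p.1 p.2)).
Qed.

Let W0 s : (0 <= W s)%E. Proof. by apply: integral_ge0 => x _; exact: hz0. Qed.

Let mq_sz x : measurable_fun setT (fun p : R * E => (q p.1 p.2 x)%:E).
Proof. by apply/measurable_EFinP; exact: (measurable_fun_pair1 x mq). Qed.

Let swap_sz x : (\int[leb]_s hz x s = \int[nu]_z \int[leb]_s (q s z x)%:E)%E.
Proof.
apply: (fubini_tonelli (m1 := leb) (m2 := nu) (fun p : R * E => (q p.1 p.2 x)%:E) (mq_sz x)).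
by move=> p; rewrite lee_fin.
Qed.

Let mq_zxs : measurable_fun setT (fun p : (E * T) * R => (q p.2 p.1.1 p.1.2)%:E).
Proof.
apply/measurable_EFinP.
apply: (measurableT_comp (f := fun p : (R * E) * T => q p.1.1 p.1.2 p.2)
  (g := fun p : (E * T) * R => ((p.2, p.1.1), p.1.2)) mq).
apply: measurable_fun_pair => /=.
  apply: measurable_fun_pair => //; exact: measurableT_comp.
exact: measurableT_comp.
Qed.

Let mqs : measurable_fun setT (fun p : E * T => \int[leb]_s (q s p.1 p.2)%:E)%E.
Proof.
apply: (measurable_fun_fubini_tonelli_F (m2 := leb)
  (fun p : (E * T) * R => (q p.2 p.1.1 p.1.2)%:E)) => //; last first.
  by move=> p; rewrite lee_fin.
Qed.

Let qs0 p : (0 <= \int[leb]_s (q s p.1 p.2)%:E)%E.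
Proof. by apply: integral_ge0 => s _; rewrite lee_fin. Qed.

(** Tonelli in all three variables: integrating in time produces [g], whose integrals are at most
    [C] uniformly in [z], and [nu] is finite. *)
Let int_W_lty : (\int[leb]_s W s < +oo)%E.
Proof.
rewrite -(fubini_tonelli (m1 := mu) (m2 := leb) _ mhz (fun p => hz0 p.1 p.2)).
under eq_integral do rewrite swap_sz.
rewrite -(fubini_tonelli (m1 := nu) (m2 := mu) _ mqs qs0).
apply: (@le_lt_trans _ _ (\int[nu]_z (cst C%:E z))%E).
  apply: ge0_le_integral => //.
  - by move=> z _; apply: integral_ge0 => x _; exact: (qs0 (z, x)).
  - exact: (measurable_fun_fubini_tonelli_F (m2 := mu) _ mqs).
  move=> z _; apply: le_trans (g_le z).
  rewrite le_eqVlt; apply/orP; left; apply/eqP; apply: ae_eq_integral => //.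
  - exact: (measurable_fun_pair2 z mqs).
  - by apply/measurable_EFinP; exact: (measurable_fun_pair2 z mg).
  - by apply: filterS (qg z) => x h _.
by apply: integrable_lty => //; exact: finite_measure_integrable_cst.
Qed.

Let tail (t : R) : \bar R := (\int[leb]_(s in `]t, +oo[) W s)%E.

(** Dominated convergence along the integers, extended to real [t] by monotonicity. *)
Let tail_cvg0 : tail t @[t --> +oo] --> 0%E.
Proof.
have iW : leb.-integrable setT W.
  apply/integrableP; split => //.
  by under eq_integral do rewrite gee0_abs//.
have tail0 t : (0 <= tail t)%E by apply: integral_ge0 => s _; exact: W0.
have mtl (t : R) : measurable_fun (`]t, +oo[%classic : set R) W by exact: measurable_funTS.
have tail_dec t t' : t <= t' -> (tail t' <= tail t)%E.
  move=> tt'; apply: ge0_subset_integral => //; first exact: mtl.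
  by move=> s /=; rewrite !in_itv/= !andbT; exact: le_lt_trans.
have cn : tail n%:R @[n --> \oo] --> 0%E.
  rewrite -(integral0 leb setT).
  rewrite (_ : (fun n => tail n%:R) = fun n =>
      \int[leb]_s (W \_ (`]n%:R, +oo[%classic : set R)) s)%E; last first.
    by apply/funext => n; rewrite /tail integral_mkcond.
  have [] := @dominated_convergence _ _ _ leb setT measurableT
    (fun n => W \_ (`]n%:R, +oo[%classic : set R)) (cst 0%E) W => //.
  - move=> n; apply/(measurable_restrictT W) => //; exact: mtl.
  - apply: aeW => s _; apply: cvg_near_cst.
    have := nbhs_infty_ger s; apply: filterS => n sn.
    by rewrite /patch memNset//= in_itv/= andbT; apply/negP; rewrite -leNgt.
  - apply: aeW => s n _; rewrite /patch; case: ifPn => _; last by rewrite abse0.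
    by rewrite gee0_abs.
apply/fine_cvgP; split.
  near=> t; rewrite ge0_fin_numE//.
  have [_] := integrableP _ _ _ iW; apply: le_lt_trans.
  under [leRHS]eq_integral do rewrite gee0_abs//.
  by apply: ge0_subset_integral.
have tfin t : tail t \is a fin_num.
  rewrite ge0_fin_numE//.
  have [_] := integrableP _ _ _ iW; apply: le_lt_trans.
  under [leRHS]eq_integral do rewrite gee0_abs//.
  by apply: ge0_subset_integral.
apply/cvgrPdist_le => r r0.
have /cvgrPdist_le/(_ _ r0) [n _ /(_ n (leqnn n))]/= :
    (fine \o (fun n => tail n%:R)) @ \oo --> (0 : R) by exact: fine_cvg cn.
rewrite !sub0r !normrN => h.
near=> t; rewrite sub0r normrN ger0_norm ?fine_ge0//.
apply: le_trans h; rewrite ger0_norm ?fine_ge0// fine_le//.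
by apply: tail_dec; near: t; exact: nbhs_pinfty_ge.
Unshelve. all: by end_near. Qed.

Let qe_integrable x : (\int[leb]_s hz x s < +oo)%E ->
  (leb \x nu)%E.-integrable setT (fun p : R * E => (q p.1 p.2 x * e p.2)%:E).
Proof.
move=> hx.
have mqex : measurable_fun setT (fun p : R * E => (q p.1 p.2 x * e p.2)%:E).
  apply/measurable_EFinP; apply: measurable_funM.
    exact: (measurable_fun_pair1 x mq).
  exact: measurableT_comp.
have [_] := @integrable12ltyP _ _ _ _ _ leb nu _ mqex; apply.
apply: le_lt_trans hx.
apply: ge0_le_integral => //.
- by move=> s _; apply: integral_ge0.
- by apply: (measurable_fun_fubini_tonelli_F (m2 := nu) (fun p : R * E => `|(q p.1 p.2 x * e p.2)%:E|)%E) => //; exact: measurableT_comp.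
- exact: (measurable_fun_pair2 x mhz).
move=> s _; apply: ge0_le_integral => //.
- apply: measurableT_comp => //; exact: (measurable_fun_pair2 s mqex).
- exact: (measurable_fun_pair2 s (mq_sz x)).
- by move=> z _; rewrite lee_fin normrM (ger0_norm (q_ge0 _ _ _)) ler_piMr.
Qed.

Let inner_le x s : (`|\int[nu]_z (q s z x * e z)|%:E <= hz x s)%E.
Proof.
set F := Rintegral _ _ _.
have mqes : measurable_fun setT (fun z => q s z x * e z).
  apply: measurable_funM => //.
  by apply/measurable_EFinP; exact: (measurable_fun_pair2 s (mq_sz x)).
have [hfin|] := boolP (hz x s \is a fin_num); last first.
  by rewrite ge0_fin_numE// -leNgt leye_eq => /eqP ->; rewrite leey.
have iq : nu.-integrable setT (fun z => (q s z x)%:E).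
  apply/integrableP; split; first exact: (measurable_fun_pair2 s (mq_sz x)).
  under eq_integral do rewrite gee0_abs ?lee_fin//.
  by rewrite -(ge0_fin_numE (hz0 x s)).
have iqes : nu.-integrable setT (EFin \o (fun z => q s z x * e z)).
  exact: (integrableM_bounded iq me e1).
rewrite -(fineK hfin) lee_fin.
apply: le_trans (le_normr_Rintegral measurableT iqes) _.
apply: le_Rintegral => //.
  exact: integrable_norm.
by move=> z _; rewrite normrM (ger0_norm (q_ge0 _ _ _)) ler_piMr.
Qed.

Let inner_integrable x : (\int[leb]_s hz x s < +oo)%E ->
  leb.-integrable setT (EFin \o (fun s => \int[nu]_z (q s z x * e z))).
Proof.
move=> hx; have mF : measurable_fun setT (EFin \o (fun s => \int[nu]_z (q s z x * e z))).
  by apply/measurable_EFinP; exact: (measurable_fun_pair2 x minner).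
apply/integrableP; split => //.
apply: le_lt_trans hx; apply: ge0_le_integral => //.
- exact: measurableT_comp.
- exact: (measurable_fun_pair2 x mhz).
- by move=> s _; exact: inner_le.
Qed.

Let potential_part_le x t : (\int[leb]_s hz x s < +oo)%E ->
  (`|(potential_part t x)%:E| <= \int[leb]_s hz x s)%E.
Proof.
move=> hx; have iF := inner_integrable hx.
have iFt : leb.-integrable (`[0, t]%classic : set R) (EFin \o (fun s => \int[nu]_z (q s z x * e z))).
  by apply: integrableS iF.
apply: (@le_trans _ _ (\int[leb]_(s in `[0%R, t]) `|\int[nu]_z (q s z x * e z)|)%:E).
  by rewrite lee_fin; exact: le_normr_Rintegral.
rewrite fineK; last first.
  by apply: integrable_fin_num => //; exact: integrable_norm.
apply: (@le_trans _ _ (\int[leb]_(s in `[0%R, t]) hz x s)%E).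
  apply: ge0_le_integral => //.
  - exact: (measurable_int _ (integrable_norm iFt)).
  - by apply: measurable_funTS; exact: (measurable_fun_pair2 x mhz).
apply: ge0_subset_integral => //; exact: (measurable_fun_pair2 x mhz).
Qed.

(** For such an [x], Fubini writes [potential x] as an integral over all times. Negative times
    contribute nothing, so the difference is what comes after [t]. *)
Let potential_diff x t : (\int[leb]_s hz x s < +oo)%E ->
  {ae nu, forall z, (\int[leb]_s (q s z x)%:E = (g z x)%:E)%E} -> 0 <= t ->
  ((`|potential_part t x - potential x|)%:E <= \int[leb]_(s in `]t, +oo[) hz x s)%E.
Proof.
move=> hx gx t0; have iqe := qe_integrable hx.
pose F (s : R) := \int[nu]_z (q s z x * e z).
have hsfin : {ae leb, forall s, nu.-integrable setT (EFin \o (fun z => q s z x * e z))}.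
  exact: (ae_integrable1 iqe).
(* The real-valued inner integral agrees with the extended one where the section is integrable,
   which is almost every time by Fubini. *)
have FE : {ae leb, forall s, setT s -> (\int[nu]_z (q s z x * e z)%:E)%E = (F s)%:E}.
  have [A [mA A0 Asub]] := hsfin; exists A; split => // s sn; apply: Asub => i.
  by apply: sn => _; rewrite fineK//; apply: integrable_fin_num.
have iF : leb.-integrable setT (EFin \o F) by exact: inner_integrable.
have potE : potential x = \int[leb]_s F s.
  rewrite /potential /Rintegral; congr fine.
  transitivity (\int[leb]_s \int[nu]_z (q s z x * e z)%:E)%E; last first.
    apply: ae_eq_integral => //; last exact: measurable_int iF.
    exact: (measurable_fubini_F iqe).
  rewrite (Fubini iqe) /=; apply: ae_eq_integral => //.
  - apply/measurable_EFinP; apply: measurable_funM => //.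
    exact: (measurable_fun_pair1 x mg).
  - exact: (measurable_fubini_G iqe).
  apply: filterS2 gx (ae_integrable2 iqe) => z gz iz _.
  have iqz : leb.-integrable setT (fun s => (q s z x)%:E).
    apply/integrableP; split.
      exact: (measurable_fun_pair1 z (mq_sz x)).
    under eq_integral do rewrite gee0_abs ?lee_fin//.
    by rewrite gz ltry.
  under [RHS]eq_integral do rewrite mulrC EFinM.
  by rewrite integralZl// gz -EFinM mulrC.
have splitF : \int[leb]_s F s = potential_part t x + \int[leb]_(s in `]t, +oo[) F s.
  have F0 s : s <= 0 -> F s = 0.
    move=> s0; rewrite /F; under eq_Rintegral do rewrite q0// mul0r.
    by rewrite Rintegral_cst// mul0r.
  transitivity (\int[leb]_(s in (`[0, t]%classic : set R) `|` `]t, +oo[) F s).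
    rewrite [RHS]Rintegral_mkcond; apply: eq_Rintegral => s _.
    rewrite /patch; case: ifPn => //; rewrite notin_setE/= !in_itv/= andbT => h.
    by apply: F0; rewrite leNgt; apply/negP => s0; apply: h; case: (leP s t) => st; [left; rewrite ltW|right].
  rewrite Rintegral_setU//.
    by apply: integrableS iF => //; apply: measurableU.
  apply/disj_setPS => s [] /=; rewrite !in_itv/= andbT => /andP[_ st] /(le_lt_trans st).
  by rewrite ltxx.
rewrite potE splitF opprD addrA subrr sub0r normrN.
have iFt : leb.-integrable `]t, +oo[ (EFin \o F) by exact: integrableS iF.
apply: (@le_trans _ _ (\int[leb]_(s in `]t, +oo[) `|F s|)%:E).
  by rewrite lee_fin; exact: le_normr_Rintegral.
rewrite fineK; last first.
  by apply: integrable_fin_num => //; exact: integrable_norm.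
apply: ge0_le_integral => //.
- exact: (measurable_int _ (integrable_norm iFt)).
- by apply: measurable_funTS; exact: (measurable_fun_pair2 x mhz).
- by move=> s _; exact: inner_le.
Qed.

Let qe_ae_lty : {ae mu, forall x, (\int[leb]_s hz x s < +oo)%E}.
Proof.
have mI : measurable_fun setT (fun x => \int[leb]_s hz x s)%E.
  exact: (measurable_fun_fubini_tonelli_F (m2 := leb) _ mhz).
have : mu.-integrable setT (fun x => \int[leb]_s hz x s)%E.
  apply/integrableP; split => //.
  under eq_integral do rewrite gee0_abs ?integral_ge0//.
  by rewrite (fubini_tonelli (m1 := mu) (m2 := leb) _ mhz (fun p => hz0 p.1 p.2)).
move=> /(integrable_ae measurableT); apply: filterS => x /(_ I).
by rewrite ge0_fin_numE// integral_ge0.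
Qed.

(** Squeezed by the tail of [W]. The null sets in [qg] depend on [z]; [ae_swap] turns them into null
    sets of [z] for almost every [x], as [potential_diff] requires. *)
Lemma potential_part_cvg :
  (\int[mu]_x (`|potential_part t x - potential x|)%:E)%E @[t --> +oo] --> 0%E.
Proof.
apply: (@squeeze_cvge _ _ _ _ (cst 0%E) _ tail); last exact: tail_cvg0.
  near=> t; have t0 : 0 <= t by near: t; exact: nbhs_pinfty_ge.
  apply/andP; split; first by apply: integral_ge0 => x _; rewrite lee_fin.
  rewrite /tail.
  have mhzt : measurable_fun setT (fun p : T * R => (hz p.1 \_ (`]t, +oo[%classic : set R)) p.2).
    rewrite (_ : (fun p => _) = fun p : T * R =>
        (hz p.1 p.2 * (\1_(`]t, +oo[%classic : set R) p.2)%:E)%E).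
      apply: emeasurable_funM => //; apply/measurable_EFinP.
      by apply: measurableT_comp => //; exact: measurable_indic.
    apply/funext => p; rewrite /patch indicE; case: ifP => _; rewrite ?mule1 ?mule0//.
  have hzt0 (p : T * R) : (0 <= (hz p.1 \_ (`]t, +oo[%classic : set R)) p.2)%E.
    by rewrite /patch; case: ifP.
  have -> : (\int[leb]_(s in `]t, +oo[) W s = \int[mu]_x \int[leb]_(s in `]t, +oo[) hz x s)%E.
    rewrite integral_mkcond; under [RHS]eq_integral do rewrite integral_mkcond.
    rewrite (fubini_tonelli (m1 := mu) (m2 := leb) _ mhzt hzt0).
    apply: eq_integral => s _; rewrite /patch; case: ifP => // _.
    by rewrite integral0.
  apply: ae_ge0_le_integral => //.
  - by apply/measurable_EFinP; apply: measurableT_comp => //; apply: measurable_funB;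
      [exact: measurable_potential_part|exact: measurable_potential].
  - by move=> x _; apply: integral_ge0.
  - under eq_fun do rewrite integral_mkcond.
    exact: (measurable_fun_fubini_tonelli_F (m2 := leb) _ mhzt).
  have ae2 : {ae mu, forall x, {ae nu, forall z, (\int[leb]_s (q s z x)%:E = (g z x)%:E)%E}}.
    apply: (ae_swap (m1 := nu) (m2 := mu) mqs (g := fun p => (g p.1 p.2)%:E)).
      exact/measurable_EFinP.
    by apply: aeW => z; exact: qg.
  by apply: filterS2 qe_ae_lty ae2 => x h1 h2 _; exact: potential_diff.
exact: cvg_cst.
Unshelve. all: by end_near. Qed.

Lemma integrable_potential : mu.-integrable setT (EFin \o potential).
Proof.
have mge0 : measurable_fun setT (fun p : E * T => `|(g p.1 p.2)%:E|%E).
  by apply: measurableT_comp => //; exact/measurable_EFinP.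
have g0 : {ae mu, forall x, {ae nu, forall z, (\int[leb]_s (q s z x)%:E = (g z x)%:E)%E}}.
  apply: (ae_swap (m1 := nu) (m2 := mu) mqs (g := fun p => (g p.1 p.2)%:E)).
    exact/measurable_EFinP.
  by apply: aeW => z; exact: qg.
have mG : measurable_fun setT (fun x => \int[nu]_z `|(g z x)%:E|)%E.
  exact: (measurable_fun_fubini_tonelli_G (m1 := nu) _ mge0).
have mP := measurable_potential.
apply/integrableP; split; first exact/measurable_EFinP.
apply: (@le_lt_trans _ _ (\int[mu]_x \int[nu]_z `|(g z x)%:E|)%E).
  apply: ge0_le_integral => //; first by apply: measurableT_comp => //; exact/measurable_EFinP.
  move=> x _; rewrite /potential/= .
  have mgx : measurable_fun setT (g ^~ x) by exact: (measurable_fun_pair1 x mg).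
  have [gi|] := boolP (nu.-integrable setT (EFin \o (g ^~ x))).
    have gei := integrableM_bounded gi me e1.
    rewrite -[leRHS]fineK; last first.
      by apply: integrable_fin_num => //; exact: integrable_norm.
    rewrite lee_fin; apply: le_trans (le_normr_Rintegral measurableT gei) _.
    apply: le_Rintegral => //; [exact: integrable_norm|exact: integrable_norm|].
    by move=> z _; rewrite normrM ler_piMr.
  move=> ni; rewrite (_ : integral _ _ _ = +oo%E) ?leey//.
  apply/eqP; rewrite eq_le leey/= leNgt; apply/negP => lt.
  by case/negP : ni; apply/integrableP; split => //; exact/measurable_EFinP.
have gx0 : (\int[mu]_x \int[nu]_z `|(g z x)%:E| = \int[leb]_s W s)%E.
  rewrite -(fubini_tonelli (m1 := mu) (m2 := leb) _ mhz (fun p => hz0 p.1 p.2)).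
  apply: ae_eq_integral => //.
    exact: (measurable_fun_fubini_tonelli_F (m2 := leb) _ mhz).
  apply: filterS g0 => x gx _; rewrite swap_sz; apply: ae_eq_integral => //.
  - exact: (measurable_fun_pair1 x mge0).
  - exact: (measurable_fun_pair1 x mqs).
  apply: filterS gx => z gz _; rewrite gz -gz gee0_abs//.
  exact: (qs0 (z, x)).
by rewrite gx0.
Qed.

Lemma integrable_potential_part t : 0 <= t ->
  mu.-integrable setT (EFin \o potential_part t).
Proof.
move=> t0.
have mP := measurable_potential_part t.
apply/integrableP; split; first exact/measurable_EFinP.
apply: (@le_lt_trans _ _ (\int[mu]_x (\int[leb]_s hz x s))%E).
  have hh : {ae mu, forall x, setT x -> (`|(potential_part t x)%:E| <= \int[leb]_s hz x s)%E}.
    apply: filterS qe_ae_lty => x hx _; exact: potential_part_le.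
  apply: ae_ge0_le_integral => //.
  - by apply: measurableT_comp => //; exact/measurable_EFinP.
  - by move=> x _; exact: integral_ge0.
  - exact: (measurable_fun_fubini_tonelli_F (m2 := leb) _ mhz).
by rewrite (fubini_tonelli (m1 := mu) (m2 := leb) _ mhz (fun p => hz0 p.1 p.2)).
Qed.

End potential.

(** * Riesz kernels and the distance function *)

Section lebesgue_ball.
Context {R : realType}.

Lemma continuous_measurable_rV n (f : 'rV[R]_n -> R) :
  continuous f -> measurable_fun setT f.
Proof.
move=> cf; apply: (measurability _ (@RGenOpens.measurableE R)) => _ [_ [a [b ->]] <-].
rewrite setTI; apply: open_measurable_mx.
by apply: open_comp => // v _; exact: cf.
Qed.

Lemma lipschitz_continuous_rV n (f : 'rV[R]_n -> R) (L : R) :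
  (forall x y, `|f x - f y| <= L * `|x - y|) -> continuous f.
Proof.
move=> fL x A /nbhs_ballP[e /= e0 eA].
have L0 : 0 < `|L| + 1 by rewrite ltr_wpDl.
apply/nbhs_ballP; exists (e / (`|L| + 1)) => /=; first exact: divr_gt0.
move=> y; rewrite mx_norm_ball /ball_/= => xy; apply: eA.
rewrite /ball/=; apply: le_lt_trans (fL x y) _.
move: xy; rewrite ltr_pdivlMr//; apply: le_lt_trans.
by rewrite mulrC ler_wpM2l// (le_trans (ler_norm L))// lerDl.
Qed.

(** Balls of the sup norm are cubes of side [2 * r], so the measure multiplies over the
    coordinates. *)
Lemma lebesgue_rV_ball n (x : 'rV[R]_n) (r : R) : 0 < r ->
  lebesgue_rV R n (ball x r) = ((r *+ 2) ^+ n)%:E.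
Proof.
move=> r0; elim: n x => [|n ih] x.
  rewrite expr0 /= diracE mem_set//; split => // i j; by case: j.
rewrite /= /lebesgue_step /pushforward /=.
have -> : @cons_rV R n @^-1` ball x r = ball (x ord0 ord0) r `*` ball (uncons_rV x).2 r.
  have l0 : @lshift 1 n ord0 = ord0 :> 'I_n.+1 by exact/val_inj.
  apply/seteqP; split => -[y v] /=.
    move=> [_ h]; split.
      have := h ord0 (@lshift 1 n ord0).
      by rewrite /cons_rV (@row_mxEl _ 1 1 n) mxE/= l0.
    split => // i j; have := h ord0 (rshift 1 j).
    by rewrite /cons_rV (@row_mxEr _ 1 1 n) mxE/= !ord1.
  move=> [hx [_ hv]]; split => // i j; rewrite ord1 /cons_rV.
  case: (@split_ordP 1 n j) => {}j ->.
    by rewrite (@row_mxEl _ 1 1 n) !mxE/= ord1 l0.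
  by have := hv ord0 j; rewrite (@row_mxEr _ 1 1 n) !mxE.
rewrite product_measure1E/=; last 2 first.
- exact: (open_measurable (ball_open _ _)).
- exact: open_measurable_mx (ball_open _ _).
by rewrite lebesgue_measure_ball ?ltW// ih -EFinM exprS.
Qed.

Lemma measurable_ball_rV n (x : 'rV[R]_n) (r : R) : measurable (ball x r).
Proof. by apply: open_measurable_mx; exact: ball_open. Qed.

(** A cube of side at most 1 has volume at most its side. This is what discards the diagonal of the
    Green kernel. *)
Lemma lebesgue_rV_set1 n (x : 'rV[R]_n) : (0 < n)%N ->
  (lebesgue_rV R n).-negligible [set x].
Proof.
move=> n0; pose B := \bigcap_k ball x k.+1%:R^-1.
have mB : measurable B.
  by apply: bigcap_measurable => // k _; exact: measurable_ball_rV.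
exists B; split => //; last first.
  by move=> _ -> k _; apply: ballxx; rewrite invr_gt0.
suff H (e : R) : (0 < e)%R -> (lebesgue_rV R n B <= e%:E)%E.
  apply/eqP; rewrite eq_le measure_ge0 andbT; apply/lee_addgt0Pr => e e0.
  by rewrite add0e; exact: H.
move=> e0.
have [r [r0 re r1 Br]] : exists r : R, [/\ (0 < r)%R, (r *+ 2 <= e)%R, (r *+ 2 <= 1)%R &
    B `<=` ball x r].
  pose s := (Num.min (e / 2) (1 / 2) : R)%R.
  have s0 : (0 < s)%R by rewrite lt_min !divr_gt0.
  have [k _ /(_ k (leqnn k)) /= ks] := near_infty_natSinv_lt (PosNum s0).
  exists k.+1%:R^-1%R; split; first by rewrite invr_gt0.
  - move: (k.+1%:R^-1)%R ks => t ts; rewrite -mulr_natr -ler_pdivlMr//.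
    by rewrite ltW// (lt_le_trans ts)// ge_min lexx.
  - move: (k.+1%:R^-1)%R ks => t ts; rewrite -mulr_natr -ler_pdivlMr//.
    by rewrite ltW// (lt_le_trans ts)// ge_min lexx orbT.
  - by move=> y; apply.
apply: (@le_trans _ _ (lebesgue_rV R n (ball x r))).
  by apply: le_measure; rewrite ?inE//; exact: measurable_ball_rV.
rewrite lebesgue_rV_ball// lee_fin -(prednK n0) exprS.
have r20 : (0 <= r *+ 2)%R by rewrite mulrn_wge0// ltW.
rewrite -[leRHS]mulr1 ler_pM// ?exprn_ge0//.
exact: exprn_ile1.
Qed.

End lebesgue_ball.

Section riesz.
Context {R : realType}.

Let powR_half (p : R) k : (2^-1 ^+ k) `^ p = (2^-1 `^ p) ^+ k.
Proof.
elim: k => [|k ih]; first by rewrite !expr0 powR1.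
by rewrite !exprS powRM ?exprn_ge0 ?invr_ge0// ih.
Qed.

(* The dyadic balls around x dominate the singular kernel from above. *)
Lemma riesz_integral n (a : R) : 0 < a < n%:R -> exists C, 0 <= C /\
  forall (x : 'rV[R]_n) (r : R), 0 < r ->
  (\int[lebesgue_rV R n]_(y in ball x r) (`|x - y| `^ (- a))%:E <=
   (C * r `^ (n%:R - a))%:E)%E.
Proof.
move=> /andP[a0 an]; pose q : R := 2^-1 `^ (n%:R - a).
have q0 : 0 < q by rewrite powR_gt0.
have q1 : q < 1.
  have := @gt0_ltr_powR R (n%:R - a); rewrite subr_gt0 => /(_ an (2^-1) 1).
  by rewrite powR1; apply; rewrite ?inE ?nnegrE ?invr_ge0//; lra.
(* [F k] below is constant, equal to the power -a of [d k * r / 2], on a cube of side [2 * d k * r];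
   its integral is [c * q ^+ k] times the power n - a of [r]. *)
pose c : R := 2^-1 `^ (- a) * 2 ^+ n.
have c0 : 0 <= c by rewrite mulr_ge0 ?exprn_ge0// powR_ge0.
have cvq : cvgn (series (fun k => c * q ^+ k)).
  by apply: (@is_cvg_geometric_series R c q); rewrite ger0_norm ?ltW.
pose d k : R := 2^-1 ^+ k.
have d0 k : 0 < d k by rewrite exprn_gt0// invr_gt0.
exists (rsum (fun k => c * q ^+ k)); split.
  apply: le_trans (ge0_rsum_ge 0 _ cvq); first by rewrite /series/= big_geq.
  by move=> k; rewrite mulr_ge0// exprn_ge0// ltW.
move=> x r r0.
pose B k := ball x (d k * r).
have mB k : measurable (B k) by exact: measurable_ball_rV.
pose F k y : \bar R := (((d k * r / 2) `^ (- a)) * \1_(B k) y)%:E.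
have F0 k y : (0 <= F k y)%E by rewrite lee_fin mulr_ge0// powR_ge0.
have mF k : measurable_fun (ball x r) (F k).
  by apply/measurable_EFinP; apply: measurable_funM => //; apply: measurable_funTS; exact: measurable_indic.
have xyF y : ball x r y -> ((`|x - y| `^ (- a))%:E <= \sum_(k <oo) F k y)%E.
  (* On the diagonal the left side is 0, by the convention that a nonzero power of 0 is 0. *)
  move=> xy; have [->|y_neq_x] := eqVneq x y.
    rewrite subrr normr0 powR0 ?oppr_eq0 ?gt_eqF//; exact: nneseries_ge0.
  have xy0 : 0 < `|x - y| by rewrite normr_gt0 subr_eq0.
  have ex : exists k, d k.+1 * r <= `|x - y|.
    have : d n0 @[n0 --> \oo] --> 0 by apply: cvg_expr; rewrite ger0_norm ?invr_ge0//; lra.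
    move=> /cvgrPdist_lt/(_ _ (divr_gt0 xy0 r0)) [k _ /(_ k.+1 (leqnSn k))].
    rewrite sub0r normrN gtr0_norm// ltr_pdivlMr// => h.
    by exists k; exact: ltW.
  (* Minimality of [k] puts [y] into [B k], while [d k.+1 * r] is still at most the distance of [y]
     to [x], so that [F k] alone dominates the kernel at [y]. *)
  have [k kP kmin] := ex_minnP ex.
  have By : B k y.
    rewrite /B mx_norm_ball /ball_/=; case: k kP kmin => [|k] kP kmin.
      by move: xy; rewrite mx_norm_ball /ball_/= /d expr0 mul1r.
    by rewrite ltNge; apply/negP => /kmin; rewrite ltnn.
  apply: (@le_trans _ _ (F k y)).
    rewrite /F indicE mem_set// mulr1 lee_fin !powRN.
    have dk : 0 < d k * r / 2 by rewrite !divr_gt0// mulr_gt0.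
    rewrite lef_pV2 ?posrE ?powR_gt0//.
    apply: ge0_ler_powR; rewrite ?nnegrE ?(ltW a0) ?(ltW dk)//.
    by apply: le_trans kP; rewrite /d exprS (mulrC (2^-1)) mulrAC.
  by apply: le_trans (nneseries_lim_ge k.+1 _) => //; rewrite big_nat_recr//= leeDr// sume_ge0.
apply: (@le_trans _ _ (\int[lebesgue_rV R n]_(y in ball x r) \sum_(k <oo) F k y)%E).
  apply: ge0_le_integral => //.
  - exact: measurable_ball_rV.
  - have mn : measurable_fun setT (fun y : 'rV[R]_n => `|x - y|).
      apply: continuous_measurable_rV; apply: (lipschitz_continuous_rV (L := 1)) => y z.
      rewrite mul1r; apply: le_trans (ler_dist_dist _ _) _.
      by rewrite opprB addrC addrA subrK distrC.
    have := measurableT_comp (@measurable_powR R (- a)) mn.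
    by move=> /measurable_funTS h; apply/measurable_EFinP; exact: h.
  - by apply: ge0_emeasurable_sum.
rewrite integral_nneseries//; last exact: measurable_ball_rV.
have -> : (rsum (fun k => c * q ^+ k) * r `^ (n%:R - a))%:E =
    (\sum_(k <oo) (c * q ^+ k * r `^ (n%:R - a))%:E)%E.
  rewrite mulrC -rsumZ// /rsum -EFin_lim; last exact: is_cvg_seriesZ.
  apply: congr_lim; apply/funext => m; rewrite /series/= -sumEFin.
  by apply: eq_bigr => k _; rewrite mulrC.
apply: lee_nneseries => [k _ _|k _]; first exact: integral_ge0.
have e1 : (\int[lebesgue_rV R n]_(y in ball x r) F k y <=
    \int[lebesgue_rV R n]_y F k y)%E.
  apply: ge0_subset_integral => //; first exact: measurable_ball_rV.
  by apply/measurable_EFinP; apply: measurable_funM => //; exact: measurable_indic.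
apply: le_trans e1 _.
rewrite /F; under eq_integral do rewrite EFinM.
rewrite ge0_integralZl_EFin ?powR_ge0//; last first.
  by apply/measurable_EFinP; exact: measurable_indic.
have -> : (\int[lebesgue_rV R n]_y (\1_(B k) y)%:E = ((d k * r *+ 2) ^+ n)%:E)%E.
  by rewrite integral_indic// setIT; apply: lebesgue_rV_ball; exact: mulr_gt0.
rewrite -EFinM lee_fin.
rewrite le_eqVlt; apply/orP; left; apply/eqP.
have dr0 : 0 <= d k * r by rewrite mulr_ge0 ?ltW.
rewrite (powRM _ dr0) ?invr_ge0// powRM ?ltW//.
rewrite (_ : d k * r *+ 2 = d k * r * 2); last by rewrite mulr_natr.
rewrite exprMn.
rewrite -(powR_mulrn n dr0) powRM ?ltW// /c /q -powR_half -/(d k).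
rewrite (_ : n%:R - a = - a + n%:R); last by rewrite addrC.
rewrite !powRD; last 2 first.
- by rewrite (gt_eqF r0) implybT.
- by rewrite (gt_eqF (d0 k)) implybT.
by ring.
Qed.

End riesz.

(** * Euclidean norm, distance to the complement, and the comparison kernel *)

Section euclidean_norm.
Context {R : realType} {n : nat}.
Implicit Types x y : 'rV[R]_n.

(** Cauchy-Schwarz, by evaluating a nonnegative quadratic polynomial at its minimum [P / X]. *)
Let sum_mul_le (a b : 'I_n -> R) :
  (\sum_i a i * b i) ^+ 2 <= (\sum_i a i ^+ 2) * (\sum_i b i ^+ 2).
Proof.
set P := \sum_i a i * b i; set X := \sum_i a i ^+ 2; set Y := \sum_i b i ^+ 2.
have X0 : 0 <= X by apply: sumr_ge0 => i _; exact: sqr_ge0.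
have Q (t : R) : 0 <= X * t ^+ 2 - 2 * P * t + Y.
  have -> : X * t ^+ 2 - 2 * P * t + Y = \sum_i (a i * t - b i) ^+ 2.
    rewrite /X /P /Y mulrAC mulr_sumr !mulr_suml -sumrB -big_split/=.
    by apply: eq_bigr => i _; ring.
  by apply: sumr_ge0 => i _; exact: sqr_ge0.
have [X00|Xn0] := eqVneq X 0.
  suff -> : P = 0 by rewrite expr0n/= X00 mul0r.
  apply: big1 => i _; suff -> : a i = 0 by rewrite mul0r.
  apply/eqP; rewrite -sqrf_eq0; apply/eqP.
  by have /psumr_eq0P := X00; apply => // j _; exact: sqr_ge0.
have Xgt0 : 0 < X by rewrite lt_neqAle eq_sym Xn0.
have := mulr_ge0 X0 (Q (P / X)).
rewrite (_ : X * (X * (P / X) ^+ 2 - 2 * P * (P / X) + Y) = X * Y - P ^+ 2); last by field.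
by rewrite subr_ge0.
Qed.

Lemma enorm_ge0 x : 0 <= enorm x. Proof. exact: sqrtr_ge0. Qed.

Lemma enormN x : enorm (- x) = enorm x.
Proof. by rewrite /enorm; congr Num.sqrt; apply: eq_bigr => i _; rewrite mxE sqrrN. Qed.

Lemma enorm_sub x y : enorm (x - y) = enorm (y - x).
Proof. by rewrite -enormN opprB. Qed.

Lemma enormD x y : enorm (x + y) <= enorm x + enorm y.
Proof.
have S0 z : 0 <= \sum_(i < n) z ord0 i ^+ 2 :> R.
  by apply: sumr_ge0 => i _; exact: sqr_ge0.
rewrite -(@ler_pXn2r _ 2)// ?nnegrE ?addr_ge0 ?enorm_ge0//.
rewrite sqrrD !sqr_sqrtr ?S0//.
under eq_bigr do rewrite mxE sqrrD.
rewrite !big_split/= lerD2r lerD2l.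
rewrite -mulr2n lerMn2r/=.
rewrite /enorm -sqrtrM ?S0// (le_trans (ler_norm _))// -sqrtr_sqr.
exact: ler_wsqrtr (sum_mul_le _ _).
Qed.

Lemma enorm_dist x y z : enorm (x - z) <= enorm (x - y) + enorm (y - z).
Proof. by rewrite (_ : x - z = (x - y) + (y - z)) ?enormD// addrA subrK. Qed.

Lemma enorm0 : enorm (0 : 'rV[R]_n) = 0.
Proof. by rewrite /enorm big1 ?sqrtr0// => i _; rewrite mxE expr0n. Qed.

Lemma enorm_gt0 x : x != 0 -> 0 < enorm x.
Proof. by move=> x0; apply: lt_le_trans (norm_le_enorm x); rewrite normr_gt0. Qed.

Lemma enorm_le_norm : exists2 L : R, 0 <= L & forall x, enorm x <= L * `|x|.
Proof.
exists (Num.sqrt n%:R) => [|x]; first exact: sqrtr_ge0.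
rewrite -[X in _ * X](ger0_norm (normr_ge0 x)) -sqrtr_sqr -sqrtrM// ler_wsqrtr//.
rewrite (_ : n%:R * _ = \sum_(i < n) `|x| ^+ 2); last first.
  by rewrite sumr_const card_ord mulr_natl.
apply: ler_sum => i _; rewrite -(real_normK (num_real (x ord0 i))).
rewrite lerXn2r ?nnegrE//.
by rewrite [leRHS]mx_normrE; apply: (le_bigmax _ (fun ij => `|x ij.1 ij.2|) (ord0, i)).
Qed.

Lemma measurable_enorm_sub :
  measurable_fun setT (fun p : 'rV[R]_n * 'rV[R]_n => enorm (p.1 - p.2)).
Proof.
have mc i : measurable_fun setT (fun v : 'rV[R]_n => v ord0 i).
  by apply: continuous_measurable_rV => v; exact: coord_continuous.
rewrite /enorm; apply: (measurableT_comp (f := @Num.sqrt R)).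
  by apply: continuous_measurable_fun; exact: sqrt_continuous.
apply: measurable_sum => i; under eq_fun do rewrite !mxE.
apply: measurable_funX; apply: measurable_funB.
  exact: (measurableT_comp (mc i) (@measurable_fst _ _ _ _)).
exact: (measurableT_comp (mc i) (@measurable_snd _ _ _ _)).
Qed.

End euclidean_norm.

Section domain.
Context {R : realType} {n : nat} (Omega : set 'rV[R]_n).
Hypotheses (n_gt0 : (0 < n)%N) (domOmega : bounded_domain Omega).
Local Notation delta := (delta Omega).

Let oOmega : open Omega. Proof. by case: domOmega. Qed.

Lemma measurable_domain : measurable Omega.
Proof. exact: open_measurable_mx. Qed.

Lemma domain_norm_bounded : exists2 B : R, 0 < B & forall x, Omega x -> `|x| < B.
Proof.
have [_ _ _ [M [Mr MB]]] := domOmega.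
exists (`|M| + 2); first by rewrite ltr_wpDl.
move=> x Ox; apply: (@le_lt_trans _ _ (`|M| + 1)); last by rewrite ltrD2l ltr1n.
by apply: MB => //; rewrite (le_lt_trans (ler_norm M))// ltrDl.
Qed.

(** It keeps the infimum in [delta] over a nonempty set. The constant vector lies outside because
    there is at least one coordinate. *)
Let outside : exists y, ~ Omega y.
Proof.
have [B B0 OB] := domain_norm_bounded.
exists (const_mx B) => /OB; rewrite ltNge => /negP; apply.
rewrite [leRHS]mx_normrE.
apply: le_trans (le_bigmax _ (fun ij => `|(const_mx B : 'rV[R]_n) ij.1 ij.2|) (ord0, Ordinal n_gt0)).
by rewrite mxE ler_norm.
Qed.

Let delta_set_lb x : lbound [set enorm (x - y) | y in ~` Omega] 0.
Proof. by move=> _ [y _ <-]; exact: enorm_ge0. Qed.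

Let delta_set0 x : [set enorm (x - y) | y in ~` Omega] !=set0.
Proof. by have [y Oy] := outside; exists (enorm (x - y)), y. Qed.

Lemma delta_ge0 x : 0 <= delta x.
Proof. by apply: lb_le_inf; [exact: delta_set0|exact: delta_set_lb]. Qed.

Lemma delta_le x y : ~ Omega y -> delta x <= enorm (x - y).
Proof.
by move=> Oy; apply: ge_inf; [exists 0; exact: delta_set_lb|exists y].
Qed.

Lemma delta_lipschitz x y : delta x <= delta y + enorm (x - y).
Proof.
rewrite -lerBlDr; apply: lb_le_inf; first exact: delta_set0.
move=> _ [z Oz <-]; rewrite lerBlDr addrC; apply: le_trans (delta_le x Oz) _.
exact: enorm_dist.
Qed.

Lemma delta_dist x y : `|delta x - delta y| <= enorm (x - y).
Proof.
rewrite ler_norml; apply/andP; split.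
  by have := delta_lipschitz y x; rewrite enorm_sub; lra.
by have := delta_lipschitz x y; lra.
Qed.

Lemma delta_continuous : continuous delta.
Proof.
have [L _ hL] := @enorm_le_norm R n.
apply: (lipschitz_continuous_rV (L := L)) => x y.
exact: le_trans (delta_dist x y) (hL _).
Qed.

Lemma measurable_delta : measurable_fun setT delta.
Proof. exact: continuous_measurable_rV delta_continuous. Qed.

Lemma delta_gt0 x : Omega x -> 0 < delta x.
Proof.
move=> Ox; have /nbhs_ballP[r /= r0 xr] := open_nbhs_nbhs (conj oOmega Ox).
apply: (@lt_le_trans _ _ r) => //; apply: lb_le_inf; first exact: delta_set0.
move=> _ [y Oy <-]; apply: le_trans (norm_le_enorm _); rewrite leNgt.
by apply/negP => xy; apply: Oy; apply: xr; rewrite mx_norm_ball.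
Qed.

Lemma domain_diameter : exists2 D : R, 0 < D &
  (forall x, Omega x -> delta x <= D) /\
  forall x y, Omega x -> Omega y -> enorm (x - y) <= D.
Proof.
have [B B0 OB] := domain_norm_bounded.
have [y0 Oy0] := outside.
have [L L0 hL] := @enorm_le_norm R n.
pose D := L * (B + B + `|y0|) + 1.
have h (x y : 'rV[R]_n) : `|x - y| <= B + B + `|y0| -> enorm (x - y) <= D.
  move=> xy; apply: le_trans (hL _) _; rewrite /D ler_wpDr//.
  exact: ler_wpM2l.
exists D; first by rewrite ltr_wpDl// mulr_ge0// !addr_ge0// (ltW B0).
split=> [x Ox|x y Ox Oy].
  apply: le_trans (delta_le x Oy0) (h _ _ _).
  by rewrite (le_trans (ler_normB _ _))// lerD2r (le_trans (ltW (OB x Ox)))// lerDl ltW.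
apply: h; rewrite (le_trans (ler_normB _ _))//.
by have := OB x Ox; have := OB y Oy; have := normr_ge0 y0; lra.
Qed.

Lemma lebesgue_domain_lty : (lebesgue_rV R n Omega < +oo)%E.
Proof.
have [B B0 OB] := domain_norm_bounded.
apply: (@le_lt_trans _ _ (lebesgue_rV R n (ball 0 B))).
  apply: le_measure; rewrite ?inE//; first exact: measurable_domain.
    exact: measurable_ball_rV.
  by move=> x /OB xB; rewrite mx_norm_ball /ball_/= sub0r normrN.
by rewrite lebesgue_rV_ball// ltry.
Qed.

End domain.

Section kernel_bounds.
Context {R : realType} {n : nat} (Omega : set 'rV[R]_n) (s gamma : R).
Hypotheses (n_gt0 : (0 < n)%N) (domOmega : bounded_domain Omega)
  (s0 : 0 < s) (gamma01 : 0 < gamma <= 1) (n2s : 2 * s < n%:R).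
Local Notation delta := (delta Omega).
Local Notation w x := (delta x `^ gamma).
Local Notation cmp := (comparison_kernel Omega gamma s).

Let g0 : 0 < gamma. Proof. by case/andP: gamma01. Qed.

Let m x y := Num.min (delta x * delta y / enorm (x - y) ^+ 2) 1.

Let m_ge0 x y : 0 <= m x y.
Proof.
by rewrite le_min ler01 andbT divr_ge0 ?sqr_ge0// mulr_ge0// delta_ge0.
Qed.

Let r_gt0 (x y : 'rV[R]_n) : x != y -> 0 < enorm (x - y).
Proof. by move=> xy; rewrite enorm_gt0// subr_eq0. Qed.

Let powRN_le (p a b : R) : 0 <= p -> 0 < a -> a <= b -> b `^ (- p) <= a `^ (- p).
Proof.
move=> p0 a0 ab; have b0 := lt_le_trans a0 ab.
rewrite !powRN lef_pV2 ?posrE ?powR_gt0//.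
by apply: ge0_ler_powR => //; rewrite nnegrE ltW.
Qed.

(** Multiplying by [w y] and dividing by [w x] removes the boundary factor and leaves a Riesz
    kernel, integrable uniformly in [x]. If [delta y <= 2 * delta x], the minimum is at most 1.
    Otherwise [delta y <= 2 * enorm (x - y)], as [delta] is 1-Lipschitz, and the quotient in the
    minimum compensates. *)
Lemma comparison_kernel_weight x y : Omega x -> Omega y -> x != y ->
  cmp x y * w y <= 4 `^ gamma * `|x - y| `^ (- (n%:R - 2 * s)) * w x.
Proof.
move=> Ox Oy xy; rewrite /comparison_kernel -/(m x y).
have r0 := r_gt0 xy; have dx := delta_gt0 n_gt0 domOmega Ox.
have dy := delta_gt0 n_gt0 domOmega Oy.
have main : m x y * delta y <= 4 * delta x.
  have [h|h] := leP (delta y) (2 * delta x).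
    apply: (@le_trans _ _ (1 * delta y)); last by lra.
    by rewrite ler_wpM2r ?(ltW dy)// /m ge_min lexx orbT.
  have rle : delta y <= 2 * enorm (x - y).
    by have := delta_lipschitz n_gt0 domOmega y x; rewrite enorm_sub; lra.
  apply: (@le_trans _ _ (delta x * delta y / enorm (x - y) ^+ 2 * delta y)).
    by rewrite ler_wpM2r ?(ltW dy)// /m ge_min lexx.
  rewrite mulrAC ler_pdivrMr ?exprn_gt0//.
  rewrite -mulrA (mulrC 4) -mulrA ler_wpM2l ?(ltW dx)//.
  have : delta y * delta y <= (2 * enorm (x - y)) * (2 * enorm (x - y)).
    by rewrite ler_pM// ltW.
  by rewrite expr2; lra.
rewrite -mulrA (_ : m x y `^ gamma * w y = (m x y * delta y) `^ gamma); last first.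
  by rewrite powRM// ltW.
rewrite [leRHS](_ : _ = `|x - y| `^ (- (n%:R - 2 * s)) * (4 * delta x) `^ gamma); last first.
  by rewrite powRM ?(ltW dx)// mulrCA mulrA.
apply: ler_pM; [exact: powR_ge0|exact: powR_ge0| |].
  apply: powRN_le; [by rewrite subr_ge0 ltW|by rewrite normr_gt0 subr_eq0|exact: norm_le_enorm].
apply: ge0_ler_powR; rewrite ?nnegrE ?(ltW g0) ?mulr_ge0 ?(ltW dx) ?(ltW dy)//.
Qed.

(** Dropping the 1 in the minimum bounds the normalised kernel by a pure power of the distance. This
    more singular bound serves to locate where the kernel is large, not to integrate it. *)
Lemma comparison_kernel_singular x y : Omega x -> Omega y -> x != y ->
  cmp x y <= `|x - y| `^ (- (n%:R - 2 * s + 2 * gamma)) * (w x * w y).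
Proof.
move=> Ox Oy xy; rewrite /comparison_kernel -/(m x y).
set p := n%:R - 2 * s; have p0 : 0 < p by rewrite subr_gt0.
clearbody p.
have r0 := r_gt0 xy; have dx := delta_gt0 n_gt0 domOmega Ox.
have dy := delta_gt0 n_gt0 domOmega Oy.
apply: (@le_trans _ _ (enorm (x - y) `^ (- (p + 2 * gamma)) * (w x * w y))).
  rewrite opprD powRD; last by rewrite (gt_eqF r0) implybT.
  rewrite -mulrA ler_wpM2l ?powR_ge0// -powRM ?(ltW dx) ?(ltW dy)//.
  apply: (@le_trans _ _ ((delta x * delta y / enorm (x - y) ^+ 2) `^ gamma)).
    apply: ge0_ler_powR; rewrite ?nnegrE ?(ltW g0)//.
      by rewrite divr_ge0 ?sqr_ge0// mulr_ge0 ?(ltW dx) ?(ltW dy).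
    by rewrite /m ge_min lexx.
  rewrite powRM ?invr_ge0 ?sqr_ge0 ?mulr_ge0 ?(ltW dx) ?(ltW dy)// mulrC ler_wpM2r ?powR_ge0//.
  rewrite le_eqVlt; apply/orP; left; apply/eqP.
  by rewrite -powR_inv1 ?sqr_ge0// -powR_mulrn ?(ltW r0)// -!powRrM; congr (_ `^ _); ring.
rewrite ler_wpM2r ?mulr_ge0 ?powR_ge0//.
apply: powRN_le; [|by rewrite normr_gt0 subr_eq0|exact: norm_le_enorm].
by rewrite addr_ge0 ?(ltW p0)// mulr_ge0 ?(ltW g0).
Qed.

(** Distances between points and to the complement are at most [D]. The resulting positive lower
    bound of the normalised kernel is what bounds the potential of 1 from below. *)
Lemma comparison_kernel_lower : exists2 c, 0 < c &
  forall x y, Omega x -> Omega y -> x != y -> c * (w x * w y) <= cmp x y.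
Proof.
have [D D0 [dD rD]] := domain_diameter n_gt0 domOmega.
exists (D `^ (- (n%:R - 2 * s)) * (D ^+ 2)^-1 `^ gamma).
  by rewrite mulr_gt0 ?powR_gt0// invr_gt0 exprn_gt0.
move=> x y Ox Oy xy; rewrite /comparison_kernel -/(m x y).
have r0 := r_gt0 xy; have dx := delta_gt0 n_gt0 domOmega Ox.
have dy := delta_gt0 n_gt0 domOmega Oy.
have D2 : 0 < D ^+ 2 by rewrite exprn_gt0.
rewrite -mulrA -!powRM ?invr_ge0 ?mulr_ge0 ?(ltW D0) ?(ltW dx) ?(ltW dy)//.
apply: ler_pM; [exact: powR_ge0|exact: powR_ge0| |].
  by apply: powRN_le; [rewrite subr_ge0 ltW|exact: r0|exact: rD].
apply: ge0_ler_powR; rewrite ?nnegrE ?(ltW g0)//.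
  by rewrite mulr_ge0 ?invr_ge0 ?(ltW D2)// mulr_ge0 ?(ltW dx) ?(ltW dy).
rewrite le_min; apply/andP; split.
  rewrite mulrC ler_wpM2l ?mulr_ge0 ?(ltW dx) ?(ltW dy)// lef_pV2 ?posrE ?exprn_gt0//.
  by rewrite lerXn2r ?nnegrE ?(ltW r0) ?(ltW D0)// rD.
rewrite mulrC ler_pdivrMr// mul1r expr2.
by apply: ler_pM; [exact: ltW|exact: ltW|exact: dD|exact: dD].
Qed.

End kernel_bounds.

(** * The weighted measure and the Green kernel *)

Section weighted_measure.
Context {R : realType} {n : nat} (Omega : set 'rV[R]_n) (gamma : R).
Hypotheses (n_gt0 : (0 < n)%N) (domOmega : bounded_domain Omega)
  (gamma01 : 0 < gamma <= 1).
Local Notation leb := (lebesgue_rV R n).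

Definition dist_weight (x : 'rV[R]_n) : R := delta Omega x `^ gamma.
Local Notation w := dist_weight.

(** The square is what makes the inner product of L^2 an unweighted one as well, once both factors
    are divided by [w]. *)
Definition sqr_weight (x : 'rV[R]_n) : R := w x ^+ 2 * \1_Omega x.

Let mOmega : measurable Omega. Proof. exact: measurable_domain. Qed.

Lemma dist_weight_ge0 x : 0 <= w x. Proof. exact: powR_ge0. Qed.

Lemma dist_weight_gt0 x : Omega x -> 0 < w x.
Proof. by move=> Ox; rewrite powR_gt0// delta_gt0. Qed.

Lemma measurable_dist_weight : measurable_fun setT w.
Proof.
by have := measurableT_comp (@measurable_powR R gamma) (measurable_delta n_gt0 domOmega).
Qed.

Lemma dist_weight_bounded : exists2 W : R, 0 < W & forall x, Omega x -> w x <= W.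
Proof.
have [D D0 [dD _]] := domain_diameter n_gt0 domOmega.
exists (D `^ gamma) => [|x Ox]; first exact: powR_gt0.
apply: ge0_ler_powR; rewrite ?nnegrE ?delta_ge0 ?(ltW D0) ?dD//.
by case/andP: gamma01 => /ltW.
Qed.

Lemma sqr_weight_ge0 x : 0 <= sqr_weight x.
Proof. by rewrite mulr_ge0 ?sqr_ge0// indicE. Qed.

Lemma measurable_sqr_weight : measurable_fun setT sqr_weight.
Proof.
apply: measurable_funM; last exact: measurable_indic.
by apply: measurable_funX; exact: measurable_dist_weight.
Qed.

Lemma integrable_sqr_weight : leb.-integrable setT (EFin \o sqr_weight).
Proof.
have [W W0 wW] := dist_weight_bounded; have W0' := ltW W0.
have mW : measurable_fun setT (fun x : 'rV[R]_n => W ^+ 2 * \1_Omega x).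
  by apply: measurable_funM => //; exact: measurable_indic.
apply: (@le_integrable _ _ _ _ _ measurableT _ (fun x => (W ^+ 2 * \1_Omega x)%:E)).
- by apply/measurable_EFinP; exact: measurable_sqr_weight.
- move=> x _; rewrite /= lee_fin !ger0_norm ?sqr_weight_ge0 ?mulr_ge0 ?sqr_ge0 ?indicE//.
  rewrite /sqr_weight indicE; case: (boolP (x \in Omega)) => [|_]; last by rewrite !mulr0.
  rewrite inE => Ox; rewrite !mulr1 !expr2.
  by apply: ler_pM (wW _ Ox) (wW _ Ox); exact: dist_weight_ge0.
- apply: integrable_Rscale => //.
  apply/integrableP; split; first by apply/measurable_EFinP; exact: measurable_indic.
  under eq_integral do rewrite /= ger0_norm//.
  rewrite integral_indic// setIT.
  exact: lebesgue_domain_lty.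
Qed.

Definition weighted_measure := density sqr_weight_ge0 integrable_sqr_weight.

HB.instance Definition _ := FiniteMeasure.on weighted_measure.
Local Notation mu := weighted_measure.

Local Open Scope ereal_scope.

Lemma ge0_integral_weighted (f : 'rV[R]_n -> R) : (forall x, (0 <= f x)%R) ->
  measurable_fun setT f ->
  \int[mu]_x (f x)%:E = \int[leb]_(x in Omega) (f x * w x ^+ 2)%:E.
Proof.
move=> f0 mf; rewrite ge0_integral_density//; last exact/measurable_EFinP.
rewrite [RHS]integral_mkcond; apply: eq_integral => x _.
rewrite /patch /sqr_weight indicE; case: ifPn => _; first by rewrite mulr1 EFinM.
by rewrite mulr0 mule0.
Qed.

Lemma integral_weighted (f : 'rV[R]_n -> R) : measurable_fun setT f ->
  \int[mu]_x (f x)%:E = \int[leb]_(x in Omega) (f x * w x ^+ 2)%:E.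
Proof.
move=> mf; rewrite integral_density//.
rewrite [RHS]integral_mkcond; apply: eq_integral => x _.
rewrite /patch /sqr_weight indicE; case: ifPn => _; first by rewrite mulr1 EFinM.
by rewrite mulr0 mule0.
Qed.

Lemma integrable_weighted (f : 'rV[R]_n -> R) : measurable_fun setT f ->
  mu.-integrable setT (EFin \o f) <->
  leb.-integrable Omega (fun x => (f x * w x ^+ 2)%:E).
Proof.
move=> mf; rewrite integrable_density//.
rewrite [X in _ <-> X]integrable_mkcond//.
suff -> : (fun x => (f x)%:E * (sqr_weight x)%:E) =
    (fun x => (f x * w x ^+ 2)%:E) \_ Omega by [].
apply/funext => x; rewrite /patch /sqr_weight indicE.
by case: ifPn => _; rewrite ?mulr1 ?mulr0 ?mule0 ?EFinM.
Qed.

Lemma negligible_weighted A : leb.-negligible A -> mu.-negligible A.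
Proof. exact: negligible_density. Qed.

Let mu_integral_indic N : measurable N ->
  mu N = \int[leb]_(x in Omega) (\1_N x * w x ^+ 2)%:E.
Proof.
move=> mN; have mi := @measurable_indic _ _ R setT N mN.
by rewrite -ge0_integral_weighted// integral_indic// setIT.
Qed.

Lemma ae_weighted_domain : {ae mu, forall x, Omega x}.
Proof.
exists (~` Omega); split => //; first exact: measurableC.
rewrite mu_integral_indic; last exact: measurableC.
apply: integral0_eq => x Ox; by rewrite indicE memNset ?mul0r.
Qed.

(** Both measures have the same null sets in [Omega], because [w] is positive there. *)
Lemma ae_weighted (P : 'rV[R]_n -> Prop) : {ae mu, forall x, P x} <->
  {ae leb, forall x, Omega x -> P x}.
Proof.
split; last first.
  move=> /negligible_weighted H.
  by move: ae_weighted_domain H; apply: filterS2 => x Ox; exact.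
move=> [N [mN N0 PN]]; exists (N `&` Omega); split.
- exact: measurableI.
- have := mu_integral_indic mN; rewrite N0.
  have mf : measurable_fun Omega (fun x => (\1_N x * w x ^+ 2)%:E).
    apply/measurable_EFinP; apply: measurable_funTS; apply: measurable_funM.
      exact: measurable_indic.
    by apply: measurable_funX; exact: measurable_dist_weight.
  have f0 x : (0 <= \1_N x * w x ^+ 2)%R.
    by rewrite mulr_ge0 ?sqr_ge0// indicE.
  under eq_integral do rewrite -[X in X%:E]ger0_norm// -abse_EFin.
  move=> /esym/(ae_eq_integral_abs _ mOmega mf)[M [mM M0 MP]].
  apply/eqP; rewrite -measure_le0 -M0; apply: le_measure; rewrite ?inE//.
    exact: measurableI.
  move=> x [Nx Ox]; apply: MP => /= /(_ Ox) [] /eqP.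
  rewrite indicE mem_set// mul1r expf_eq0/= => /eqP.
  by apply/eqP; rewrite gt_eqF// dist_weight_gt0.
- move=> x /= /not_implyP[Ox nP]; split => //; exact: PN.
Qed.

(** By the second bound, [k] exceeds [A ^+ M] only in the ball of radius (A2 / A^M)^(1/p), where the
    first bound has an integral of the order of the power n - a of the radius. [C] and [M] precede
    [x] and [k], so that the same constants serve the Green kernel at every point and its boundary
    traces. *)
Lemma riesz_excess (a p A1 A2 : R) : (0 < a < n%:R)%R -> (0 < p)%R -> (0 <= A1)%R ->
  (0 < A2)%R -> exists C, exists M, (0 <= C)%R /\
  forall (x : 'rV[R]_n) (k : 'rV[R]_n -> R), measurable_fun setT k ->
  (forall y, 0 <= k y)%R -> k x = 0%R ->
  (forall y, Omega y -> y != x ->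
    k y * w y ^+ 2 <= A1 * `|x - y| `^ (- a) /\ k y <= A2 * `|x - y| `^ (- p))%R ->
  forall A : R, (1 <= A)%R ->
  \int[mu]_y (Num.max (k y - A ^+ M)%R 0%R)%:E <= (C / A)%:E.
Proof.
move=> an p0 A10 A20; have [C0 [C00 hC]] := riesz_integral an.
case/andP: an => a0 an; pose N := (n%:R - a)%R; have N0 : (0 < N)%R by rewrite subr_gt0.
(* The power N of that radius is of order A^(-M N / p), so this [M] brings it down to 1 / A. *)
have [M hM] : exists M : nat, (1 <= N / p * M%:R)%R.
  exists (Num.bound (p / N)); have := archi_boundP (ltW (divr_gt0 p0 N0)).
  by rewrite ltr_pdivrMr// => /ltW h; rewrite mulrAC ler_pdivlMr// mul1r mulrC.
exists (A1 * (C0 * A2 `^ (N / p)))%R, M; split.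
  by rewrite !mulr_ge0// powR_ge0.
move=> x k mk k0 kx kb A A1'; have A0 : (0 < A)%R by exact: lt_le_trans A1'.
pose r := ((A2 / A ^+ M) `^ p^-1)%R.
have AM0 : (0 < A ^+ M)%R by rewrite exprn_gt0.
have r0 : (0 < r)%R by rewrite powR_gt0 ?divr_gt0.
have mf : measurable_fun setT (fun y => Num.max (k y - A ^+ M)%R 0%R).
  by apply: measurable_maxr => //; apply: measurable_funB.
have f0 y : (0 <= Num.max (k y - A ^+ M) 0)%R by rewrite le_max lexx orbT.
have mn : measurable_fun setT (fun y : 'rV[R]_n => `|x - y|)%R.
  apply: (continuous_measurable_rV (f := fun y => `|x - y|)%R).
  apply: (lipschitz_continuous_rV (L := 1)) => y z; rewrite mul1r.
  by rewrite (le_trans (ler_dist_dist _ _))// opprB addrC addrA subrK distrC.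
have mg : measurable_fun setT (fun y : 'rV[R]_n => (A1 * `|x - y| `^ (- a))%:E).
  apply/measurable_EFinP; apply: measurable_funM => //.
  exact: (measurableT_comp (@measurable_powR R (- a)%R)).
rewrite ge0_integral_weighted//.
apply: (@le_trans _ _ (\int[leb]_(y in Omega)
    (((fun y => (A1 * `|x - y| `^ (- a))%:E) \_ (ball x r)) y))).
  apply: ge0_le_integral => //.
  - by move=> y _; rewrite lee_fin mulr_ge0// sqr_ge0.
  - apply/measurable_EFinP; apply: measurable_funTS; apply: measurable_funM => //.
    by apply: measurable_funX; exact: measurable_dist_weight.
  - apply: measurable_funTS; apply/(measurable_restrictT _ _).1 => //.
      exact: measurable_ball_rV.
    exact: measurable_funTS.
  - move=> y Oy; rewrite /patch.
    have [yx|yx] := eqVneq y x.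
      rewrite yx kx sub0r (max_idPr _) ?oppr_le0 ?(ltW AM0)// mul0r.
      by case: ifPn => // _; rewrite lee_fin mulr_ge0// powR_ge0.
    have [h1 h2] := kb y Oy yx.
    have [kA|kA] := leP (k y - A ^+ M)%R 0%R.
      rewrite mul0r; case: ifPn => // _.
      by rewrite lee_fin mulr_ge0// powR_ge0.
    rewrite ifT; last first.
      rewrite inE mx_norm_ball /ball_/=.
      have d0 : (0 < `|x - y|)%R by rewrite normr_gt0 subr_eq0 eq_sym.
      rewrite -[X in (X < _)%R](_ : (`|x - y| `^ p) `^ p^-1 = _)%R; last first.
        by rewrite -powRrM mulfV ?gt_eqF// powRr1.
      apply: gt0_ltr_powR; rewrite ?invr_gt0 ?nnegrE ?powR_ge0 ?divr_ge0 ?(ltW A20) ?(ltW AM0)//.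
      rewrite subr_gt0 in kA; have := lt_le_trans kA h2.
      by rewrite powRN ltr_pdivlMr ?powR_gt0// ltr_pdivlMr// mulrC.
    rewrite lee_fin; apply: le_trans h1; rewrite ler_wpM2r ?sqr_ge0//.
    by rewrite gerBl ltW.
apply: (@le_trans _ _ (\int[leb]_y
    (((fun y => (A1 * `|x - y| `^ (- a))%:E) \_ (ball x r)) y))).
  apply: ge0_subset_integral => //.
  apply/(measurable_restrictT _ _).1; first exact: measurable_ball_rV.
    exact: measurable_funTS.
  move=> y _; rewrite /patch; case: ifPn => // _.
  by rewrite lee_fin mulr_ge0// powR_ge0.
rewrite -integral_mkcond.
under eq_integral do rewrite EFinM.
rewrite ge0_integralZl//; last 2 first.
  - exact: measurable_ball_rV.
  - apply/measurable_EFinP; apply: measurable_funTS.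
    by apply: (measurableT_comp (@measurable_powR R (- a)%R)).
apply: le_trans (lee_wpmul2l _ (hC x r r0)) _; first by rewrite lee_fin.
rewrite -EFinM lee_fin -!mulrA ler_wpM2l// ler_wpM2l//.
have A20' := ltW A20; have A0' := ltW A0.
rewrite /r -powRrM -/N (mulrC (p^-1)%R) powRM ?invr_ge0 ?exprn_ge0// ler_wpM2l ?powR_ge0//.
rewrite -powR_mulrn// -powRN -powRrM -[leRHS]powR_inv1//.
rewrite ler_powR//.
by rewrite mulNr lerN2 [leRHS]mulrC.
Qed.
End weighted_measure.

Section integral_scale.
Context d (T : measurableType d) (R : realType) (m : {measure set T -> \bar R}).
Local Open Scope ereal_scope.

(** A nonnegative factor also passes through infinite integrals of the two parts, which is used at
    points where integrability is not known. *)
Lemma integral_scale_ge0 D (f : T -> R) (r : R) : measurable D -> (0 <= r)%R ->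
  measurable_fun D f ->
  \int[m]_(x in D) (r * f x)%:E = r%:E * \int[m]_(x in D) (f x)%:E.
Proof.
move=> mD r0 mf; have mfE : measurable_fun D (EFin \o f) by exact/measurable_EFinP.
have [->|rn0] := eqVneq r 0%R.
  by rewrite mul0e; apply: integral0_eq => x _; rewrite mul0r.
rewrite integralE [in RHS]integralE.
rewrite (_ : (fun x => (r * f x)%:E) = (fun x => r%:E * (f x)%:E)); last first.
  by apply/funext => x; rewrite EFinM.
rewrite ge0_funeposM// ge0_funenegM//.
rewrite !ge0_integralZl_EFin//; [|exact: measurable_funeneg|exact: measurable_funepos].
set a := \int[m]_(_ in _) _; set b := \int[m]_(_ in _) _.
have a0 : 0 <= a by apply: integral_ge0.
have b0 : 0 <= b by apply: integral_ge0.
have rp : (0 < r)%R by rewrite lt_neqAle eq_sym rn0.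
move: a b a0 b0 => [a| |] [b| |] //= _ _; rewrite ?(gt0_muley, gt0_muleNy) ?lte_fin//.
by rewrite -!EFinM -!EFinB mulrBr.
Qed.

Lemma Rintegral_scale_ge0 D (f : T -> R) (r : R) : measurable D -> (0 <= r)%R ->
  measurable_fun D f ->
  (\int[m]_(x in D) (r * f x) = r * \int[m]_(x in D) f x)%R.
Proof.
move=> mD r0 mf; rewrite /Rintegral integral_scale_ge0//.
have [->|rn0] := eqVneq r 0%R; first by rewrite mul0e mul0r.
have rp : (0 < r)%R by rewrite lt_neqAle eq_sym rn0.
case: (\int[m]_(x in D) (f x)%:E) => [a| |] //=.
  by rewrite gt0_muley ?lte_fin//= mulr0.
by rewrite gt0_muleNy ?lte_fin//= mulr0.
Qed.

End integral_scale.

#[local] Opaque dist_weight.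

Section green_kernel.
Context {R : realType} {n : nat} (Omega : set 'rV[R]_n) (s gamma : R)
  (G : 'rV[R]_n -> 'rV[R]_n -> \bar R) (c0 C0 : R).
Hypotheses (n_gt0 : (0 < n)%N) (domOmega : bounded_domain Omega)
  (s0 : 0 < s) (gamma01 : 0 < gamma <= 1) (n2s : 2 * s < n%:R)
  (kernG : nonneg_kernel Omega G) (c0_gt0 : 0 < c0) (C0_gt0 : 0 < C0)
  (G_two_sided : forall x y, Omega x -> Omega y -> x != y ->
         G x y = G y x /\
         ((c0 * comparison_kernel Omega gamma s x y)%:E <= G x y
            <= (C0 * comparison_kernel Omega gamma s x y)%:E)%E).
Local Notation leb := (lebesgue_rV R n).
Local Notation w := (dist_weight Omega gamma).
Local Notation mu := (weighted_measure n_gt0 domOmega gamma01).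
Local Notation cmp := (comparison_kernel Omega gamma s).

Let mOmega : measurable Omega. Proof. exact: measurable_domain. Qed.

Let w0 x : Omega x -> 0 < w x.
Proof. exact: dist_weight_gt0. Qed.

(* The values off the diagonal are G x y / (w x * w y); all functions u are
   likewise replaced by u / w, and the Lebesgue measure by w^2 times itself, so
   that the Green operator becomes the symmetric integral operator of this
   kernel for a finite measure. *)
Definition green_kernel x y : R :=
  if `[< [/\ Omega x, Omega y & x != y] >] then fine (G x y) / (w x * w y) else 0.
Local Notation K := green_kernel.

Lemma green_fin_num x y : Omega x -> Omega y -> x != y -> G x y \is a fin_num.
Proof.
move=> Ox Oy xy; have [_ /andP[_ h]] := G_two_sided Ox Oy xy.
by rewrite ge0_fin_numE ?(le_lt_trans h) ?ltry//; case: kernG => _; exact.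
Qed.

Lemma green_kernel_in x y : Omega x -> Omega y -> x != y ->
  K x y = fine (G x y) / (w x * w y).
Proof. by move=> Ox Oy xy; rewrite /green_kernel asboolT. Qed.

Lemma green_kernel_out x y : ~ [/\ Omega x, Omega y & x != y] -> K x y = 0.
Proof. by move=> h; rewrite /green_kernel asboolF. Qed.

#[local] Opaque green_kernel.

Lemma green_kernelE x y : Omega x -> Omega y -> x != y ->
  G x y = (K x y * (w x * w y))%:E.
Proof.
move=> Ox Oy xy; rewrite green_kernel_in// divfK ?fineK ?green_fin_num//.
by rewrite mulf_neq0// gt_eqF// w0.
Qed.

Lemma green_kernel_diag x : K x x = 0.
Proof. by apply: green_kernel_out; rewrite eqxx => -[]. Qed.

Lemma green_kernel_ge0 x y : 0 <= K x y.
Proof.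
have [[Ox Oy xy]|h] := pselect [/\ Omega x, Omega y & x != y]; last first.
  by rewrite green_kernel_out.
rewrite green_kernel_in// divr_ge0 ?mulr_ge0 ?dist_weight_ge0// fine_ge0//.
by case: kernG => _; exact.
Qed.

Let quotient_sym (p q : \bar R) (a b : R) : p = q -> fine p / (a * b) = fine q / (b * a).
Proof. by move=> ->; rewrite (mulrC a). Qed.

Lemma green_kernel_sym x y : K x y = K y x.
Proof.
have [[Ox Oy xy]|h] := pselect [/\ Omega x, Omega y & x != y].
  have yx : y != x by rewrite eq_sym.
  rewrite (green_kernel_in Ox Oy xy) (green_kernel_in Oy Ox yx).
  have [E _] := G_two_sided Ox Oy xy.
  exact: (quotient_sym _ _ E).
rewrite !green_kernel_out// => -[Oy Ox yx]; apply: h; split => //.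
by rewrite eq_sym.
Qed.

Lemma measurable_green_kernel : measurable_fun setT (fun p : 'rV[R]_n * 'rV[R]_n => K p.1 p.2).
Proof.
pose D := (Omega `*` Omega) `&` [set p : 'rV[R]_n * 'rV[R]_n | p.1 != p.2].
have mD : measurable D.
  apply: measurableI; first exact: measurableX.
  rewrite [X in measurable X](_ : _ =
    (fun p : 'rV[R]_n * 'rV[R]_n => enorm (p.1 - p.2)) @^-1` `]0, +oo[); last first.
    apply/seteqP; split => p /=; rewrite in_itv/= andbT.
      by move=> h; apply: enorm_gt0; rewrite subr_eq0.
    by apply: contraTneq => ->; rewrite subrr enorm0 ltxx.
  rewrite -[X in measurable X]setTI; apply: measurable_enorm_sub => //.
rewrite (_ : (fun p => _) = (fun p => fine (G p.1 p.2) / (w p.1 * w p.2)) \_ D); last first.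
  apply/funext => p.
  have [[h1 h2 h3]|h] := pselect [/\ Omega p.1, Omega p.2 & p.1 != p.2].
    by rewrite green_kernel_in// patchE mem_set//; split.
  by rewrite green_kernel_out// patchE memNset// => -[[h1 h2] h3]; apply: h.
apply/(measurable_restrictT _ _).1 => //.
have [mG _] := kernG.
apply: measurable_funM.
  apply: (measurableT_comp (f := fine)) => //.
  by apply: measurable_funS mG => //; [exact: measurableX|move=> p []].
apply: measurable_funTS; under eq_fun do rewrite -powR_inv1 ?mulr_ge0 ?dist_weight_ge0//.
apply: (measurableT_comp (@measurable_powR R (- 1))).
have mw := @measurable_dist_weight _ _ _ gamma n_gt0 domOmega.
apply: measurable_funM.
  exact: (measurableT_comp mw (@measurable_fst _ _ _ _)).
exact: (measurableT_comp mw (@measurable_snd _ _ _ _)).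
Qed.

(** Stated for a single section [k], so as to hold for interior [x] and to survive the limit to
    boundary points. The factor [w y ^+ 2] is the density of [mu]. *)
Definition singular_bound (x : 'rV[R]_n) (k : 'rV[R]_n -> R) := forall y, Omega y -> y != x ->
  k y * w y ^+ 2 <= C0 * 4 `^ gamma * `|x - y| `^ (- (n%:R - 2 * s)) /\
  k y <= C0 * `|x - y| `^ (- (n%:R - 2 * s + 2 * gamma)).

Let bound_weight (k g a b cm c r : R) : 0 < a -> 0 < b -> 0 <= c ->
  k * (a * b) <= c * cm -> cm * b <= g * r * a -> k * b ^+ 2 <= c * g * r.
Proof.
move=> a0 b0 c0' h1 h2; rewrite -(ler_pM2r a0).
have -> : k * b ^+ 2 * a = k * (a * b) * b by rewrite expr2; ring.
apply: le_trans (ler_wpM2r (ltW b0) h1) _.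
by rewrite -!mulrA ler_wpM2l// mulrA.
Qed.

Let bound_singular (k ab cm c r : R) : 0 < ab -> 0 <= c ->
  k * ab <= c * cm -> cm <= r * ab -> k <= c * r.
Proof.
move=> a0 c0' h1 h2; rewrite -(ler_pM2r a0); apply: le_trans h1 _.
by rewrite -mulrA ler_wpM2l.
Qed.

Let bound_lower (k ab cm c e : R) : 0 < ab -> 0 <= c ->
  c * cm <= k * ab -> e * ab <= cm -> c * e <= k.
Proof.
move=> a0 c0' h1 h2; rewrite -(ler_pM2r a0); apply: le_trans h1.
by rewrite -mulrA ler_wpM2l.
Qed.

Lemma green_kernel_bound x : Omega x -> singular_bound x (K x).
Proof.
move=> Ox y Oy; rewrite eq_sym => xy.
have [_ /andP[_ h]] := G_two_sided Ox Oy xy.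
move: h; rewrite (green_kernelE Ox Oy xy) lee_fin => h.
split.
  apply: (bound_weight (w0 Ox) (w0 Oy) (ltW C0_gt0) h).
  exact: comparison_kernel_weight.
apply: (bound_singular (mulr_gt0 (w0 Ox) (w0 Oy)) (ltW C0_gt0) h).
exact: comparison_kernel_singular.
Qed.

Lemma singular_bound_excess : exists C, exists M, 0 <= C /\
  forall (x : 'rV[R]_n) (k : 'rV[R]_n -> R), measurable_fun setT k -> (forall y, 0 <= k y) -> k x = 0 ->
  singular_bound x k -> forall A : R, 1 <= A ->
  (\int[mu]_y (Num.max (k y - A ^+ M) 0)%:E <= (C / A)%:E)%E.
Proof.
apply: riesz_excess => //.
- by rewrite subr_gt0 n2s/= gtrBl mulr_gt0.
- by rewrite addr_gt0 ?subr_gt0// mulr_gt0//; case/andP: gamma01.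
- by rewrite mulr_ge0 ?powR_ge0// ltW.
Qed.

Lemma green_kernel_lower : exists2 c, 0 < c &
  forall x y, Omega x -> Omega y -> x != y -> c <= K x y.
Proof.
have [c c_gt0 hc] := comparison_kernel_lower n_gt0 domOmega gamma01 n2s.
exists (c0 * c) => [|x y Ox Oy xy]; first exact: mulr_gt0.
have [_ /andP[h _]] := G_two_sided Ox Oy xy.
move: h; rewrite (green_kernelE Ox Oy xy) lee_fin => h.
exact: (bound_lower (mulr_gt0 (w0 Ox) (w0 Oy)) (ltW c0_gt0) h (hc x y Ox Oy xy)).
Qed.

Local Open Scope ereal_scope.

Lemma measurable_green_section x : Omega x -> measurable_fun Omega (G x).
Proof.
move=> Ox; have [/(measurable_restrictT _ (measurableX mOmega mOmega)).1 mG _] := kernG.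
apply: (eq_measurable_fun (fun y => ((fun p => G p.1 p.2) \_ (Omega `*` Omega)) (x, y))).
  by move=> y; rewrite inE => Oy; rewrite patchE mem_set.
apply: measurable_funTS.
exact: (measurableT_comp mG (pair1_measurable x)).
Qed.

Lemma measurable_weight_quotient (u : 'rV[R]_n -> R) : measurable_fun Omega u ->
  measurable_fun setT (fun y => u y / w y * \1_Omega y)%R.
Proof.
move=> mu_.
rewrite (_ : (fun y => _) = (fun y => u y * w y `^ (-1))%R \_ Omega); last first.
  apply/funext => y; rewrite patchE indicE powR_inv1 ?dist_weight_ge0//.
  by case: ifPn => _; rewrite ?mulr1 ?mulr0.
apply/(measurable_restrictT _ _).1 => //; apply: measurable_funM => //.
apply: measurable_funTS; apply: (measurableT_comp (@measurable_powR R (- 1)%R)).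
exact: measurable_dist_weight.
Qed.

Lemma integral_green (u : 'rV[R]_n -> R) x : measurable_fun Omega u -> Omega x ->
  \int[leb]_(y in Omega) (G x y * (u y)%:E) =
  (w x)%:E * \int[mu]_y (K x y * ((u y / w y) * \1_Omega y)%R)%:E.
Proof.
move=> mu_ Ox.
have mv : measurable_fun setT (fun y => u y / w y * \1_Omega y)%R.
  exact: measurable_weight_quotient.
have mK : measurable_fun setT (K x).
  exact: (measurableT_comp measurable_green_kernel (pair1_measurable x)).
have mKv : measurable_fun setT (fun y => K x y * (u y / w y * \1_Omega y))%R.
  exact: measurable_funM.
rewrite integral_weighted// -integral_scale_ge0//; last 2 first.
- exact: dist_weight_ge0.
- apply: measurable_funTS; apply: measurable_funM => //.
  by apply: measurable_funX; exact: measurable_dist_weight.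
apply: ae_eq_integral => //.
- by apply: emeasurable_funM; [exact: measurable_green_section|exact/measurable_EFinP].
- apply/measurable_EFinP; apply: measurable_funTS; apply: measurable_funM => //.
  apply: measurable_funM => //.
  by apply: measurable_funX; exact: measurable_dist_weight.
(* At [y = x] the size of [G] is not controlled and [K] is 0; that point is negligible. *)
- have [N [mN N0 xN]] := lebesgue_rV_set1 x n_gt0.
  exists N; split => // y /= h; apply: xN; apply: contrapT => yx; apply: h => Oy.
  have xy : x != y by apply/eqP => xy; exact: yx.
  rewrite (green_kernelE Ox Oy xy) -EFinM indicE mem_set//; congr EFin.
  have := w0 Oy; move: (K x y) (w x) (w y) (u y) => k a b v b0.
  by rewrite mulr1; field; rewrite gt_eqF.
Qed.

Lemma green_weighted (u : 'rV[R]_n -> R) x : measurable_fun Omega u -> Omega x ->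
  green Omega G u x = (w x * \int[mu]_y (K x y * (u y / w y * \1_Omega y)))%R.
Proof.
move=> mu_ Ox; rewrite /green integral_green// /Rintegral.
have := w0 Ox; case: (\int[mu]_y _) => [a| |] //= wx.
  by rewrite gt0_muley ?lte_fin//= mulr0.
by rewrite gt0_muleNy ?lte_fin//= mulr0.
Qed.

End green_kernel.

(** Separation makes compact sets closed, hence Borel. *)
Lemma hausdorff_rV {R : realType} {n : nat} : hausdorff_space 'rV[R]_n.
Proof.
rewrite ball_hausdorff => a b ab.
have d0 : 0 < `|a - b| / 2 by rewrite divr_gt0// normr_gt0 subr_eq0.
exists (PosNum d0, PosNum d0); apply/eqP; rewrite -subset0 => y [] /=.
rewrite !mx_norm_ball /ball_/= => h1 h2.
have := ler_distD y a b; rewrite (distrC y b); lra.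
Qed.

Section weighted_spaces.
Context {R : realType} {n : nat} (Omega : set 'rV[R]_n) (gamma : R).
Hypotheses (n_gt0 : (0 < n)%N) (domOmega : bounded_domain Omega)
  (gamma01 : 0 < gamma <= 1).
Local Notation leb := (lebesgue_rV R n).
Local Notation w := (dist_weight Omega gamma).
Local Notation mu := (weighted_measure n_gt0 domOmega gamma01).
Implicit Types u v : 'rV[R]_n -> R.

Let mOmega : measurable Omega. Proof. exact: measurable_domain. Qed.

Let w0 x : Omega x -> 0 < w x.
Proof. exact: dist_weight_gt0. Qed.

Let mw : measurable_fun setT w.
Proof. exact: measurable_dist_weight. Qed.

Definition weight_quotient u y := u y / w y * \1_Omega y.
Local Notation wq := weight_quotient.

Lemma weight_quotient_in u y : Omega y -> wq u y = u y / w y.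
Proof. by move=> Oy; rewrite /wq indicE mem_set// mulr1. Qed.

Lemma weight_quotient_out u y : ~ Omega y -> wq u y = 0.
Proof. by move=> Oy; rewrite /wq indicE memNset// mulr0. Qed.

Lemma weight_quotientK u y : Omega y -> wq u y * w y = u y.
Proof. by move=> Oy; rewrite weight_quotient_in// divfK// gt_eqF// w0. Qed.

Lemma weight_quotientB u v y : wq (u - v) y = wq u y - wq v y.
Proof. by rewrite /wq /= !mulrBl. Qed.

Let mwq u : measurable_fun Omega u -> measurable_fun setT (wq u).
Proof. exact: measurable_weight_quotient. Qed.

Lemma inL2_measurable u : inL2 Omega u -> measurable_fun Omega u.
Proof.
by move=> /sub_Lfun_mfun; rewrite inE/= => /(measurable_restrictT _ mOmega).2.
Qed.

Local Open Scope ereal_scope.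

Lemma integral_weight_sqr u : measurable_fun Omega u ->
  \int[mu]_y (wq u y ^+ 2)%:E = \int[leb]_(y in Omega) (u y ^+ 2)%:E.
Proof.
move=> mu_; rewrite integral_weighted//; last by apply: measurable_funX; exact: mwq.
by apply: eq_integral => y /set_mem Oy; rewrite -exprMn weight_quotientK.
Qed.

Lemma inL2_integrable_sqr u : inL2 Omega u ->
  mu.-integrable setT (fun y => (wq u y ^+ 2)%:E).
Proof.
move=> uL2; have mu_ := inL2_measurable uL2.
have := Lfun2_integrable_sqr uL2.
move=> /integrableP[_ h]; apply/integrableP; split.
  by apply/measurable_EFinP; apply: measurable_funX; exact: mwq.
under eq_integral do rewrite gee0_abs ?lee_fin ?sqr_ge0//.
rewrite integral_weight_sqr// integral_mkcond; apply: le_lt_trans h.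
rewrite le_eqVlt; apply/orP; left; apply/eqP; apply: eq_integral => y _ /=.
by rewrite ger0_norm ?sqr_ge0// !patchE; case: ifPn => // _; rewrite expr0n.
Qed.

Lemma normL2_sqr u : measurable_fun Omega u ->
  (normL2 Omega u) `^ 2 = \int[mu]_y (wq u y ^+ 2)%:E.
Proof.
move=> mu_; rewrite /normL2 poweR_Lnorm// integral_weight_sqr// [RHS]integral_mkcond.
apply: eq_integral => y _ /=.
rewrite powR_mulrn// real_normK ?num_real// !patchE.
by case: ifPn => // _; rewrite expr0n.
Qed.

Lemma normL2_cvg0 (u_ : nat -> 'rV[R]_n -> R) : (forall N, measurable_fun Omega (u_ N)) ->
  normL2 Omega (u_ N) @[N --> \oo] --> 0 ->
  \int[mu]_y (wq (u_ N) y ^+ 2)%:E @[N --> \oo] --> 0.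
Proof.
move=> mu_ h; under eq_fun do rewrite -normL2_sqr//.
apply: (squeeze_cvge _ (@cvg_cst _ 0 _ _ _) h).
have /fine_cvgP[fN hN] := h.
(* Once the norm is below 1, its square is below the norm itself. *)
have N1 : \forall N \near \oo, (fine (normL2 Omega (u_ N)) < 1)%R.
  exact: (cvgr_lt _ hN _ (@ltr01 R)).
apply: filterS2 fN N1 => N.
rewrite poweR_ge0/=.
have : 0 <= normL2 Omega (u_ N) by exact: Lnorm_ge0.
move: (normL2 _ _) => [a| |]//; rewrite lee_fin => a0 _ /= a1.
rewrite lee_fin powR_mulrn// expr2 -[leRHS]mulr1.
exact: ler_wpM2l (ltW a1).
Qed.

Lemma normL1w_weight u : measurable_fun Omega u ->
  normL1w Omega gamma u = \int[mu]_y (`|wq u y|)%:E.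
Proof.
move=> mu_; rewrite /normL1w Lnorm1 integral_weighted//; last first.
  by apply: measurableT_comp => //; exact: mwq.
rewrite [RHS]integral_mkcond; apply: eq_integral => y _ /=.
rewrite !patchE; case: ifPn => [/set_mem Oy|_]; last by rewrite normr0.
rewrite -[X in (X * _)%R](weight_quotientK _ Oy) expr2 mulrA normrM normrM.
by rewrite (ger0_norm (dist_weight_ge0 _ _ _)).
Qed.

(** Local integrability follows from the weighted one: on a compact subset of [Omega] the distance
    attains a positive minimum. *)
Lemma inL1wP u : inL1w Omega gamma u <->
  measurable_fun Omega u /\ mu.-integrable setT (EFin \o wq u).
Proof.
have wE : (fun x => (wq u x * w x ^+ 2)%:E) \_ Omega =
    EFin \o ((fun x => u x * w x)%R \_ Omega).
  apply/funext => y; rewrite /= !patchE; case: ifPn => // /set_mem Oy.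
  by rewrite expr2 mulrA weight_quotientK.
split=> [[_ uL]|[mu_ ui]].
  have mu_ : measurable_fun Omega u.
    move: (uL) => /sub_Lfun_mfun; rewrite inE/= => /(measurable_restrictT _ mOmega).2 h.
    apply: (eq_measurable_fun (fun y => u y * w y * w y `^ (-1))%R).
      move=> y /set_mem Oy; rewrite powR_inv1 ?dist_weight_ge0// mulfK//.
      by rewrite gt_eqF// w0.
    apply: measurable_funM => //; apply: measurable_funTS.
    by apply: (measurableT_comp (@measurable_powR R (- 1)%R)).
  split => //; apply/integrable_weighted; first exact: mwq.
  rewrite integrable_mkcond// wE.
  exact/Lfun1_integrable.
have := (integrable_weighted n_gt0 domOmega gamma01 (mwq mu_)).1 ui.
rewrite (integrable_mkcond _ mOmega) wE => h; split; last exact/Lfun1_integrable.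
move=> A cA AO.
have mA : measurable A.
  rewrite -(setCK A); apply: measurableC; apply: open_measurable_mx.
  exact: closed_openC (compact_closed (@hausdorff_rV R n) cA).
have [->|/set0P A0] := eqVneq A set0; first exact: integrable_set0.
have [x Ax xmin] := compact_EVT_min A0 cA (continuous_subspaceT (delta_continuous n_gt0 domOmega)).
move: Ax => /set_mem Ax.
have dx := w0 (AO _ Ax).
have mA_ : measurable_fun A u by exact: measurable_funS mu_.
have alg (a b c : R) : (0 < a)%R -> (a <= c)%R -> (0 <= b)%R -> (b <= `|a^-1| * (b * c))%R.
  move=> a0 ac b0; rewrite gtr0_norm ?invr_gt0// mulrC ler_pdivlMr//.
  exact: ler_wpM2l.
apply: (@le_integrable _ _ _ leb _ mA _
    (fun y => ((w x)^-1 * (u y * w y))%:E)).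
- exact/measurable_EFinP.
- move=> y Ay; rewrite /= lee_fin !normrM (ger0_norm (dist_weight_ge0 _ _ _)).
  apply: (alg (w x) `|u y|%R (w y) dx _ (normr_ge0 _)).
  apply: ge0_ler_powR; rewrite ?nnegrE ?delta_ge0//; last exact/xmin/mem_set.
  by case/andP: gamma01 => /ltW.
- apply: integrable_Rscale => //.
  move/(integrableS measurableT mA (@subsetT _ _)): h.
  apply: eq_integrable => // y /set_mem Ay /=.
  by rewrite patchE mem_set//; exact: AO.
Qed.

Lemma inner_weight u v : measurable_fun Omega u -> measurable_fun Omega v ->
  (inner Omega u v = \int[mu]_y (wq u y * wq v y))%R.
Proof.
move=> mu_ mv; rewrite /inner /Rintegral integral_weighted//; last first.
  by apply: measurable_funM; exact: mwq.
congr fine; apply: eq_integral => y /set_mem Oy.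
by rewrite expr2 mulrACA !weight_quotientK.
Qed.

Lemma inLinfw_bounded u B : measurable_fun Omega u ->
  (forall y, (`|wq u y| <= B)%R) -> inLinfw Omega gamma u.
Proof.
move=> mu_ uB.
rewrite /inLinfw (_ : _ \_ _ = wq u); last first.
  by apply/funext => y; rewrite patchE /wq indicE; case: ifPn => _; rewrite ?mulr1 ?mulr0.
have ms : wq u \in mfun by rewrite inE; exact: mwq.
apply/andP; split => //.
rewrite inE/= /finite_norm unlock; case: ifPn => // _.
apply: (@le_lt_trans _ _ B%:E); last exact: ltry.
by apply/ess_supP; apply: nearW => y; rewrite /= lee_fin.
Qed.

End weighted_spaces.

(** * Eigenfunctions and the heat semigroup *)

Lemma Rintegral_fubini d1 d2 (T1 : measurableType d1) (T2 : measurableType d2)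
    (R : realType) (m1 : {sigma_finite_measure set T1 -> \bar R})
    (m2 : {sigma_finite_measure set T2 -> \bar R}) (f : T1 -> T2 -> R) :
  (m1 \x m2)%E.-integrable setT (fun p => (f p.1 p.2)%:E) ->
  (forall x, m2.-integrable setT (EFin \o f x)) ->
  (forall y, m1.-integrable setT (EFin \o f ^~ y)) ->
  \int[m1]_x \int[m2]_y f x y = \int[m2]_y \int[m1]_x f x y.
Proof.
move=> fi f1 f2; rewrite /Rintegral; congr fine.
have := Fubini fi; rewrite /= => E.
transitivity (\int[m1]_x \int[m2]_y (f x y)%:E)%E.
  by apply: eq_integral => x _; rewrite fineK//; exact: integrable_fin_num (f1 x).
rewrite E; apply: eq_integral => y _; rewrite fineK//.
exact: integrable_fin_num (f2 y).
Qed.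

Section eigenfunctions.
Context {R : realType} {n : nat} (Omega : set 'rV[R]_n) (s gamma : R)
  (G : 'rV[R]_n -> 'rV[R]_n -> \bar R) (c0 C0 : R)
  (lambda : nat -> R) (phi : nat -> 'rV[R]_n -> R).
Hypotheses (n_gt0 : (0 < n)%N) (domOmega : bounded_domain Omega)
  (s0 : 0 < s) (gamma01 : 0 < gamma <= 1) (n2s : 2 * s < n%:R)
  (kernG : nonneg_kernel Omega G) (c0_gt0 : 0 < c0) (C0_gt0 : 0 < C0)
  (G_two_sided : forall x y, Omega x -> Omega y -> x != y ->
         G x y = G y x /\
         ((c0 * comparison_kernel Omega gamma s x y)%:E <= G x y
            <= (C0 * comparison_kernel Omega gamma s x y)%:E)%E)
  (eigG : eigen_decomposition Omega G lambda phi).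
Local Notation leb := (lebesgue_rV R n).
Local Notation w := (dist_weight Omega gamma).
Local Notation wq := (weight_quotient Omega gamma).
Local Notation mu := (weighted_measure n_gt0 domOmega gamma01).
Local Notation K := (green_kernel Omega gamma G).

Let mOmega : measurable Omega. Proof. exact: measurable_domain. Qed.

Let w0 x : Omega x -> 0 < w x.
Proof. exact: dist_weight_gt0. Qed.

Definition eigen_quotient k := wq (phi k).
Local Notation eta := eigen_quotient.

Let lam0_gt0 : 0 < lambda 0%N. Proof. by case: eigG => /andP[]. Qed.

Lemma lambda_ge k : lambda 0%N <= lambda k.
Proof. by case: eigG => _ + _ _ _; apply. Qed.

Lemma lambda_gt0 k : 0 < lambda k.
Proof. exact: lt_le_trans (lambda_ge k). Qed.

Lemma phi_inL2 k : inL2 Omega (phi k).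
Proof. by case: eigG => _ _ _ [+ _ _] _; apply. Qed.

Lemma measurable_phi k : measurable_fun Omega (phi k).
Proof. exact: (inL2_measurable domOmega (phi_inL2 k)). Qed.

Lemma measurable_eigen_quotient k : measurable_fun setT (eta k).
Proof. exact: (measurable_weight_quotient gamma n_gt0 domOmega (measurable_phi k)). Qed.

Lemma measurable_green_kernel_section x : measurable_fun setT (K x).
Proof.
exact: (measurableT_comp (measurable_green_kernel gamma n_gt0 domOmega kernG) (pair1_measurable x)).
Qed.

(** The eigenvalue equation holds at every point of [Omega], and both sides vanish outside. Validity
    at each point is what yields bounds at each point later. *)
Lemma eigen_quotient_eigen k x :
  eta k x = lambda k * \int[mu]_y (K x y * eta k y).
Proof.
have [Ox|Ox] := pselect (Omega x); last first.
  rewrite /eigen_quotient weight_quotient_out//.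
  rewrite /Rintegral integral0_eq ?mulr0// => y _.
  by rewrite green_kernel_out ?mul0r// => -[].
rewrite {1}/eigen_quotient weight_quotient_in//.
have [_ _ _ _ /(_ k x Ox) h] := eigG.
have := green_weighted n_gt0 domOmega gamma01 kernG G_two_sided (measurable_phi k) Ox.
rewrite h; have := lambda_gt0 k; have := w0 Ox.
rewrite -/(wq (phi k)); move: (\int[mu]_y _) (phi k x) (w x) (lambda k) => I p a l a0 l0 E.
have -> : p = l * (a * I) by rewrite -E mulrA divff ?mul1r// gt_eqF.
by field; rewrite gt_eqF.
Qed.

Lemma integrable_eigen_quotient k : mu.-integrable setT (EFin \o eta k).
Proof.
have h := inL2_integrable_sqr n_gt0 domOmega gamma01 (phi_inL2 k).
apply: (le_integrable measurableT _ _ (integrable_Radd measurableT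
   (f := cst 1) (g := fun y => eta k y ^+ 2) _ h)).
- by apply/measurable_EFinP; exact: measurable_eigen_quotient.
- move=> y _; rewrite /= lee_fin [leRHS]ger0_norm ?addr_ge0 ?sqr_ge0//.
  have := sqr_ge0 (`|eta k y| - 1); rewrite sqrrB1 real_normK ?num_real//.
  have := normr_ge0 (eta k y); lra.
- by apply: (@bounded_integrable _ _ _ mu (cst 1) 1) => // x; rewrite normr1.
Qed.

Lemma eigen_quotient_orthonormal j k : \int[mu]_y (eta j y * eta k y) = (j == k)%:R.
Proof.
have [_ _ _ [_ <- _] _] := eigG.
by rewrite (inner_weight n_gt0 domOmega gamma01 (measurable_phi j) (measurable_phi k)).
Qed.

Section bounded.
Variables (C1 : R) (M : nat).
Hypotheses (C1_ge0 : 0 <= C1)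
 (excess_le : forall (x : 'rV[R]_n) (k : 'rV[R]_n -> R), measurable_fun setT k ->
  (forall y, 0 <= k y) -> k x = 0 ->
  singular_bound Omega s gamma C0 x k -> forall A : R, 1 <= A ->
  (\int[mu]_y (Num.max (k y - A ^+ M) 0)%:E <= (C1 / A)%:E)%E).

Lemma green_kernel_excess x (A : R) : 1 <= A ->
  (\int[mu]_y (excess K (A ^+ M) x y)%:E <= (C1 / A)%:E)%E.
Proof.
apply: excess_le.
- exact: measurable_green_kernel_section.
- by move=> y; exact: green_kernel_ge0.
- exact: green_kernel_diag.
have [Ox|Ox] := pselect (Omega x); first exact: (green_kernel_bound n_gt0 domOmega gamma01 n2s kernG C0_gt0 G_two_sided Ox).
move=> y Oy yx; rewrite green_kernel_out; last by case.
by rewrite mul0r !mulr_ge0 ?powR_ge0// ltW.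
Qed.

Let mK : measurable_fun setT (fun p : 'rV[R]_n * 'rV[R]_n => K p.1 p.2).
Proof. exact: measurable_green_kernel. Qed.

(** By the triangle inequality, the absolute value of [eta k] satisfies the integral inequality of
    [subeigenfunction_bounded]. *)
Lemma eigen_quotient_bounded k : exists B : R, forall x, `|eta k x| <= B.
Proof.
have lk := lambda_gt0 k.
apply: (@subeigenfunction_bounded _ _ _ mu K (green_kernel_ge0 _ kernG)
  (green_kernel_sym G_two_sided) mK C1 M C1_ge0 green_kernel_excess
  (lambda k) (fun x => `|eta k x|) (ltW lk) (fun x => normr_ge0 _)).
  by apply: integrable_Rnorm; exact: integrable_eigen_quotient.
move=> x; rewrite eigen_quotient_eigen normrM (ger0_norm (ltW lk)) EFinM.
rewrite lee_pmul2l ?lte_fin//.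
have mf : measurable_fun setT (fun y => K x y * eta k y).
  apply: measurable_funM; first exact: measurable_green_kernel_section.
  exact: measurable_eigen_quotient.
apply: (@le_trans _ _ `|\int[mu]_y (K x y * eta k y)%:E|%E).
  rewrite /Rintegral; move: (integral _ _ _) => [r| |] //=.
    by rewrite normr0 leey.
  by rewrite normr0 leey.
apply: le_trans (le_abse_integral _ _ _) _ => //; first exact/measurable_EFinP.
apply: ge0_le_integral => //.
- by apply/measurable_EFinP; exact: measurableT_comp.
- apply/measurable_EFinP; apply: measurable_funM.
    exact: measurable_green_kernel_section.
  by apply: measurableT_comp => //; exact: measurable_eigen_quotient.
by move=> y _; rewrite lee_fin normrM ger0_norm// green_kernel_ge0.
Qed.

Lemma eigen_quotient_growth : exists b : R^nat,
  [/\ forall k, 0 <= b k, forall k x, `|eta k x| <= b k &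
      forall t, 0 < t -> cvgn (series (fun k => expR (- lambda k * t) * b k ^+ 2))].
Proof.
have [b0 hb0] := choice eigen_quotient_bounded.
have lam0 k := ltW (lambda_gt0 k).
have [D [b [D0 b_ge0 eb h]]] := @eigenfunction_growth _ _ _ mu K
  (green_kernel_ge0 _ kernG)
  mK C1 M C1_ge0 green_kernel_excess
  eta lambda b0 measurable_eigen_quotient hb0 lam0 eigen_quotient_eigen
  eigen_quotient_orthonormal ltac:(by case: eigG).
exists b; split => //.
exact: growth_summable lam0 h.
Qed.

(** A zero measure could not carry the normalised [eta 0]. *)
Let mass_gt0 : 0 < fine (mu setT).
Proof.
have [B hB] := eigen_quotient_bounded 0.
have m0 : 0 <= fine (mu setT) by exact: fine_ge0.
rewrite lt_neqAle m0 andbT; apply/eqP => /esym m00.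
have := eigen_quotient_orthonormal 0 0; rewrite eqxx /Rintegral => h.
have : (\int[mu]_y (eta 0 y * eta 0 y)%:E = 0)%E.
  apply/eqP; rewrite eq_le integral_ge0 ?andbT; last first.
    by move=> y _; rewrite lee_fin -expr2 sqr_ge0.
  have -> : (0 = \int[mu]_y (cst ((B ^+ 2)%:E) y))%E.
    by rewrite integral_cst// -[X in (_ * X)%E]fineK ?fin_num_measure// m00 mule0.
  apply: ge0_le_integral => //.
  - by move=> y _; rewrite lee_fin -expr2 sqr_ge0.
  - by apply/measurable_EFinP; apply: measurable_funM; exact: measurable_eigen_quotient.
  - move=> y _; rewrite lee_fin -expr2 -(real_normK (num_real (eta 0 y))).
    rewrite !expr2; apply: ler_pM (hB y) (hB y) => //.
by move=> E; move: h; rewrite E/= => /eqP; rewrite eq_sym oner_eq0.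
Qed.

Let K0 x y : 0 <= K x y. Proof. exact: green_kernel_ge0. Qed.

Let iK x : mu.-integrable setT (EFin \o K x).
Proof. exact: (kernel_integrable K0 mK green_kernel_excess). Qed.

(** This potential is the supersolution with which heat flows are compared. Uniform integrability
    bounds it from above, the lower kernel bound times the total mass from below; the latter holds
    on [Omega] only, since [K] vanishes outside. *)
Lemma green_potential_bounds : exists c1 C1', [/\ 0 < c1,
  forall x, 0 <= \int[mu]_y K x y <= C1' &
  {ae mu, forall x, c1 <= \int[mu]_y K x y}].
Proof.
have [c c_gt0 hc] := green_kernel_lower n_gt0 domOmega gamma01 n2s kernG c0_gt0 G_two_sided.
exists (c * fine (mu setT)), (fine (mu setT) + C1); split.
- exact: mulr_gt0 mass_gt0.
- move=> x; rewrite Rintegral_ge0//=.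
  exact: (Rintegral_kernel_le K0 mK green_kernel_excess).
apply/ae_weighted; apply: aeW => x Ox.
rewrite -lee_fin /Rintegral fineK; last first.
  exact: (integrable_fin_num measurableT (iK x)).
rewrite EFinM fineK ?fin_num_measure// -integral_cst//.
apply: ae_ge0_le_integral => //.
- by move=> y _; rewrite lee_fin ltW.
- by move=> y _; rewrite lee_fin.
- by apply/measurable_EFinP; exact: measurable_green_kernel_section.
suff : {ae mu, forall y, c <= K x y} by apply: filterS => y h _; rewrite lee_fin.
apply/ae_weighted.
have [N [mN N0 xN]] := lebesgue_rV_set1 x n_gt0.
exists N; split => // y /= h; apply: xN; apply: contrapT => yx; apply: h => Oy.
by apply: hc => //; apply/eqP => xy; exact: yx.
Qed.

(** Fubini and the symmetry of [K] move the operator onto [eta k], where it divides by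
    [lambda k]. *)
Lemma coef_green_potential k :
  coef mu eta (fun x => \int[mu]_y K x y) k = coef mu eta (cst 1) k / lambda k.
Proof.
have [B hB] := eigen_quotient_bounded k.
have B0 : 0 <= B by apply: le_trans (hB 0).
have meta := measurable_eigen_quotient k.
have mf : measurable_fun setT (fun p : 'rV[R]_n * 'rV[R]_n => K p.1 p.2 * eta k p.1).
  by apply: measurable_funM => //; exact: (measurableT_comp meta (@measurable_fst _ _ _ _)).
have i1 x : mu.-integrable setT (EFin \o (fun y => K x y * eta k x)).
  under eq_fun do rewrite mulrC; exact: integrable_Rscale.
have i2 y : mu.-integrable setT (EFin \o (fun x => K x y * eta k x)).
  rewrite (_ : (fun x => _) = (fun x => K y x * eta k x)); last first.
    by apply/funext => x; rewrite (green_kernel_sym G_two_sided x y).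
  exact: integrableM_bounded hB.
have ifub : (mu \x mu)%E.-integrable setT (EFin \o (fun p => K p.1 p.2 * eta k p.1)).
  have mfE : measurable_fun setT (fun p : 'rV[R]_n * 'rV[R]_n => (K p.1 p.2 * eta k p.1)%:E).
    exact/measurable_EFinP.
  apply: (integrable12ltyP mu mu mfE).2.
  apply: (@le_lt_trans _ _ (\int[mu]_x (cst ((fine (mu setT) + C1) * B)%:E x))%E); last first.
    by rewrite integral_cst// -[X in (_ * X)%E]fineK ?fin_num_measure// -EFinM ltry.
  apply: ge0_le_integral => //.
  - by move=> x _; apply: integral_ge0.
  - apply: (measurable_fun_fubini_tonelli_F (m2 := mu)
      (fun p : 'rV[R]_n * 'rV[R]_n => `|(K p.1 p.2 * eta k p.1)%:E|)%E) => //.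
    exact: measurableT_comp.
  move=> x _.
  have ix : mu.-integrable setT (EFin \o (fun y => K x y * `|eta k x|)).
    by under eq_fun do rewrite mulrC; exact: integrable_Rscale.
  apply: (@le_trans _ _ (\int[mu]_y (K x y * `|eta k x|)%:E)%E).
    apply: ge0_le_integral => //.
    - apply: measurableT_comp => //; exact: (measurable_int _ (i1 x)).
    - exact: (measurable_int _ ix).
    by move=> y _; rewrite /= lee_fin normrM ger0_norm.
  rewrite -[leLHS]fineK; last exact: (integrable_fin_num measurableT ix).
  rewrite lee_fin -/(Rintegral _ _ _) RintegralZr//.
  apply: ler_pM => //; first exact: Rintegral_ge0.
  exact: (Rintegral_kernel_le K0 mK green_kernel_excess).
rewrite /coef.
transitivity (\int[mu]_x \int[mu]_y (K x y * eta k x)).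
  by apply: eq_Rintegral => x _; rewrite RintegralZr.
rewrite (Rintegral_fubini ifub i1 i2).
transitivity (\int[mu]_y ((lambda k)^-1 * eta k y)).
  apply: eq_Rintegral => y _.
  transitivity (\int[mu]_x (K y x * eta k x)).
    by apply: (@eq_Rintegral _ _ _ mu) => x _; rewrite (green_kernel_sym G_two_sided y x).
  have l0 : lambda k != 0 by rewrite gt_eqF// lambda_gt0.
  by rewrite (eigen_quotient_eigen k y) mulrA mulVf// mul1r.
rewrite RintegralZl ?integrable_eigen_quotient// mulrC.
by congr (_ / _); apply: eq_Rintegral => y _; rewrite mul1r.
Qed.

End bounded.
End eigenfunctions.

Lemma ae_eq0_small d (T : measurableType d) (R : realType)
    (m : {measure set T -> \bar R}) (f : T -> R) : measurable_fun setT f ->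
  (forall x, 0 <= f x) ->
  (forall e : R, 0 < e -> (\int[m]_x (f x)%:E <= e%:E)%E) -> {ae m, forall x, f x = 0}.
Proof.
move=> mf f0 h.
have E : (\int[m]_x `|(f x)%:E| = 0)%E.
  under eq_integral do rewrite gee0_abs ?lee_fin//.
  apply/eqP; rewrite eq_le integral_ge0 ?andbT; last by move=> x _; rewrite lee_fin.
  by apply/lee_addgt0Pr => e e0; rewrite add0e; exact: h.
have /(ae_eq_integral_abs m measurableT) := E.
move=> /(_ _)/wrap[]; first exact/measurable_EFinP.
by apply: filterS => x /(_ I)[].
Qed.

(** * The semigroup as a heat series, and its positivity *)

Section semigroup.
Context {R : realType} {n : nat} (Omega : set 'rV[R]_n) (gamma : R)
  (lambda : nat -> R) (phi : nat -> 'rV[R]_n -> R)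
  (S : R -> ('rV[R]_n -> R) -> 'rV[R]_n -> R) (b : R^nat).
Hypotheses (n_gt0 : (0 < n)%N) (domOmega : bounded_domain Omega)
  (gamma01 : 0 < gamma <= 1) (onb : orthonormal_basis Omega phi)
  (heatS : heat_semigroup Omega gamma lambda phi S).
Local Notation leb := (lebesgue_rV R n).
Local Notation w := (dist_weight Omega gamma).
Local Notation wq := (weight_quotient Omega gamma).
Local Notation mu := (weighted_measure n_gt0 domOmega gamma01).
Local Notation eta := (eigen_quotient Omega gamma phi).
Local Notation lam := lambda.
Hypotheses (b_ge0 : forall k, 0 <= b k) (eta_bounded : forall k x, `|eta k x| <= b k)
  (b_sum : forall t, 0 < t -> cvgn (series (fun k => expR (- lam k * t) * b k ^+ 2))).
Local Notation cf := (coef mu eta).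
Local Notation ht := (heat eta lam).

Let mOmega : measurable Omega. Proof. exact: measurable_domain. Qed.

Let w0 x : Omega x -> 0 < w x.
Proof. exact: dist_weight_gt0. Qed.

Let mw : measurable_fun setT w.
Proof. exact: measurable_dist_weight. Qed.

Let mphi k : measurable_fun Omega (phi k).
Proof. by case: onb => h _ _; exact: (inL2_measurable domOmega (h k)). Qed.

Let meta k : measurable_fun setT (eta k).
Proof. exact: (measurable_weight_quotient gamma n_gt0 domOmega (mphi k)). Qed.

Let eta_orthonormal j k : \int[mu]_y (eta j y * eta k y) = (j == k)%:R.
Proof.
have [_ <- _] := onb.
by rewrite (inner_weight n_gt0 domOmega gamma01 (mphi j) (mphi k)).
Qed.

Definition weight_lift (v : 'rV[R]_n -> R) y := v y * w y.

Lemma weight_liftK v y : Omega y -> wq (weight_lift v) y = v y.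
Proof. by move=> Oy; rewrite weight_quotient_in// mulfK// gt_eqF// w0. Qed.

Lemma measurable_weight_lift (v : 'rV[R]_n -> R) : measurable_fun setT v ->
  measurable_fun Omega (weight_lift v).
Proof. by move=> mv; apply: measurable_funTS; exact: measurable_funM. Qed.

Let mwq (u : 'rV[R]_n -> R) : measurable_fun Omega u -> measurable_fun setT (wq u).
Proof. exact: measurable_weight_quotient. Qed.

Let ae_lift (v : 'rV[R]_n -> R) : {ae mu, forall y, wq (weight_lift v) y = v y}.
Proof.
by apply/ae_weighted; apply: aeW => y Oy; exact: weight_liftK.
Qed.

Lemma weight_lift_inL2 (v : 'rV[R]_n -> R) B : measurable_fun setT v -> (forall y, `|v y| <= B) ->
  inL2 Omega (weight_lift v).
Proof.
move=> mv vB; have mu_ := measurable_weight_lift mv.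
have mf : (weight_lift v) \_ Omega \in mfun.
  by rewrite inE/=; exact: (measurable_restrictT _ mOmega).1 mu_.
apply/andP; split => //; rewrite inE/= /finite_norm.
have : (normL2 Omega (weight_lift v) `^ 2 < +oo)%E.
  rewrite (normL2_sqr n_gt0 domOmega gamma01)//.
  have : mu.-integrable setT (EFin \o (fun y => wq (weight_lift v) y ^+ 2)).
    apply: (@bounded_integrable _ _ _ mu _ (B ^+ 2)).
      by apply: measurable_funX; exact: mwq.
    move=> y; rewrite normrX.
    have [Oy|Oy] := pselect (Omega y).
      rewrite weight_liftK// !expr2.
      by apply: ler_pM (vB y) (vB y).
    by rewrite weight_quotient_out// normr0 expr0n sqr_ge0.
  move=> /integrableP[_]; under eq_integral do rewrite /= ger0_norm ?sqr_ge0//.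
  by [].
rewrite /normL2; move: (Lnorm _ _ _) => [r| |]//=; rewrite ?ltry//.
by rewrite pnatr_eq0.
Qed.

Lemma coef_inner (u : 'rV[R]_n -> R) k : measurable_fun Omega u -> cf (wq u) k = inner Omega u (phi k).
Proof.
by move=> mu_; rewrite (inner_weight n_gt0 domOmega gamma01 mu_ (mphi k)).
Qed.

Lemma eq_coef_ae (u v : 'rV[R]_n -> R) k : measurable_fun setT u -> measurable_fun setT v ->
  {ae mu, forall y, u y = v y} -> cf u k = cf v k.
Proof.
move=> mu_ mv uv; rewrite /coef /Rintegral; congr fine.
apply: ae_eq_integral => //.
- by apply/measurable_EFinP; exact: measurable_funM.
- by apply/measurable_EFinP; exact: measurable_funM.
by apply: filterS uv => y E _; rewrite /= E.
Qed.

Let wq_sum (c : nat -> R) N (u : 'rV[R]_n -> R) y :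
  wq (u - \sum_(k < N) (fun x => c k * phi k x)) y = wq u y - \sum_(k < N) c k * eta k y.
Proof.
rewrite /wq /= fct_sumE /eigen_quotient /wq !mulrBl; congr (_ - _).
by rewrite !mulr_suml; apply: eq_bigr => k _; rewrite !mulrA.
Qed.

Let measurable_partial (c : nat -> R) N (u : 'rV[R]_n -> R) : measurable_fun Omega u ->
  measurable_fun Omega (u - \sum_(k < N) (fun x => c k * phi k x)).
Proof.
move=> mu_; apply: measurable_funB => //.
rewrite (_ : \sum_(k < N) _ = (fun x => \sum_(k < N) c k * phi k x)); last first.
  by apply/funext => x; rewrite fct_sumE.
by apply: measurable_sum => k; exact: measurable_funM.
Qed.

(** By orthonormality, the squared distance of [v] to its partial sum is the squared norm minus the
    sum of squared coefficients; completeness makes it tend to 0. *)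
Lemma heat_parseval (v : 'rV[R]_n -> R) B : measurable_fun setT v -> (forall y, `|v y| <= B) ->
  series (fun k => cf v k ^+ 2) @ \oo --> \int[mu]_y (v y ^+ 2).
Proof.
move=> mv vB; have vL2 := weight_lift_inL2 mv vB.
have mu_ := measurable_weight_lift mv.
have [_ _ /(_ _ vL2) h] := onb.
have iv : mu.-integrable setT (EFin \o v) by exact: (@bounded_integrable _ _ _ mu v B).
have iv2 : mu.-integrable setT (EFin \o (fun y => v y ^+ 2)).
  by under eq_fun do rewrite /= expr2; exact: integrableM_bounded iv mv vB.
have := normL2_cvg0 n_gt0 domOmega gamma01 _ h.
have cE k : inner Omega (weight_lift v) (phi k) = cf v k.
  rewrite -coef_inner//; apply: eq_coef_ae => //; exact: mwq.
have ic k : mu.-integrable setT (EFin \o (fun y => cf v k * eta k y)).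
  by apply: integrable_Rscale => //; exact: (@bounded_integrable _ _ _ mu _ (b k)).
have iS N := integrable_Rsum N ic.
have E N : (\int[mu]_y (wq (weight_lift v - \sum_(k < N)
    (fun x => inner Omega (weight_lift v) (phi k) * phi k x)) y ^+ 2)%:E =
    (\int[mu]_y (v y ^+ 2) - series (fun k => cf v k ^+ 2) N)%:E)%E.
  pose Q y := \sum_(k < N) cf v k * eta k y.
  have [D QD] : exists D, forall y, `|Q y| <= D.
    exists (\sum_(k < N) `|cf v k| * b k) => y; apply: le_trans (ler_norm_sum _ _ _) _.
    by apply: ler_sum => k _; rewrite normrM ler_wpM2l.
  have mQ : measurable_fun setT Q by apply: measurable_sum => k; exact: measurable_funM.
  have ivQ : mu.-integrable setT (EFin \o (fun y => v y * Q y)).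
    exact: integrableM_bounded iv mQ QD.
  have iQ2 : mu.-integrable setT (EFin \o (fun y => Q y ^+ 2)).
    by under eq_fun do rewrite /= expr2; exact: integrableM_bounded (iS N) mQ QD.
  transitivity (\int[mu]_y (v y ^+ 2 - 2 * (v y * Q y) + Q y ^+ 2)%:E)%E.
    apply: ae_eq_integral => //.
    - apply/measurable_EFinP; apply: measurable_funX; apply: mwq.
      exact: (measurable_partial (fun k => inner Omega (weight_lift v) (phi k)) N mu_).
    - apply/measurable_EFinP; apply: measurable_funD; last exact: measurable_funX.
      apply: measurable_funB; first exact: measurable_funX.
      by apply: measurable_funM => //; exact: measurable_funM.
    apply: filterS (ae_lift v) => y Ey _; congr EFin.
    rewrite (wq_sum (fun k => inner Omega (weight_lift v) (phi k))) Ey.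
    under eq_bigr do rewrite cE.
    rewrite -/(Q y); move: (v y) (Q y) => p q; ring.
  have i2 : mu.-integrable setT (EFin \o (fun y => 2 * (v y * Q y))).
    exact: integrable_Rscale.
  have i12 := integrable_Rsub measurableT iv2 i2.
  have itot := integrable_Radd measurableT i12 iQ2.
  rewrite -[LHS]fineK; last exact: (integrable_fin_num measurableT itot).
  congr EFin; rewrite -/(Rintegral _ _ _).
  rewrite RintegralD// RintegralB// RintegralZl//.
  rewrite (combination_square_integral meta eta_bounded eta_orthonormal).
  have -> : \int[mu]_y (v y * Q y) = \sum_(k < N) cf v k ^+ 2.
    transitivity (\int[mu]_y (\sum_(k < N) cf v k * (v y * eta k y))).
      apply: eq_Rintegral => y _; rewrite mulr_sumr; apply: eq_bigr => k _.
      by rewrite mulrCA.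
    rewrite (Rintegral_sum (F := fun k y => cf v k * (v y * eta k y))).
      apply: eq_bigr => k _; rewrite RintegralZl//.
      exact: integrableM_bounded iv (meta k) (eta_bounded k).
    move=> k; apply: integrable_Rscale => //.
    exact: integrableM_bounded iv (meta k) (eta_bounded k).
  rewrite seriesEord/=; move: (\int[mu]_y _) (\sum_(_ < _) _) => p q; ring.
under eq_fun do rewrite E.
move=> /(_ _)/fine_cvgP[].
  by move=> N; exact: (measurable_partial (fun k => inner Omega (weight_lift v) (phi k)) N mu_).
move=> _ /= g; apply/cvgrPdist_lt => e e0; have /cvgrPdist_lt/(_ e e0) := g.
by apply: filterS => N /=; rewrite sub0r normrN.
Qed.

Let coef_bound (u : 'rV[R]_n -> R) k : mu.-integrable setT (EFin \o u) ->
  `|cf u k| <= \int[mu]_y `|u y| * b k.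
Proof. by move=> iu; exact: (coef_le meta eta_bounded). Qed.

Let inL2_integrable (u : 'rV[R]_n -> R) : inL2 Omega u ->
  mu.-integrable setT (EFin \o wq u).
Proof.
move=> uL2; have mu_ := inL2_measurable domOmega uL2.
have i2 := inL2_integrable_sqr n_gt0 domOmega gamma01 uL2.
have i1 : mu.-integrable setT (EFin \o cst (1 : R)).
  by apply: (@bounded_integrable _ _ _ mu (cst 1) 1) => // x; rewrite normr1.
apply: (le_integrable measurableT _ _ (integrable_Radd measurableT i1 i2)).
- by apply/measurable_EFinP; exact: mwq.
- move=> y _; rewrite /= lee_fin [leRHS]ger0_norm ?addr_ge0 ?sqr_ge0//.
  move: (wq u y) => a; have := sqr_ge0 (`|a| - 1); rewrite sqrrB1 real_normK ?num_real//.
  have := normr_ge0 a; lra.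
Qed.

(** The expansion of [S t u] converges in L^2, and at positive times its quotient by [w] also
    converges uniformly, to the heat series; the two limits agree almost everywhere. *)
Lemma semigroup_inL2 t (u : 'rV[R]_n -> R) : 0 < t -> inL2 Omega u ->
  {ae mu, forall y, wq (S t u) y = ht t (cf (wq u)) y}.
Proof.
move=> t0 uL2; have mu_ := inL2_measurable domOmega uL2.
have [/(_ t u (ltW t0) uL2)[SL2 cvS] _ _] := heatS.
have mS := inL2_measurable domOmega SL2.
have iu := inL2_integrable uL2.
pose A := \int[mu]_y `|wq u y|.
have cA k : `|cf (wq u) k| <= A * b k by exact: coef_bound.
pose V k := A * (expR (- lam k * t) * b k ^+ 2).
have cV : cvgn (series V) by exact: (is_cvg_dirichlet_bound b_sum).
pose H y := ht t (cf (wq u)) y.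
have mH : measurable_fun setT H by exact: (measurable_heat b_sum meta eta_bounded cA).
pose cc k := expR (- lam k * t) * inner Omega u (phi k).
pose Q N y := \sum_(k < N) cc k * eta k y.
have QH N y : `|H y - Q N y| <= rsum V - series V N.
  rewrite (_ : Q N y = series (fun k => expR (- lam k * t) * (cf (wq u) k * eta k y)) N).
    apply: rsum_tail_le => // k.
    apply: (@dirichlet_term_le _ lam b A (fun k => cf (wq u) k * eta k y) t).
    exact: (heat_term_le eta_bounded y cA).
  rewrite seriesEord/=; apply: eq_bigr => k _.
  by rewrite /cc -coef_inner// mulrA.
have mQ N : measurable_fun setT (Q N).
  by apply: measurable_sum => k; exact: measurable_funM.
have tail0 : (rsum V - series V N) @[N --> \oo] --> 0.
  by rewrite -(subrr (rsum V)); apply: cvgB; [exact: cvg_cst|exact: cV].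
have := normL2_cvg0 n_gt0 domOmega gamma01 _ cvS.
move=> /(_ (fun N => measurable_partial cc N mS)) IQ.
pose D y := (wq (S t u) y - H y) ^+ 2.
have mD : measurable_fun setT D.
  by apply: measurable_funX; apply: measurable_funB => //; exact: mwq.
suff : {ae mu, forall y, D y = 0}.
  apply: filterS => y /eqP; rewrite sqrf_eq0 subr_eq0 => /eqP.
  exact.
apply: ae_eq0_small => //; first by move=> y; exact: sqr_ge0.
move=> e e0.
have m0 : 0 < 1 + fine (mu setT) by rewrite ltr_wpDr ?fine_ge0.
(* The uniform error is kept below 1 so that its square is below itself; the [1 +] guards the
   division by the mass. *)
have e1 : 0 < Num.min 1 (e / (4 * (1 + fine (mu setT)))).
  by rewrite lt_min ltr01 divr_gt0// mulr_gt0.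
have e4 : 0 < e / 4 by rewrite divr_gt0.
have [N [N1 N2]] : exists N, (\int[mu]_y (wq (S t u - \sum_(k < N)
    (fun x => cc k * phi k x)) y ^+ 2)%:E <= (e / 4)%:E)%E /\
    rsum V - series V N <= Num.min 1 (e / (4 * (1 + fine (mu setT)))).
  have /fine_cvgP[h1 /cvgrPdist_lt/(_ _ e4) h2] := IQ.
  have /cvgrPdist_lt/(_ _ e1) h3 := tail0.
  have [N] := filter_ex (filterI h1 (filterI h2 h3)).
  rewrite /= !sub0r !normrN => -[f1 [f2 f3]].
  exists N; split; last exact: le_trans (ler_norm _) (ltW f3).
  by rewrite -[leLHS]fineK// lee_fin (le_trans (ler_norm _))// ltW.
set d := Num.min _ _ in e1 N2.
apply: (@le_trans _ _ (\int[mu]_y (2 * (wq (S t u - \sum_(k < N)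
    (fun x => cc k * phi k x)) y ^+ 2) + 2 * d ^+ 2)%:E)%E).
  apply: ge0_le_integral => //.
  - by move=> y _; rewrite lee_fin sqr_ge0.
  - exact/measurable_EFinP.
  - apply/measurable_EFinP; apply: measurable_funD => //; apply: measurable_funM => //.
    by apply: measurable_funX; apply: mwq; exact: measurable_partial.
  move=> y _; rewrite lee_fin wq_sum -/(Q N y) /D.
  have := le_trans (QH N y) N2.
  move: (wq (S t u) y) (H y) (Q N y) => p h q hq.
  have : (h - q) ^+ 2 <= d ^+ 2.
    by rewrite -(real_normK (num_real (h - q))) lerXn2r ?nnegrE// ltW.
  have := sqr_ge0 (p - q + (h - q)); rewrite !expr2; nra.
under eq_integral do rewrite EFinD.
rewrite ge0_integralD//; last 3 first.
- by move=> y _; rewrite lee_fin mulr_ge0// sqr_ge0.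
- apply/measurable_EFinP; apply: measurable_funM => //.
  by apply: measurable_funX; apply: mwq; exact: measurable_partial.
- by move=> y _; rewrite lee_fin mulr_ge0// sqr_ge0.
have -> : (\int[mu]_y (2 * d ^+ 2)%:E = (2 * d ^+ 2 * fine (mu setT))%:E)%E.
  by rewrite integral_cst// [RHS]EFinM fineK ?fin_num_measure.
rewrite integral_scale_ge0//; last first.
  by apply: measurable_funX; apply: mwq; exact: measurable_partial.
have d1 : d <= 1 by rewrite /d ge_min lexx.
have d2 : d * (4 * (1 + fine (mu setT))) <= e.
  by rewrite -ler_pdivlMr ?mulr_gt0// /d ge_min lexx orbT.
clearbody d; rewrite (_ : e%:E = (e / 2)%:E + (e / 2)%:E)%E; last by rewrite -EFinD -splitr.
apply: leeD.
  rewrite (_ : e / 2 = 2 * (e / 4)); last by field.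
  by rewrite EFinM lee_wpmul2l.
rewrite lee_fin.
have : 0 <= fine (mu setT) by exact: fine_ge0.
move: (fine (mu setT)) d2 => M d2 M0; rewrite expr2.
have : d * d * M <= d * M by rewrite -mulrA ler_piMl// mulr_ge0// ltW.
lra.
Qed.

(** Smoothing: at each positive time, differences in L^1 become uniform ones. *)
Lemma heat_contraction t (u v : 'rV[R]_n -> R) y : 0 < t ->
  mu.-integrable setT (EFin \o u) -> mu.-integrable setT (EFin \o v) ->
  `|ht t (cf u) y - ht t (cf v) y| <=
    \int[mu]_y `|u y - v y| * dirichlet lam t (fun k => b k ^+ 2).
Proof.
move=> t0 iu iv; have iuv := integrable_Rsub measurableT iu iv.
have cu k := heat_term_le eta_bounded y (fun k => coef_bound k iu) k.
have cv k := heat_term_le eta_bounded y (fun k => coef_bound k iv) k.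
rewrite /heat -(dirichletB b_sum cu cv t0).
apply: (norm_dirichlet_le b_sum) => // k; rewrite -mulrBl.
apply: (heat_term_le eta_bounded (a := fun k => cf u k - cf v k)) => {}k.
rewrite (_ : cf u k - cf v k = cf (fun y => u y - v y) k); first exact: coef_bound.
rewrite /coef -RintegralB//.
- by apply: eq_Rintegral => z _; rewrite mulrBl.
- exact: integrableM_bounded iu (meta k) (eta_bounded k).
- exact: integrableM_bounded iv (meta k) (eta_bounded k).
Qed.

Let clip (j : nat) (r : R) : R := Num.max (- j%:R) (Num.min r j%:R).

Let clip_le j r : `|clip j r| <= j%:R.
Proof.
rewrite ler_norml /clip le_max lexx/= ge_max ge_min lexx orbT andbT.
by rewrite (le_trans _ (ler0n R j))// oppr_le0.
Qed.

Let clip_sub j r : `|clip j r - r| <= `|r|.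
Proof.
rewrite /clip; have j0 := ler0n R j.
by case: (leP r j%:R) => h1; case: (leP (- j%:R)) => h2; rewrite ?subrr ?normr0//;
  rewrite ler_norml; have := ler_norm r; have := ler_norm (- r); rewrite normrN; lra.
Qed.

Let clip_id j r : `|r| <= j%:R -> clip j r = r.
Proof.
rewrite ler_norml => /andP[h1 h2]; rewrite /clip (min_idPl h2).
exact/max_idPr.
Qed.

Let ratio_le (p B M : R) : 0 <= p -> 0 <= B -> 0 <= M -> p / (1 + B * M) * B * M <= p.
Proof.
move=> p0 B0 M0; have h : 0 < 1 + B * M by rewrite ltr_pwDl// mulr_ge0.
rewrite (_ : _ * M = p * (B * M) / (1 + B * M)); last by field; rewrite gt_eqF.
by rewrite ler_pdivrMr// ler_wpM2l// lerDr.
Qed.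

Let triangle_chain (p q r a c : R) : `|p - r| <= a -> a <= c -> `|q - r| <= `|p - q| + c.
Proof.
move=> h1 h2; have := ler_normD (q - p) (p - r); rewrite addrA subrK (distrC q p).
by move=> h; rewrite (le_trans h)// lerD2l (le_trans h1).
Qed.

Let integrable_bounded_quotient (v : 'rV[R]_n -> R) B : measurable_fun setT v ->
  (forall y, `|v y| <= B) -> mu.-integrable setT (EFin \o wq (weight_lift v)).
Proof. by move=> mv vB; apply: inL2_integrable; exact: weight_lift_inL2 mv vB. Qed.

(** Truncations of the quotient lift to L^2, where the formula is known, and converge in the
    weighted L^1 space. The left side follows by the assumed continuity of [S t], the right side by
    [heat_contraction]. *)
Lemma semigroup_inL1w t (u : 'rV[R]_n -> R) : 0 < t -> inL1w Omega gamma u ->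
  {ae mu, forall y, wq (S t u) y = ht t (cf (wq u)) y}.
Proof.
move=> t0 uL1; have [_ /(_ t (ltW t0))[SL1 Scv] _] := heatS.
have [mu_ iu] := (inL1wP n_gt0 domOmega gamma01 u).1 uL1.
have [mSu iSu] := (inL1wP n_gt0 domOmega gamma01 _).1 (SL1 _ uL1).
pose v := wq u; have mv : measurable_fun setT v by exact: mwq.
pose vj j y := clip j (v y).
have mvj j : measurable_fun setT (vj j).
  by apply: measurable_maxr => //; exact: measurable_minr.
have vjB j y : `|vj j y| <= j%:R by exact: clip_le.
pose uj j := weight_lift (vj j).
have muj j : measurable_fun Omega (uj j) by exact: measurable_weight_lift.
have iuj j : mu.-integrable setT (EFin \o wq (uj j)).
  exact: integrable_bounded_quotient (mvj j) (vjB j).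
have ujL1 j : inL1w Omega gamma (uj j) by apply/(inL1wP n_gt0 domOmega gamma01).
have mSj j : measurable_fun Omega (S t (uj j)).
  by have [] := (inL1wP n_gt0 domOmega gamma01 _).1 (SL1 _ (ujL1 j)).
have I0 : (\int[mu]_y (`|wq (uj j) y - v y|)%:E @[j --> \oo] --> 0)%E.
  have inv := integrable_Rnorm iu.
  have aeO : {ae mu, forall y, Omega y} by exact: ae_weighted_domain.
  have h1 j : measurable_fun setT (fun y => (wq (uj j) y)%:E).
    by apply/measurable_EFinP; exact: mwq.
  have h2 : measurable_fun setT (fun y => (v y)%:E) by exact/measurable_EFinP.
  have h3 : {ae mu, forall y, setT y -> (wq (uj j) y)%:E @[j --> \oo] --> (v y)%:E}.
    apply: filterS aeO => y Oy _; apply: cvg_EFin; first exact: nearW.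
    apply: cvg_near_cst; exists (Num.bound `|v y|) => // j /= hj.
    rewrite /uj weight_liftK// /vj clip_id//.
    by rewrite (le_trans (ltW (archi_boundP (normr_ge0 _))))// ler_nat.
  have h4 : mu.-integrable setT (fun y => (`|v y| + `|v y|)%:E) by exact: integrable_Radd.
  have h5 : {ae mu, forall y, forall j, setT y -> (`|(wq (uj j) y)%:E| <= (`|v y| + `|v y|)%:E)%E}.
    apply: filterS aeO => y Oy j _; rewrite /= lee_fin /uj weight_liftK//.
    have := clip_sub j (v y); have := ler_normD (vj j y - v y) (v y).
    by rewrite subrK /vj; lra.
  have [_ h _] := dominated_convergence measurableT h1 h2 h3 h4 h5.
  by apply: cvg_trans h.
have SI : (\int[mu]_y (`|wq (S t (uj j)) y - wq (S t u) y|)%:E @[j --> \oo] --> 0)%E.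
  have E1 j : normL1w Omega gamma (uj j - u) = (\int[mu]_y (`|wq (uj j) y - v y|)%:E)%E.
    rewrite (normL1w_weight n_gt0 domOmega gamma01); last exact: measurable_funB.
    by apply: eq_integral => y _; rewrite weight_quotientB.
  have E2 j : normL1w Omega gamma (S t (uj j) - S t u) =
      (\int[mu]_y (`|wq (S t (uj j)) y - wq (S t u) y|)%:E)%E.
    rewrite (normL1w_weight n_gt0 domOmega gamma01); last exact: measurable_funB.
    by apply: eq_integral => y _; rewrite weight_quotientB.
  under eq_fun do rewrite -E2; apply: Scv => //.
  by under eq_fun do rewrite E1.
pose D y := `|wq (S t u) y - ht t (cf v) y|.
have mH : measurable_fun setT (ht t (cf v)).
  exact: (measurable_heat b_sum meta eta_bounded (fun k => coef_bound k iu)).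
suff : {ae mu, forall y, D y = 0}.
  by apply: filterS => y /eqP; rewrite normr_eq0 subr_eq0 => /eqP.
have mD : measurable_fun setT D.
  by apply: measurableT_comp => //; apply: measurable_funB => //; exact: mwq.
apply: ae_eq0_small => // [y|e e0]; first exact: normr_ge0.
pose B := dirichlet lam t (fun k => b k ^+ 2).
have B0 : 0 <= B.
  apply: le_trans (normr_ge0 (ht t (fun=> 0) 0)) _; rewrite -[B]mul1r.
  by apply: (heat_bounded b_sum eta_bounded) => // k; rewrite normr0 mul1r.
have m0 : 0 < 1 + B * fine (mu setT) by rewrite ltr_wpDr ?mulr_ge0 ?fine_ge0.
have e2 : 0 < e / 2 by rewrite divr_gt0.
have e1 : 0 < e / 2 / (1 + B * fine (mu setT)) by rewrite divr_gt0.
have [j [J1 J2]] : exists j, (\int[mu]_y (`|wq (S t (uj j)) y - wq (S t u) y|)%:E <= (e / 2)%:E)%E /\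
    \int[mu]_y `|wq (uj j) y - v y| <= e / 2 / (1 + B * fine (mu setT)).
  have /fine_cvgP[h1 /cvgrPdist_lt/(_ _ e2) h2] := SI.
  have /fine_cvgP[_ /cvgrPdist_lt/(_ _ e1) h3] := I0.
  have [N] := filter_ex (filterI h1 (filterI h2 h3)).
  rewrite /= !sub0r !normrN => -[f1 [f2 f3]].
  exists N; split; last exact: le_trans (ler_norm _) (ltW f3).
  by rewrite -[leLHS]fineK// lee_fin (le_trans (ler_norm _))// ltW.
have ajL2 := weight_lift_inL2 (mvj j) (vjB j).
apply: (@le_trans _ _ (\int[mu]_y (`|wq (S t (uj j)) y - wq (S t u) y| +
    e / 2 / (1 + B * fine (mu setT)) * B)%:E)%E).
  have mdiff : measurable_fun setT (fun y => `|wq (S t (uj j)) y - wq (S t u) y|).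
    by apply: measurableT_comp => //; apply: measurable_funB; exact: mwq.
  apply: ae_ge0_le_integral => //.
  - by move=> y _; rewrite lee_fin normr_ge0.
  - exact/measurable_EFinP.
  - by move=> y _; rewrite lee_fin addr_ge0 ?normr_ge0// mulr_ge0// ltW.
  - by apply/measurable_EFinP; exact: measurable_funD.
  apply: filterS (semigroup_inL2 t0 ajL2) => y Ey _; rewrite lee_fin /D.
  have h := heat_contraction y t0 (iuj j) iu.
  rewrite -Ey in h; exact: triangle_chain h (ler_wpM2r B0 J2).
under eq_integral do rewrite EFinD.
rewrite ge0_integralD//; last 2 first.
- apply/measurable_EFinP; apply: measurableT_comp => //.
  by apply: measurable_funB; exact: mwq.
- by move=> y _; rewrite lee_fin mulr_ge0// ltW.
rewrite integral_cst// (_ : e%:E = (e / 2)%:E + (e / 2)%:E)%E; last by rewrite -EFinD -splitr.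
apply: leeD => //; rewrite -[X in (_ * X)%E]fineK ?fin_num_measure// -EFinM lee_fin.
exact: ratio_le (ltW e2) B0 (fine_ge0 (measure_ge0 mu setT)).
Qed.

Lemma heat_cvg (T : topologicalType) (F : set_system T) {FF : ProperFilter F} t
    (a : T -> R^nat) (y : T -> 'rV[R]_n) (l : R^nat) A : 0 < t ->
  (forall x k, `|a x k| <= A * b k) ->
  (forall k, (a x k * eta k (y x)) @[x --> F] --> l k) ->
  ht t (a x) (y x) @[x --> F] --> dirichlet lam t l.
Proof.
move=> t0 aA al; rewrite /heat /dirichlet.
apply: (cvg_rsum_dominated (v := fun k => A * (expR (- lam k * t) * b k ^+ 2))).
- by move=> k; apply: cvgM; [exact: cvg_cst|exact: al].
- apply: nearW => x k.
  apply: (@dirichlet_term_le _ lam b A (fun k => a x k * eta k (y x)) t).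
  exact: (heat_term_le eta_bounded (y x) (aA x)).
exact: (is_cvg_dirichlet_bound b_sum).
Qed.

Lemma heat_out t a y : 0 < t -> ~ Omega y -> ht t a y = 0.
Proof.
move=> t0 Oy; apply/eqP; rewrite -normr_le0 -(mul0r (dirichlet lam t (fun k => b k ^+ 2))).
apply: (norm_dirichlet_le b_sum) => // k.
by rewrite /eigen_quotient weight_quotient_out// mulr0 normr0 mul0r.
Qed.

Hypothesis ceta : forall k y, Omega y -> eta k x @[x --> y] --> eta k y.

(* The semigroup only gives positivity almost everywhere; continuity of the
   eigenfunctions upgrades it to every point. *)
Let heat_ge0_everywhere t a A : 0 < t -> (forall k, `|a k| <= A * b k) ->
  {ae mu, forall y, 0 <= ht t a y} -> forall y, 0 <= ht t a y.
Proof.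
move=> t0 aA /ae_weighted[N [mN N0 NP]].
move=> y; have [Oy|Oy] := pselect (Omega y); last by rewrite heat_out.
rewrite leNgt; apply/negP => hy.
have hc : ht t a x @[x --> y] --> ht t a y.
  apply: (@heat_cvg _ _ (nbhs_pfilter y) t (fun=> a) id _ A t0 (fun _ => aA)) => k.
  by apply: cvgM; [exact: cvg_cst|exact: ceta].
have oO : open Omega by case: domOmega.
have hn : \forall x \near y, ht t a x < 0 by exact: (cvgr_lt _ hc _ hy).
have : nbhs y ([set x | ht t a x < 0] `&` Omega).
  by apply: filterI; [exact: hn|exact: open_nbhs_nbhs (conj oO Oy)].
(* A negative value would persist on a ball, which has positive measure but would lie in the null
   set [N]. *)
move=> /nbhs_ballP[r /= r0 yr].
have : (leb (ball y r) <= leb N)%E.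
  apply: le_measure; rewrite ?inE//; first exact: measurable_ball_rV.
  move=> x /yr[h1 h2]; apply: NP => /= /(_ h2).
  by rewrite leNgt h1.
by rewrite N0 lebesgue_rV_ball// lee_fin leNgt exprn_gt0// mulrn_wgt0.
Qed.

(** The submarkov property concerns functions with values in [0, 1], so [v] is rescaled until
    [c * v * w] is one; this is possible because [w] is bounded on [Omega]. *)
Lemma heat_positive :
  (forall t (u : 'rV[R]_n -> R), 0 <= t -> measurable_fun Omega u ->
     {ae leb, forall x, Omega x -> 0 <= u x <= 1} ->
     {ae leb, forall x, Omega x -> 0 <= S t u x <= 1}) ->
  forall t B (v : 'rV[R]_n -> R), 0 < t -> measurable_fun setT v ->
  (forall x, 0 <= v x <= B) -> forall y, 0 <= ht t (cf v) y.
Proof.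
move=> Smarkov t B v t0 mv vB.
have B0 : 0 <= B by have /andP[h1 h2] := vB 0; exact: le_trans h2.
have vn x : `|v x| <= B by have /andP[h1 h2] := vB x; rewrite ger0_norm.
have [W W0 wW] := dist_weight_bounded n_gt0 domOmega gamma01.
pose c := ((B + 1) * W)^-1.
have c0 : 0 < c by rewrite invr_gt0 mulr_gt0// ltr_wpDl.
pose v' x := c * v x.
have mv' : measurable_fun setT v' by exact: measurable_funM.
have v'B x : `|v' x| <= c * B.
  by rewrite normrM (gtr0_norm c0) ler_wpM2l ?(ltW c0).
pose u := weight_lift v'.
have iv : mu.-integrable setT (EFin \o v) by exact: (@bounded_integrable _ _ _ mu v B).
have u01 : {ae leb, forall x, Omega x -> 0 <= u x <= 1}.
  apply: aeW => x Ox; have /andP[v0 v1] := vB x.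
  have wx := dist_weight_ge0 Omega gamma x.
  rewrite /u /weight_lift /v' mulr_ge0 ?mulr_ge0 ?(ltW c0)//= -mulrA /c mulrC.
  rewrite ler_pdivrMr ?mul1r ?mulr_gt0 ?ltr_wpDl//.
  apply: ler_pM (wW _ Ox) => //; rewrite (le_trans v1)// lerDl.
  exact: ler01.
have Sge := Smarkov t u (ltW t0) (measurable_weight_lift mv') u01.
have /(ae_weighted n_gt0 domOmega gamma01 (fun x => 0 <= S t u x <= 1)).2 Sge' := Sge.
have SE := semigroup_inL2 t0 (weight_lift_inL2 mv' v'B).
have cE k : cf (wq u) k = c * cf v k.
  rewrite (@eq_coef_ae (wq u) v')//; first last.
  - exact: ae_lift.
  - exact: (mwq (measurable_weight_lift mv')).
  rewrite /coef -RintegralZl//.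
    by apply: eq_Rintegral => y _; rewrite /v' mulrA.
  exact: integrableM_bounded iv (meta k) (eta_bounded k).
have htE y : ht t (cf (wq u)) y = c * ht t (cf v) y.
  rewrite /heat -(dirichletZ b_sum _ (heat_term_le eta_bounded y (fun k => coef_bound k iv)) t0).
  by apply: eq_rsum => k; rewrite cE !mulrA.
apply: (heat_ge0_everywhere t0 (fun k => coef_bound k iv)).
apply: filterS2 Sge' SE => y /andP[Sy _] Ey.
rewrite -(pmulr_rge0 _ c0) -htE -Ey.
have wy := dist_weight_ge0 Omega gamma y.
by rewrite /wq mulr_ge0 ?indicE// divr_ge0.
Qed.

Lemma heat_eigen_ge0 :
  (forall t B (v : 'rV[R]_n -> R), 0 < t -> measurable_fun setT v ->
    (forall x, 0 <= v x <= B) -> forall y, 0 <= ht t (cf v) y) ->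
  forall t x y, 0 < t -> 0 <= ht t (eta ^~ x) y.
Proof.
move=> pos t x y t0.
apply: (heat_ge0_everywhere (A := 1) t0) => [k|]; first by rewrite mul1r.
exact: (heat_eigen_ae_ge0 b_sum b_ge0 meta eta_bounded pos).
Qed.

End semigroup.

(** * Boundary traces *)

Section uniform_excess.
Context d (T : measurableType d) (R : realType).
Variables (mu : {finite_measure set T -> \bar R}) (C : R) (M : nat).
Hypothesis C0 : 0 <= C.
Implicit Types k : T -> R.

Let min_lip (a b c : R) : `|Num.min a c - Num.min b c| <= `|a - b|.
Proof.
case: (leP a c) => h1; case: (leP b c) => h2; rewrite ?subrr ?normr0//.
  by rewrite ler_norml; have := ler_norm (a - b); have := ler_norm (- (a - b)); rewrite normrN; lra.
by rewrite ler_norml; have := ler_norm (a - b); have := ler_norm (- (a - b)); rewrite normrN; lra.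
Qed.

Let min_split (a c : R) : a = Num.min a c + Num.max (a - c) 0.
Proof.
case: (leP a c) => h; first by rewrite max_r ?addr0// subr_le0.
by rewrite max_l ?subr_ge0 ?(ltW h)// addrC subrK.
Qed.

Definition uniform_excess k := [/\ measurable_fun setT k, forall y, 0 <= k y &
  forall A : R, 1 <= A -> (\int[mu]_y (Num.max (k y - A ^+ M) 0)%:E <= (C / A)%:E)%E].

(** [k] is read as a kernel that does not depend on its first variable. *)
Lemma uniform_excess_integrable k : uniform_excess k -> mu.-integrable setT (EFin \o k).
Proof.
move=> [mk k0 ek].
apply: (@kernel_integrable _ _ _ mu (fun=> k) _ _ C M _ point) => //.
exact: (measurableT_comp mk (@measurable_snd _ _ _ _)).
Qed.

Lemma Rintegral_uniform_excess_le k : uniform_excess k ->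
  \int[mu]_y k y <= fine (mu setT) + C.
Proof.
move=> [mk k0 ek].
apply: (@Rintegral_kernel_le _ _ _ mu (fun=> k) _ _ C M _ point) => //.
exact: (measurableT_comp mk (@measurable_snd _ _ _ _)).
Qed.

(* Vitali's theorem: the excess bound is uniform integrability. *)
Lemma uniform_excess_cvg (k_ : nat -> T -> R) k :
  (forall j, uniform_excess (k_ j)) -> uniform_excess k ->
  {ae mu, forall y, k_ j y @[j --> \oo] --> k y} ->
  \int[mu]_y `|k_ j y - k y| @[j --> \oo] --> 0.
Proof.
move=> ek_ ek cvk.
have ik j := uniform_excess_integrable (ek_ j).
have ik0 := uniform_excess_integrable ek.
have [mk k0 hk] := ek.
apply/cvgrPdist_le => e e0.
(* At this height each of the two excess integrals is at most [e / 3]; the functions cut at [B]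
   converge by domination. *)
pose A := 1 + 3 * C / e.
have A1 : 1 <= A by rewrite lerDl divr_ge0// ?mulr_ge0// ltW.
have A0 : 0 < A by exact: lt_le_trans A1.
pose B := A ^+ M; have B0 : 0 <= B by rewrite exprn_ge0// ltW.
have CA : C / A <= e / 3.
  by rewrite ler_pdivrMr// /A mulrDr mulr1 (_ : e / 3 * _ = C); [lra|field; rewrite gt_eqF].
pose D j y := `|Num.min (k_ j y) B - Num.min (k y) B|.
have mmin j : measurable_fun setT (D j).
  apply: measurableT_comp => //; apply: measurable_funB.
    by apply: measurable_minr => //; case: (ek_ j).
  exact: measurable_minr.
have DB j y : 0 <= D j y <= B.
  have [_ kj0 _] := ek_ j; rewrite normr_ge0/= ler_norml.
  have h1 : 0 <= Num.min (k_ j y) B by rewrite le_min kj0.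
  have h2 : 0 <= Num.min (k y) B by rewrite le_min k0.
  have h3 : Num.min (k_ j y) B <= B by rewrite ge_min lexx orbT.
  have h4 : Num.min (k y) B <= B by rewrite ge_min lexx orbT.
  by apply/andP; split; lra.
have iD j : mu.-integrable setT (EFin \o D j).
  apply: (@bounded_integrable _ _ _ mu _ B) => // y.
  by have /andP[h1 h2] := DB j y; rewrite ger0_norm.
have D0 : \int[mu]_y D j y @[j --> \oo] --> 0.
  have h3 : {ae mu, forall y, setT y -> (D j y)%:E @[j --> \oo] --> (cst 0%E y : \bar R)}.
    apply: filterS cvk => y cy _; apply: cvg_EFin; first exact: nearW.
    apply/cvgrPdist_lt => r r0; have /cvgrPdist_lt/(_ r r0) := cy.
    apply: filterS => j /=; rewrite sub0r normrN normr_id distrC; apply: le_lt_trans.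
    exact: min_lip.
  have h4 : mu.-integrable setT (cst B%:E).
    by apply: (@bounded_integrable _ _ _ mu (cst B) B) => // y; rewrite ger0_norm.
  have h5 : {ae mu, forall y, forall j, setT y -> (`|(D j y)%:E| <= cst B%:E y)%E}.
    by apply: aeW => y j _; rewrite /= lee_fin; have /andP[h1 h2] := DB j y; rewrite ger0_norm.
  have h1 j : measurable_fun setT (fun y => (D j y)%:E) by exact/measurable_EFinP.
  have [_ _ h] := dominated_convergence measurableT h1 (measurable_cst _) h3 h4 h5.
  move: h; rewrite integral0 => /fine_cvgP[_].
  by apply: cvg_trans.
have /cvgrPdist_le/(_ (e / 3)) := D0.
move=> /(_ (divr_gt0 e0 (ltr0Sn _ 2))); apply: filterS => j.
rewrite !sub0r !normrN => hD.
pose ex (f : T -> R) (y : T) : R := Num.max (f y - B) 0.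
have exI f : uniform_excess f -> mu.-integrable setT (EFin \o ex f) /\
    \int[mu]_y ex f y <= C / A.
  move=> [mf f0 hf].
  have mex : measurable_fun setT (ex f).
    by apply: measurable_maxr => //; exact: measurable_funB.
  have ex0 y : 0 <= ex f y by rewrite le_max lexx orbT.
  have iex : mu.-integrable setT (EFin \o ex f).
    apply/integrableP; split; first exact/measurable_EFinP.
    under eq_integral do rewrite /= ger0_norm//.
    exact: le_lt_trans (hf A A1) (ltry _).
  split=> //; rewrite -lee_fin /Rintegral fineK; first exact: hf.
  exact: (integrable_fin_num measurableT iex).
have [i1 e1] := exI _ (ek_ j); have [i2 e2] := exI _ ek.
have i12 := integrable_Radd measurableT (iD j) i1.
have itot := integrable_Radd measurableT i12 i2.
rewrite ger0_norm; last by apply: Rintegral_ge0.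
apply: (@le_trans _ _ (\int[mu]_y (D j y + ex (k_ j) y + ex k y))).
  apply: le_Rintegral => //.
    by apply: integrable_Rnorm; exact: integrable_Rsub.
  move=> y _; rewrite /D /ex.
  rewrite {1}(min_split (k_ j y) B) {1}(min_split (k y) B).
  have m1 : 0 <= Num.max (k_ j y - B) 0 by rewrite le_max lexx orbT.
  have m2 : 0 <= Num.max (k y - B) 0 by rewrite le_max lexx orbT.
  move: m1 m2; move: (Num.min _ _) (Num.min _ _) (Num.max _ _) (Num.max _ _) => p q r t r0 t0.
  rewrite opprD addrACA; apply: le_trans (ler_normD _ _) _.
  rewrite -addrA lerD2l; apply: le_trans (ler_normB _ _) _.
  by rewrite !ger0_norm.
rewrite RintegralD// RintegralD//.
have := le_trans (ler_norm _) hD.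
by move=> h; move: e1 e2; lra.
Qed.

End uniform_excess.

Section selection.
Context {R : realType} {n : nat} (Omega : set 'rV[R]_n).
Hypothesis oOmega : open Omega.

Let rational_point (i : nat) : 'rV[R]_n :=
  if (unpickle i : option 'rV[rat]_n) is Some q then map_mx ratr q else 0.

Let close_point j (z : 'rV[R]_n) i :=
  `[< Omega (rational_point i) /\ ball z j.+1%:R^-1 (rational_point i) >].

Let close_index j z : nat :=
  if pselect (exists i, close_point j z i) is left h then ex_minn h else 0%N.

(* The rational point of Omega of least index within 1 / (j + 1) of z: it makes
   boundary limits limits of jointly measurable sequences. *)
Definition selection j (z : 'rV[R]_n) := rational_point (close_index j z).

Let close_index_ex j z : closure Omega z -> exists i, close_point j z i.
Proof.
move=> /(_ (ball z j.+1%:R^-1)) [].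
  by apply: nbhsx_ballx; rewrite invr_gt0.
move=> x [Ox zx].
have : nbhs x (Omega `&` ball z j.+1%:R^-1).
  apply: filterI; first exact: open_nbhs_nbhs.
  exact: open_nbhs_nbhs (conj (ball_open _ _) zx).
move=> /nbhs_ballP[e /= e0 xe].
have h i : exists q : rat, `|x ord0 i - ratr q| < e.
  have [|q] := @rat_in_itvoo R (x ord0 i - e) (x ord0 i + e).
    by rewrite ltrD2l gtrN.
  by rewrite in_itv/= => qP; exists q; rewrite distrC ltr_distl.
have [q qP] := choice h.
have bq : ball x e (map_mx ratr (\row_i q i) : 'rV[R]_n).
  by split => // i l; rewrite !mxE ord1 /ball/=; exact: qP.
exists (pickle (\row_i q i)); apply/asboolP.
by rewrite /rational_point pickleK; exact: xe.
Qed.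

Lemma selectionP j z : closure Omega z ->
  Omega (selection j z) /\ ball z j.+1%:R^-1 (selection j z).
Proof.
move=> cz; rewrite /selection /close_index; case: pselect => [h|]; last first.
  by have := close_index_ex j cz.
by case: ex_minnP => i /asboolP.
Qed.

Lemma selection_cvg z : closure Omega z ->
  selection j z @[j --> \oo] --> boundary_filter Omega z.
Proof.
move=> cz A /= /nbhs_ballP[e /= e0 zA].
have [N _ Ne] := near_infty_natSinv_lt (PosNum e0).
exists N => // j /= Nj; have [Oj bj] := selectionP j cz.
by apply: zA => //; apply: le_ball bj; apply/ltW/Ne.
Qed.

Lemma measurable_selection j : measurable_fun setT (selection j).
Proof.
have mB i : measurable [set z | close_point j z i].
  have [Oi|Oi] := pselect (Omega (rational_point i)).
    rewrite (_ : [set z | _] = ball (rational_point i) j.+1%:R^-1).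
      exact: measurable_ball_rV.
    apply/seteqP; split => z; first by move=> /asboolP[_]; exact: ball_sym.
    by move=> h; apply/asboolP; split => //; exact: ball_sym.
  rewrite (_ : [set z | _] = set0); first exact: measurable0.
  by apply/seteqP; split => // z /asboolP[].
have midx i : measurable [set z | close_index j z = i].
  have mN l : measurable [set z | ~ close_point j z l].
    exact: (measurableC (mB l)).
  (* The index is [i] when [i] is the first close one; 0 is also the default when no point is
     close. *)
  rewrite (_ : [set z | _] =
    ([set z | close_point j z i] `&` \bigcap_l [set z | (l < i)%N -> ~ close_point j z l]) `|`
    (if i == 0%N then \bigcap_l [set z | ~ close_point j z l] else set0)).
    apply: measurableU.
      apply: measurableI => //; apply: bigcap_measurable => // l _.
      have [li|li] := boolP (l < i)%N; last first.
        by rewrite (_ : [set z | _] = setT)//; apply/seteqP; split.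
      rewrite (_ : [set z | _] = [set z | ~ close_point j z l])//.
      by apply/seteqP; split => z /= h; [exact: h|move=> _].
    by case: ifP => // _; apply: bigcap_measurable => // l _; exact: mN.
  apply/seteqP; split => z /=; rewrite /close_index.
    case: pselect => [h|h]; last first.
      move=> <-; right => l _ /= cl; apply: h; by exists l.
    case: ex_minnP => l cl lmin <-; left; split => // l' _ /= ll' cl'.
    by have := lmin _ cl'; rewrite leqNgt ll'.
  case: pselect => [h|h]; last first.
    by case=> [[ci _]|]; [case: h; exists i|case: eqP].
  case: ex_minnP => l cl lmin [[ci hi]|].
    apply/eqP; rewrite eqn_leq lmin//= leqNgt; apply/negP => li.
    exact: (hi l I li).
  by case: eqP => // _ /(_ l I).
move=> _ A mA; rewrite setTI.
rewrite (_ : _ @^-1` A = \bigcup_(i in [set i | A (rational_point i)]) [set z | close_index j z = i]).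
  apply: bigcup_measurable => i _; exact: midx.
apply/seteqP; split => [z Az|z [i /= Ai zi]]; first by exists (close_index j z).
by rewrite /preimage /= /selection zi.
Qed.

End selection.

Lemma cvg_powR {R : realType} (p x : R) : 0 < x -> r `^ p @[r --> x] --> x `^ p.
Proof.
move=> x0; rewrite /powR (gt_eqF x0).
have h : expR (p * ln r) @[r --> x] --> expR (p * ln x).
  apply: continuous_cvg; first exact: continuous_expR.
  by apply: cvgM; [exact: cvg_cst|exact: continuous_ln].
apply: cvg_trans h; apply: near_eq_cvg; near=> r.
have r0 : 0 < r by near: r; exact: lt_nbhsr.
by rewrite (gt_eqF r0).
Unshelve. all: by end_near. Qed.

Section boundary.
Context {R : realType} {n : nat} (Omega : set 'rV[R]_n) (s gamma : R)
  (G : 'rV[R]_n -> 'rV[R]_n -> \bar R) (c0 C0 : R)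
  (lambda : nat -> R) (phi : nat -> 'rV[R]_n -> R) (C1 : R) (M : nat)
  (b : R^nat) (ext : nat -> 'rV[R]_n -> R).
Hypotheses (n_gt0 : (0 < n)%N) (domOmega : bounded_domain Omega)
  (s0 : 0 < s) (gamma01 : 0 < gamma <= 1) (n2s : 2 * s < n%:R)
  (kernG : nonneg_kernel Omega G) (c0_gt0 : 0 < c0) (C0_gt0 : 0 < C0)
  (G_two_sided : forall x y, Omega x -> Omega y -> x != y ->
         G x y = G y x /\
         ((c0 * comparison_kernel Omega gamma s x y)%:E <= G x y
            <= (C0 * comparison_kernel Omega gamma s x y)%:E)%E)
  (eigG : eigen_decomposition Omega G lambda phi)
  (G_trace : forall z y, frontier Omega z -> Omega y ->
       cvg (boundary_quotient Omega gamma (fun x => fine (G x y)) x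
              @[x --> boundary_filter Omega z])).
Local Notation leb := (lebesgue_rV R n).
Local Notation w := (dist_weight Omega gamma).
Local Notation mu := (weighted_measure n_gt0 domOmega gamma01).
Local Notation eta := (eigen_quotient Omega gamma phi).
Local Notation K := (green_kernel Omega gamma G).
Local Notation lam := lambda.
Local Notation ht := (heat eta lam).
Local Notation bf := (boundary_filter Omega).
Hypotheses (C1_ge0 : 0 <= C1)
 (excess_le : forall (x : 'rV[R]_n) (k : 'rV[R]_n -> R), measurable_fun setT k ->
  (forall y, 0 <= k y) -> k x = 0 ->
  singular_bound Omega s gamma C0 x k -> forall A : R, 1 <= A ->
  (\int[mu]_y (Num.max (k y - A ^+ M) 0)%:E <= (C1 / A)%:E)%E)
 (b_ge0 : forall k, 0 <= b k) (eta_bounded : forall k x, `|eta k x| <= b k)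
 (b_sum : forall t, 0 < t -> cvgn (series (fun k => expR (- lam k * t) * b k ^+ 2)))
 (ext_cvg : forall k z, closure Omega z -> eta k x @[x --> bf z] --> ext k z).

Let oOmega : open Omega. Proof. by case: domOmega. Qed.

Let mOmega : measurable Omega. Proof. exact: measurable_domain. Qed.

Let w0 x : Omega x -> 0 < w x.
Proof. exact: dist_weight_gt0. Qed.

Lemma frontier_out z : frontier Omega z -> ~ Omega z.
Proof. by move=> [_]; rewrite (interior_id Omega).1. Qed.

Lemma frontier_closure z : frontier Omega z -> closure Omega z.
Proof. by case. Qed.

Lemma measurable_frontier : measurable (frontier Omega).
Proof.
apply: measurableD; last by apply: open_measurable_mx; exact: open_interior.
rewrite -[closure _]setCK; apply: measurableC; apply: open_measurable_mx.
by apply: closed_openC; exact: closed_closure.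
Qed.

Lemma boundary_filter_proper z : closure Omega z -> ProperFilter (bf z).
Proof. exact: within_nbhs_proper. Qed.

Lemma boundary_filter_in z : closure Omega z -> bf z Omega.
Proof. by move=> cz; apply: withinT. Qed.

Let near_bf z A : nbhs z A -> bf z A.
Proof. by move=> zA; apply: filterS zA => x Ax _. Qed.

(** The kernel [K] with its first variable moved to the boundary: the trace already divides by the
    weight at that point, so only [w y] is left. *)
Definition boundary_green z y : R :=
  if `[< frontier Omega z /\ Omega y >] then green_trace Omega gamma G z y / w y else 0.
Local Notation g := boundary_green.

Lemma boundary_green_in z y : frontier Omega z -> Omega y ->
  g z y = green_trace Omega gamma G z y / w y.
Proof. by move=> fz Oy; rewrite /g asboolT. Qed.

Lemma boundary_green_out z y : ~ (frontier Omega z /\ Omega y) -> g z y = 0.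
Proof. by move=> h; rewrite /g asboolF. Qed.

Lemma boundary_green_cvg z y : frontier Omega z -> Omega y ->
  K x y @[x --> bf z] --> g z y.
Proof.
move=> fz Oy; have cz := frontier_closure fz.
have ? := boundary_filter_proper cz.
rewrite boundary_green_in//.
have := G_trace fz Oy; rewrite -/(boundary_trace _ _ _ _) => ct.
apply: cvg_trans (_ : (boundary_quotient Omega gamma (fun x => fine (G x y)) x / w y)
  @[x --> bf z] --> _); last by apply: cvgM; [exact: ct|exact: cvg_cst].
apply: near_eq_cvg.
have zy : z != y by apply/eqP => zy; apply: (frontier_out fz); rewrite zy.
have d0 : 0 < `|z - y| by rewrite normr_gt0 subr_eq0.
have h : bf z (Omega `&` ball z `|z - y|).
  by apply: filterI; [exact: boundary_filter_in|apply: near_bf; exact: nbhsx_ballx].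
move: h; apply: filterS => x [Ox zx].
have xy : x != y.
  apply/eqP => xy; move: zx; rewrite xy mx_norm_ball /ball_/=.
  by rewrite ltxx.
rewrite /boundary_quotient green_kernel_in//.
by rewrite -mulrA -invfM.
Qed.

Lemma boundary_green_ge0 z y : 0 <= g z y.
Proof.
have [[fz Oy]|h] := pselect (frontier Omega z /\ Omega y); last first.
  by rewrite boundary_green_out.
have ? := boundary_filter_proper (frontier_closure fz).
apply: (ler_cvg_to (cvg_cst 0) (boundary_green_cvg fz Oy)).
by apply: nearW => x; exact: green_kernel_ge0.
Qed.

(** The bounds for the sections [K x] have constants independent of [x] and right-hand sides
    continuous in [x] away from [y], so they pass to the limit. *)
Lemma boundary_green_bound z : frontier Omega z -> singular_bound Omega s gamma C0 z (g z).
Proof.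
move=> fz y Oy yz; have cz := frontier_closure fz.
have ? := boundary_filter_proper cz.
have cg := boundary_green_cvg fz Oy.
have zy : 0 < `|z - y| by rewrite normr_gt0 subr_eq0 eq_sym.
have cn : `|x - y| @[x --> bf z] --> `|z - y|.
  have cn : continuous (fun x : 'rV[R]_n => `|x - y|).
    apply: (@lipschitz_continuous_rV _ _ _ 1) => p q; rewrite mul1r.
    by rewrite (le_trans (ler_dist_dist _ _))// opprB addrA subrK.
  by move=> A /cn zA; exact: near_bf zA.
have cp p : `|x - y| `^ p @[x --> bf z] --> `|z - y| `^ p.
  exact: (cvg_comp _ _ cn (cvg_powR zy)).
have bd : \forall x \near bf z, Omega x /\ y != x.
  have h : bf z (Omega `&` ball z `|z - y|).
    by apply: filterI; [exact: boundary_filter_in|apply: near_bf; exact: nbhsx_ballx].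
  move: h; apply: filterS => x [Ox zx]; split => //; apply/eqP => xy; move: zx.
  by rewrite -xy mx_norm_ball /ball_/= ltxx.
split.
  apply: (ler_cvg_to (cvgM cg (cvg_cst _)) (cvgM (cvg_cst _) (cp _))).
  move: bd; apply: filterS => x [Ox yx].
  by have [] := green_kernel_bound n_gt0 domOmega gamma01 n2s kernG C0_gt0 G_two_sided Ox Oy yx.
apply: (ler_cvg_to cg (cvgM (cvg_cst _) (cp _))).
move: bd; apply: filterS => x [Ox yx].
by have [] := green_kernel_bound n_gt0 domOmega gamma01 n2s kernG C0_gt0 G_two_sided Ox Oy yx.
Qed.

Let mK : measurable_fun setT (fun p : 'rV[R]_n * 'rV[R]_n => K p.1 p.2).
Proof. exact: measurable_green_kernel. Qed.

(** A limit along a filter is not measurable in [z] by itself; [selection] exhibits it as the limit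
    of a sequence of measurable functions. *)
Lemma measurable_boundary_green :
  measurable_fun setT (fun p : 'rV[R]_n * 'rV[R]_n => g p.1 p.2).
Proof.
have mD : measurable (frontier Omega `*` Omega).
  by apply: measurableX => //; exact: measurable_frontier.
have mg : measurable_fun (frontier Omega `*` Omega) (fun p : 'rV[R]_n * 'rV[R]_n => g p.1 p.2).
  apply: (@measurable_fun_cvg _ _ R _ (fun j (p : 'rV[R]_n * 'rV[R]_n) => K (selection Omega j p.1) p.2)).
    move=> j; apply: measurable_funTS.
    apply: (measurableT_comp mK (g := fun p : 'rV[R]_n * 'rV[R]_n => (selection Omega j p.1, p.2))).
    apply/measurable_fun_pair => //.
    exact: (measurableT_comp (@measurable_selection R n Omega j) (@measurable_fst _ _ _ _)).
  move=> [z y] [/= fz Oy].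
  exact: (cvg_comp _ _ (selection_cvg oOmega (frontier_closure fz)) (boundary_green_cvg fz Oy)).
rewrite (_ : (fun p => _) = (fun p => g p.1 p.2) \_ (frontier Omega `*` Omega)); last first.
  apply/funext => p; rewrite patchE; case: ifPn => // /negP h.
  by rewrite boundary_green_out// => -[h1 h2]; apply: h; rewrite inE.
exact: (measurable_restrictT _ mD).1 mg.
Qed.

Lemma green_kernel_uniform x : uniform_excess mu C1 M (K x).
Proof.
split; first exact: measurable_green_kernel_section.
  by move=> y; exact: green_kernel_ge0.
move=> A A1; exact: (green_kernel_excess n2s kernG C0_gt0 G_two_sided excess_le).
Qed.

Lemma boundary_green_uniform z : uniform_excess mu C1 M (g z).
Proof.
have mg : measurable_fun setT (g z).
  exact: (measurableT_comp measurable_boundary_green (pair1_measurable z)).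
split => //; first by move=> y; exact: boundary_green_ge0.
apply: (@excess_le z (g z)) => //; first by move=> y; exact: boundary_green_ge0.
  by apply: boundary_green_out => -[/frontier_out].
have [fz|fz] := pselect (frontier Omega z); first exact: boundary_green_bound.
move=> y Oy yz; rewrite boundary_green_out; last by case.
by rewrite mul0r !mulr_ge0 ?powR_ge0// ltW.
Qed.

Let meta k : measurable_fun setT (eta k).
Proof. by apply: measurable_eigen_quotient => //; exact: eigG. Qed.

(** At interior points the coefficients of [K x] are [eta k x / lam k], by the eigenvalue equation.
    Along the selected points the sections converge in L^1 by Vitali, which suffices since [eta k]
    is bounded, and [eta k] tends to [ext k z]. *)
Lemma boundary_green_eigen z k : frontier Omega z ->
  coef mu eta (g z) k = ext k z / lam k.
Proof.
move=> fz; have cz := frontier_closure fz.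
have ? := boundary_filter_proper cz.
have lk : lam k != 0 by rewrite gt_eqF// (lambda_gt0 eigG).
have ig := uniform_excess_integrable (boundary_green_uniform z).
have iK x := uniform_excess_integrable (green_kernel_uniform x).
have cs := selection_cvg oOmega cz.
have I0 := uniform_excess_cvg C1_ge0 (fun j => green_kernel_uniform (selection Omega j z))
  (boundary_green_uniform z) _.
have h1 : (coef mu eta (K (selection Omega j z)) k @[j --> \oo]) --> coef mu eta (g z) k.
  apply/cvgrPdist_le => e e0.
  have /cvgrPdist_le/(_ (e / (b k + 1))) : \int[mu]_y `|K (selection Omega j z) y - g z y| @[j --> \oo] --> 0.
    apply: I0; apply: filterS (_ : {ae mu, forall y, Omega y}); last exact: ae_weighted_domain.
    by move=> y Oy; exact: (cvg_comp _ _ cs (boundary_green_cvg fz Oy)).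
  have b1 : 0 < b k + 1 by rewrite ltr_wpDl.
  move=> /(_ (divr_gt0 e0 b1)); apply: filterS => j; rewrite sub0r normrN => hj.
  have id := integrable_Rsub measurableT (iK (selection Omega j z)) ig.
  rewrite distrC /coef -RintegralB//.
  - have ie : mu.-integrable setT (EFin \o (fun y => (K (selection Omega j z) y - g z y) * eta k y)).
      exact: integrableM_bounded id (meta k) (eta_bounded k).
    under eq_Rintegral do rewrite -mulrBl.
    apply: le_trans (le_normr_Rintegral measurableT ie) _.
    apply: (@le_trans _ _ (\int[mu]_y (b k * `|K (selection Omega j z) y - g z y|))).
      apply: le_Rintegral => //.
      - exact: integrable_Rnorm.
      - by apply: integrable_Rscale => //; exact: integrable_Rnorm.
      - by move=> y _; rewrite normrM mulrC ler_wpM2r.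
    rewrite RintegralZl//; last exact: integrable_Rnorm.
    apply: le_trans (ler_wpM2l (b_ge0 k) (le_trans (ler_norm _) hj)) _.
    by rewrite mulrCA ler_piMr ?(ltW e0)// ler_pdivrMr// mul1r lerDl.
  - exact: integrableM_bounded (iK _) (meta k) (eta_bounded k).
  - exact: integrableM_bounded ig (meta k) (eta_bounded k).
have h2 : (coef mu eta (K (selection Omega j z)) k @[j --> \oo]) --> ext k z / lam k.
  have E j : coef mu eta (K (selection Omega j z)) k = eta k (selection Omega j z) / lam k.
    by rewrite (eigen_quotient_eigen n_gt0 domOmega gamma01 kernG G_two_sided eigG k (selection Omega j z)) mulrC mulKf.
  under eq_fun do rewrite E.
  have h : eta k (selection Omega j z) @[j --> \oo] --> ext k z.
    exact: (cvg_comp _ _ cs (@ext_cvg k z cz)).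
  exact: cvgM h (cvg_cst _).
by rewrite -(cvg_lim _ h1)// (cvg_lim _ h2).
Qed.

Lemma ext_bounded k z : closure Omega z -> `|ext k z| <= b k.
Proof.
move=> cz; have ? := boundary_filter_proper cz.
apply: (ler_cvg_to (cvg_norm (@ext_cvg k z cz)) (cvg_cst _)).
by apply: nearW => x; exact: eta_bounded.
Qed.

Lemma ext_heat_cvg t z y : 0 < t -> closure Omega z ->
  ht t (eta ^~ x) y @[x --> bf z] --> ht t (ext ^~ z) y.
Proof.
move=> t0 cz; have ? := boundary_filter_proper cz.
apply: (@heat_cvg _ _ _ _ lam phi b eta_bounded b_sum _ (bf z) _ t
  (fun x => eta ^~ x) (fun=> y) _ 1 t0).
  by move=> x k; rewrite mul1r.
by move=> k; apply: cvgM; [exact: ext_cvg|exact: cvg_cst].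
Qed.

(** The heat kernel is [w x * w y] times the normalised one; the trace divides by [w x], and the
    series passes to the boundary. *)
Lemma heat_trace_boundary t z y : 0 < t -> frontier Omega z -> Omega y ->
  heat_trace Omega gamma lam phi t z y = w y * ht t (ext ^~ z) y.
Proof.
move=> t0 fz Oy; have cz := frontier_closure fz.
have ? := boundary_filter_proper cz.
rewrite /heat_trace /boundary_trace; apply: cvg_lim => //.
have h : (w y * ht t (eta ^~ x) y) @[x --> bf z] --> w y * ht t (ext ^~ z) y.
  by apply: cvgM; [exact: cvg_cst|exact: ext_heat_cvg].
apply: cvg_trans h; apply: near_eq_cvg.
have := boundary_filter_in cz; apply: filterS => x Ox.
have wx := w0 Ox; have wy := w0 Oy.
have cet : cvgn (series (fun k => expR (- lam k * t) * (eta k x * eta k y))).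
  apply: (is_cvg_dirichlet b_sum (A := 1)) => // k; rewrite mul1r expr2 normrM.
  exact: ler_pM.
rewrite /boundary_quotient /heat_kernel.
rewrite (_ : limn _ = (w x * w y) * ht t (eta ^~ x) y); last first.
  rewrite /heat /dirichlet -rsumZ//; apply: eq_rsum => k.
  rewrite /eigen_quotient !weight_quotient_in//.
  move: (w x) (w y) (phi k x) (phi k y) (expR _) wx wy => p q u v e p0 q0.
  by field; rewrite !gt_eqF.
rewrite -[delta Omega x `^ gamma]/(w x); move: wx; move: (w x) (w y) (ht _ _ _) => p q r p0.
by field; rewrite gt_eqF.
Qed.

End boundary.

(** * Convergence to the elliptic solution *)

Section heat_potential.
Context d1 d2 (E : measurableType d1) (T : measurableType d2) (R : realType).
Variables (mu : {finite_measure set T -> \bar R}) (eta : nat -> T -> R) (lam b : R^nat)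
  (a : E -> R^nat) (g : E -> T -> R) (C : R).
Local Notation leb := (@lebesgue_measure R).
Hypotheses
  (b_sum : forall t, 0 < t -> cvgn (series (fun k => expR (- lam k * t) * b k ^+ 2)))
  (b_ge0 : forall k, 0 <= b k)
  (meta : forall k, measurable_fun setT (eta k)) (eta_bounded : forall k x, `|eta k x| <= b k)
  (ma : forall k, measurable_fun setT (a ^~ k)) (a_bounded : forall z k, `|a z k| <= b k)
  (heat_ge0 : forall t z y, 0 < t -> 0 <= heat eta lam t (a z) y)
  (mg : measurable_fun setT (fun p : E * T => g p.1 p.2))
  (g_le : forall z, (\int[mu]_x (g z x)%:E <= C%:E)%E)
  (heat_int : forall z, {ae mu, forall y,
    (\int[leb]_(s in `]0%R, +oo[) (heat eta lam s (a z) y)%:E = (g z y)%:E)%E}).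

(** The value 0 at nonpositive times, where the series is not controlled, makes it measurable and
    nonnegative on all times, as the potential estimates require. *)
Definition positive_heat (t : R) z y := if 0 < t then heat eta lam t (a z) y else 0.

Lemma measurable_positive_heat :
  measurable_fun setT (fun p : (R * E) * T => positive_heat p.1.1 p.1.2 p.2).
Proof.
pose D := [set p : (R * E) * T | 0 < p.1.1].
have mt : measurable_fun setT (fun p : (R * E) * T => p.1.1).
  exact: (measurableT_comp (@measurable_fst _ _ _ _) (@measurable_fst _ _ _ _)).
have mz : measurable_fun setT (fun p : (R * E) * T => p.1.2).
  exact: (measurableT_comp (@measurable_snd _ _ _ _) (@measurable_fst _ _ _ _)).
have mD : measurable D.
  rewrite (_ : D = (fun p : (R * E) * T => p.1.1) @^-1` `]0, +oo[).
    by rewrite -[X in measurable X]setTI; exact: mt.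
  by apply/seteqP; split => p /=; rewrite /D/= in_itv/= andbT.
rewrite (_ : (fun p => _) =
    (fun p : (R * E) * T => heat eta lam p.1.1 (a p.1.2) p.2) \_ D); last first.
  apply/funext => p; rewrite patchE /positive_heat /D.
  by case: ifPn => h; [rewrite mem_set|rewrite memNset//=; exact/negP].
pose F k (p : (R * E) * T) := expR (- lam k * p.1.1) * (a p.1.2 k * eta k p.2).
pose H k (p : (R * E) * T) := 1 * (expR (- lam k * p.1.1) * b k ^+ 2).
have mF k : measurable_fun D (F k).
  apply: measurable_funTS; apply: measurable_funM.
    apply: measurableT_comp => //; exact: measurable_funM.
  apply: measurable_funM.
    exact: (measurableT_comp (ma k) mz).
  exact: (measurableT_comp (meta k) (@measurable_snd _ _ _ _)).
have FH k p : D p -> `|F k p| <= H k p.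
  move=> _; rewrite /H mul1r normrM (ger0_norm (expR_ge0 _)) ler_wpM2l ?expR_ge0//.
  by rewrite normrM expr2; apply: ler_pM.
have cH p : D p -> cvgn (series (H ^~ p)).
  by move=> Dp; exact: (is_cvg_dirichlet_bound b_sum).
have mm := measurable_rsum mF FH cH.
exact: (measurable_restrictT _ mD).1 mm.
Qed.

Lemma positive_heat_ge0 t z y : 0 <= positive_heat t z y.
Proof. by rewrite /positive_heat; case: ifPn => // t0; exact: heat_ge0. Qed.

Lemma positive_heat0 t z y : t <= 0 -> positive_heat t z y = 0.
Proof. by move=> t0; rewrite /positive_heat ltNge t0. Qed.

Lemma integral_positive_heat z :
  {ae mu, forall y, (\int[leb]_s (positive_heat s z y)%:E = (g z y)%:E)%E}.
Proof.
apply: filterS (heat_int z) => y <-; rewrite [RHS]integral_mkcond.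
apply: eq_integral => t _; rewrite patchE /positive_heat.
have [t0|t0] := ltP 0 t.
  by rewrite mem_set//= in_itv/= t0.
by rewrite memNset//= in_itv/= andbT ltNge t0.
Qed.

Section charge.
Variables (nu : {finite_measure set E -> \bar R}) (e : E -> R).
Hypotheses (me : measurable_fun setT e) (e1 : forall z, `|e z| <= 1).

Lemma heat_potential_cvg :
  (\int[mu]_x (`|potential_part nu positive_heat e t x - potential nu g e x|)%:E)%E
    @[t --> +oo] --> 0%E.
Proof.
exact: (potential_part_cvg nu measurable_positive_heat positive_heat_ge0 positive_heat0
  mg g_le integral_positive_heat me e1).
Qed.

Lemma integrable_heat_potential : mu.-integrable setT (EFin \o potential nu g e).
Proof.
exact: (integrable_potential nu measurable_positive_heat positive_heat_ge0
  mg g_le integral_positive_heat me e1).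
Qed.

Lemma integrable_heat_potential_part t : 0 <= t ->
  mu.-integrable setT (EFin \o potential_part nu positive_heat e t).
Proof.
exact: (integrable_potential_part nu measurable_positive_heat positive_heat_ge0
  mg g_le integral_positive_heat me e1).
Qed.

End charge.
End heat_potential.

Section density_sign.
Context d (T : measurableType d) (R : realType) (m : {measure set T -> \bar R}).
Variables (r : T -> R).
Hypothesis ri : m.-integrable setT (EFin \o (fun x => `|r x|)).
Hypothesis mr : measurable_fun setT r.
Local Notation nu := (density (fun x => normr_ge0 (r x)) ri).

(** It vanishes where [r] does. The inverse is written as a real power, which is a measurable
    function. *)
Definition sign_of (x : T) : R := r x * `|r x| `^ (- 1).

Lemma measurable_sign_of : measurable_fun setT sign_of.
Proof.
apply: measurable_funM => //; apply: (measurableT_comp (@measurable_powR R (- 1))).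
exact: measurableT_comp.
Qed.

Let sign_ofM x : sign_of x * `|r x| = r x.
Proof.
rewrite /sign_of powR_inv1//; have [->|r0] := eqVneq (r x) 0; first by rewrite !mul0r.
by rewrite divfK// normr_eq0.
Qed.

Lemma norm_sign_of_le1 x : `|sign_of x| <= 1.
Proof.
rewrite /sign_of powR_inv1//; have [->|r0] := eqVneq (r x) 0.
  by rewrite mul0r normr0.
by rewrite normrM normfV normr_id divff// normr_eq0.
Qed.

Lemma Rintegral_density_sign (k : T -> R) : measurable_fun setT k ->
  \int[nu]_x (k x * sign_of x) = \int[m]_x (k x * r x).
Proof.
move=> mk; rewrite /Rintegral; congr fine.
rewrite integral_density//; last by apply: measurable_funM => //; exact: measurable_sign_of.
apply: eq_integral => x _; rewrite -EFinM; congr EFin.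
by rewrite -mulrA sign_ofM.
Qed.

End density_sign.

(** Dropping the endpoint [r = t] avoids time 0, where the semigroup and the heat series are not
    compared. *)
Lemma Rintegral_reflection_pos {R : realType} (F1 F2 : R -> R) (t : R) :
  measurable_fun setT F2 -> (forall s, 0 < s -> F1 s = F2 s) ->
  \int[@lebesgue_measure R]_(r in `[0, t]) F1 (t - r) =
  \int[@lebesgue_measure R]_(s in `[0, t]) F2 s.
Proof.
move=> mF2 F12; rewrite -(Rintegral_reflection t mF2) /Rintegral; congr fine.
have mF2t : measurable_fun setT (fun r : R => F2 (t - r)).
  by apply: (measurableT_comp mF2); exact: measurable_funB.
have E (r : R) : r \in (`[0, t[%classic : set R) -> F2 (t - r) = F1 (t - r).
  by rewrite inE/= in_itv/= => /andP[_ rt]; rewrite F12// subr_gt0.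
rewrite -[LHS]integral_itv_bndo_bndc; last first.
  apply/measurable_EFinP; apply: (eq_measurable_fun _ E).
  exact: measurable_funTS.
rewrite -[RHS]integral_itv_bndo_bndc; last first.
  by apply/measurable_EFinP; exact: measurable_funTS.
by apply: eq_integral => r rt; rewrite E.
Qed.

Section limit.
Context {R : realType} {n : nat} (Omega : set 'rV[R]_n) (s gamma : R)
  (G : 'rV[R]_n -> 'rV[R]_n -> \bar R) (c0 C0 : R)
  (lambda : nat -> R) (phi : nat -> 'rV[R]_n -> R)
  (S : R -> ('rV[R]_n -> R) -> 'rV[R]_n -> R) (C1 : R) (M : nat)
  (b : R^nat) (ext : nat -> 'rV[R]_n -> R).
Hypotheses (n_gt0 : (0 < n)%N) (domOmega : bounded_domain Omega)
  (s0 : 0 < s) (gamma01 : 0 < gamma <= 1) (n2s : 2 * s < n%:R)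
  (kernG : nonneg_kernel Omega G) (c0_gt0 : 0 < c0) (C0_gt0 : 0 < C0)
  (G_two_sided : forall x y, Omega x -> Omega y -> x != y ->
         G x y = G y x /\
         ((c0 * comparison_kernel Omega gamma s x y)%:E <= G x y
            <= (C0 * comparison_kernel Omega gamma s x y)%:E)%E)
  (eigG : eigen_decomposition Omega G lambda phi)
  (heatS : heat_semigroup Omega gamma lambda phi S)
  (S_submarkov : forall (t : R) (u0 : 'rV[R]_n -> R), 0 <= t ->
       measurable_fun Omega u0 ->
       {ae lebesgue_rV R n, forall x, Omega x -> 0 <= u0 x <= 1} ->
       {ae lebesgue_rV R n, forall x, Omega x -> 0 <= S t u0 x <= 1})
  (G_trace : forall z y, frontier Omega z -> Omega y ->
       cvg (boundary_quotient Omega gamma (fun x => fine (G x y)) x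
              @[x --> boundary_filter Omega z])).
Local Notation leb := (lebesgue_rV R n).
Local Notation leb1 := (@lebesgue_measure R).
Local Notation surf := (@surface_measure R n).
Local Notation w := (dist_weight Omega gamma).
Local Notation wq := (weight_quotient Omega gamma).
Local Notation mu := (weighted_measure n_gt0 domOmega gamma01).
Local Notation eta := (eigen_quotient Omega gamma phi).
Local Notation K := (green_kernel Omega gamma G).
Local Notation g := (boundary_green Omega gamma G).
Local Notation lam := lambda.
Local Notation ht := (heat eta lam).
Local Notation cf := (coef mu eta).
Hypotheses (C1_ge0 : 0 <= C1)
 (excess_le : forall (x : 'rV[R]_n) (k : 'rV[R]_n -> R), measurable_fun setT k ->
  (forall y, 0 <= k y) -> k x = 0 ->
  singular_bound Omega s gamma C0 x k -> forall A : R, 1 <= A ->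
  (\int[mu]_y (Num.max (k y - A ^+ M) 0)%:E <= (C1 / A)%:E)%E)
 (b_ge0 : forall k, 0 <= b k) (eta_bounded : forall k x, `|eta k x| <= b k)
 (b_sum : forall t, 0 < t -> cvgn (series (fun k => expR (- lam k * t) * b k ^+ 2)))
 (ceta : forall k y, Omega y -> eta k x @[x --> y] --> eta k y)
 (ext_cvg : forall k z, closure Omega z ->
    eta k x @[x --> boundary_filter Omega z] --> ext k z).

Let onb : orthonormal_basis Omega phi. Proof. by case: eigG. Qed.

Let lam0_gt0 : 0 < lam 0%N. Proof. by case: eigG => /andP[]. Qed.

Let lam_ge k : lam 0%N <= lam k. Proof. exact: (lambda_ge eigG). Qed.

Let oOmega : open Omega. Proof. by case: domOmega. Qed.

Let mOmega : measurable Omega. Proof. exact: measurable_domain. Qed.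

Let mfront : measurable (frontier Omega). Proof. exact: measurable_frontier. Qed.

Let w0 x : Omega x -> 0 < w x.
Proof. exact: dist_weight_gt0. Qed.

Let mw : measurable_fun setT w.
Proof. exact: measurable_dist_weight. Qed.

Let meta k : measurable_fun setT (eta k).
Proof. by apply: measurable_eigen_quotient => //; exact: eigG. Qed.

Let mK : measurable_fun setT (fun p : 'rV[R]_n * 'rV[R]_n => K p.1 p.2).
Proof. exact: measurable_green_kernel. Qed.

Let positive t B (v : 'rV[R]_n -> R) : 0 < t -> measurable_fun setT v ->
  (forall x, 0 <= v x <= B) -> forall y, 0 <= ht t (cf v) y.
Proof. exact: (heat_positive n_gt0 domOmega gamma01 onb heatS eta_bounded b_sum ceta S_submarkov). Qed.

Let eigen_ge0 t x y : 0 < t -> 0 <= ht t (eta ^~ x) y.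
Proof.
exact: (heat_eigen_ge0 onb b_ge0 eta_bounded b_sum ceta (@positive)).
Qed.

Let parseval (v : 'rV[R]_n -> R) B : measurable_fun setT v -> (forall x, `|v x| <= B) ->
  series (fun k => cf v k ^+ 2) @ \oo --> \int[mu]_y (v y ^+ 2).
Proof. exact: (heat_parseval onb eta_bounded). Qed.

(** [heat_integral] with the Green potential of 1 as supersolution. Interior and boundary sections
    of the kernel both fit, with different coefficients. *)
Let heat_int_of (a : R^nat) (k : 'rV[R]_n -> R) : (forall j, `|a j| <= b j) ->
  uniform_excess mu C1 M k -> (forall j, cf k j = a j / lam j) ->
  (forall t y, 0 < t -> 0 <= ht t a y) ->
  {ae mu, forall y, (\int[leb1]_(t in `]0%R, +oo[) (ht t a y)%:E = (k y)%:E)%E}.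
Proof.
move=> ab uk ca ha.
have [c1 [C1' [c1_gt0 psi_le psi_ge]]] := green_potential_bounds
  n2s kernG c0_gt0 C0_gt0 G_two_sided eigG C1_ge0 excess_le.
have mpsi : measurable_fun setT (fun x => \int[mu]_y K x y).
  exact: (measurable_partial_Rintegral mu mK).
have cpsi := coef_green_potential
  n2s kernG C0_gt0 G_two_sided eigG C1_ge0 excess_le.
have ik := uniform_excess_integrable uk; have [_ k0 _] := uk.
exact: (heat_integral lam0_gt0 lam_ge b_sum b_ge0 meta eta_bounded (@parseval) (@positive)
  mpsi psi_le c1_gt0 psi_ge cpsi ab k0 ik ca ha).
Qed.

Let Kuniform x : uniform_excess mu C1 M (K x).
Proof. exact: (green_kernel_uniform n2s kernG C0_gt0 G_two_sided excess_le). Qed.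

Let guniform z : uniform_excess mu C1 M (g z).
Proof. exact: (boundary_green_uniform n2s kernG C0_gt0 G_two_sided G_trace excess_le). Qed.

Let interior_int z : {ae mu, forall y,
  (\int[leb1]_(t in `]0%R, +oo[) (ht t (eta ^~ z) y)%:E = (K z y)%:E)%E}.
Proof.
apply: heat_int_of => //; last by move=> t y; exact: eigen_ge0.
move=> k; have lk : lam k != 0 by rewrite gt_eqF// (lambda_gt0 eigG).
rewrite (eigen_quotient_eigen n_gt0 domOmega gamma01 kernG G_two_sided eigG k z).
by rewrite mulrC mulKf.
Qed.

(** Cut off outside the boundary, so that bounds and measurability hold at every [z]. *)
Let bext (z : 'rV[R]_n) k : R := ext k z * \1_(frontier Omega) z.

Let bext_in z : frontier Omega z -> bext z = ext ^~ z.
Proof. by move=> fz; apply/funext => k; rewrite /bext indicE mem_set// mulr1. Qed.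

Let bext_out z k : ~ frontier Omega z -> bext z k = 0.
Proof. by move=> fz; rewrite /bext indicE memNset// mulr0. Qed.

Let bext_bounded z k : `|bext z k| <= b k.
Proof.
have [fz|fz] := pselect (frontier Omega z); last by rewrite bext_out// normr0.
rewrite bext_in//; exact: (ext_bounded eta_bounded ext_cvg k (frontier_closure fz)).
Qed.

Let measurable_bext k : measurable_fun setT (bext ^~ k).
Proof.
have mm : measurable_fun (frontier Omega) (ext k).
  apply: (@measurable_fun_cvg _ _ R _ (fun j z => eta k (selection Omega j z))).
    move=> j; apply: measurable_funTS.
    exact: (measurableT_comp (meta k) (@measurable_selection R n Omega j)).
  move=> z fz; have cz := frontier_closure fz.
  exact: (cvg_comp _ _ (selection_cvg oOmega cz) (@ext_cvg k z cz)).
rewrite (_ : (fun z => _) = ext k \_ (frontier Omega)).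
  exact: (measurable_restrictT _ mfront).1 mm.
apply/funext => z; rewrite patchE; case: ifPn => [/set_mem fz|/negP fz].
  by rewrite bext_in.
by rewrite bext_out// => fz'; apply: fz; rewrite inE.
Qed.

Let boundary_ge0 t z y : 0 < t -> 0 <= ht t (bext z) y.
Proof.
move=> t0; have [fz|fz] := pselect (frontier Omega z); last first.
  rewrite (_ : ht t (bext z) y = 0)//.
  apply/eqP; rewrite -normr_le0 -(mul0r (dirichlet lam t (fun k => b k ^+ 2))).
  by apply: (norm_dirichlet_le b_sum) => // k; rewrite bext_out// !mul0r normr0.
have cz := frontier_closure fz; have ? := boundary_filter_proper cz.
rewrite bext_in//.
have hc : ht t (eta ^~ x) y @[x --> boundary_filter Omega z] --> ht t (ext ^~ z) y.
  exact: (ext_heat_cvg eta_bounded b_sum ext_cvg).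
apply: (ler_cvg_to (cvg_cst 0) hc).
by apply: nearW => x; exact: eigen_ge0.
Qed.

Let boundary_int z : {ae mu, forall y,
  (\int[leb1]_(t in `]0%R, +oo[) (ht t (bext z) y)%:E = (g z y)%:E)%E}.
Proof.
apply: heat_int_of => //; last by move=> t y; exact: boundary_ge0.
move=> k; have [fz|fz] := pselect (frontier Omega z).
  rewrite bext_in//.
  exact: (boundary_green_eigen n2s kernG C0_gt0 G_two_sided eigG
    G_trace C1_ge0 excess_le b_ge0 eta_bounded ext_cvg k fz).
rewrite bext_out// mul0r /coef /Rintegral integral0_eq// => y _.
by rewrite boundary_green_out ?mul0r// => -[].
Qed.

Let Cg := fine (mu setT) + C1.

Let uniform_le (k : 'rV[R]_n -> R) : uniform_excess mu C1 M k ->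
  (\int[mu]_x (k x)%:E <= Cg%:E)%E.
Proof.
move=> uk; have ik := uniform_excess_integrable uk.
rewrite -[leLHS]fineK; last exact: (integrable_fin_num measurableT ik).
by rewrite lee_fin; exact: (Rintegral_uniform_excess_le uk).
Qed.

Variables (u0 f h : 'rV[R]_n -> R).
Hypotheses (u0L1 : inL1w Omega gamma u0) (fL1 : inL1w Omega gamma f)
  (hL1 : surface_measure.-integrable (frontier Omega) (EFin \o h)).

Let iu0 : mu.-integrable setT (EFin \o wq u0).
Proof. by have [] := (inL1wP n_gt0 domOmega gamma01 u0).1 u0L1. Qed.

Let mf : measurable_fun Omega f.
Proof. by have [] := (inL1wP n_gt0 domOmega gamma01 f).1 fL1. Qed.

Let r1 := wq f.

Let mr1 : measurable_fun setT r1.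
Proof. exact: measurable_weight_quotient. Qed.

Let ir1 : mu.-integrable setT (EFin \o r1).
Proof. by have [] := (inL1wP n_gt0 domOmega gamma01 f).1 fL1. Qed.

Let ir1n : mu.-integrable setT (EFin \o (fun x => `|r1 x|)).
Proof. exact: integrable_Rnorm. Qed.

Let r2 z := h z * \1_(frontier Omega) z.

Let r2E : EFin \o r2 = (EFin \o h) \_ (frontier Omega).
Proof.
apply/funext => z; rewrite patchE /r2 /= indicE.
by case: ifPn => _; rewrite ?mulr1 ?mulr0.
Qed.

Let ir2 : surf.-integrable setT (EFin \o r2).
Proof. by rewrite r2E; exact/(integrable_mkcond _ mfront). Qed.

Let mr2 : measurable_fun setT r2.
Proof. by have /integrableP[/measurable_EFinP] := ir2. Qed.

Let ir2n : surf.-integrable setT (EFin \o (fun x => `|r2 x|)).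
Proof. exact: (integrable_abse ir2). Qed.

Local Notation nu1 := (density (fun x => normr_ge0 (r1 x)) ir1n).
Local Notation nu2 := (density (fun x => normr_ge0 (r2 x)) ir2n).
Local Notation q1 := (positive_heat eta lam (fun z k => eta k z)).
Local Notation q2 := (positive_heat eta lam bext).
Local Notation e1 := (sign_of r1).
Local Notation e2 := (sign_of r2).

Let me1 : measurable_fun setT e1. Proof. exact: measurable_sign_of. Qed.

Let me2 : measurable_fun setT e2. Proof. exact: measurable_sign_of. Qed.

Let mq1 : measurable_fun setT (fun p : (R * 'rV[R]_n) * 'rV[R]_n => q1 p.1.1 p.1.2 p.2).
Proof. by apply: (measurable_positive_heat b_sum) => // z k; exact: eta_bounded. Qed.

Let mq2 : measurable_fun setT (fun p : (R * 'rV[R]_n) * 'rV[R]_n => q2 p.1.1 p.1.2 p.2).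
Proof. exact: (measurable_positive_heat b_sum). Qed.

Let mg : measurable_fun setT (fun p : 'rV[R]_n * 'rV[R]_n => g p.1 p.2).
Proof. exact: measurable_boundary_green. Qed.

Let pp1 := potential_part nu1 q1 e1.
Let pp2 := potential_part nu2 q2 e2.
Let pot1 := potential nu1 K e1.
Let pot2 := potential nu2 g e2.

Let pp1_cvg : (\int[mu]_x (`|pp1 t x - pot1 x|)%:E)%E @[t --> +oo] --> 0%E.
Proof.
apply: (heat_potential_cvg b_sum meta eta_bounded meta (fun z k => eta_bounded k z)
  (fun t z y => @eigen_ge0 t z y) mK (fun z => uniform_le (Kuniform z)) interior_int nu1 me1).
exact: norm_sign_of_le1.
Qed.

Let pp2_cvg : (\int[mu]_x (`|pp2 t x - pot2 x|)%:E)%E @[t --> +oo] --> 0%E.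
Proof.
apply: (heat_potential_cvg b_sum meta eta_bounded measurable_bext bext_bounded
  (fun t z y => @boundary_ge0 t z y) mg (fun z => uniform_le (guniform z)) boundary_int nu2 me2).
exact: norm_sign_of_le1.
Qed.

Let ipot1 : mu.-integrable setT (EFin \o pot1).
Proof.
apply: (integrable_heat_potential b_sum meta eta_bounded meta (fun z k => eta_bounded k z)
  (fun t z y => @eigen_ge0 t z y) mK (fun z => uniform_le (Kuniform z)) interior_int nu1 me1).
exact: norm_sign_of_le1.
Qed.

Let ipot2 : mu.-integrable setT (EFin \o pot2).
Proof.
apply: (integrable_heat_potential b_sum meta eta_bounded measurable_bext bext_bounded
  (fun t z y => @boundary_ge0 t z y) mg (fun z => uniform_le (guniform z)) boundary_int nu2 me2).
exact: norm_sign_of_le1.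
Qed.

Let ipp1 t : 0 <= t -> mu.-integrable setT (EFin \o pp1 t).
Proof.
apply: (integrable_heat_potential_part b_sum meta eta_bounded meta (fun z k => eta_bounded k z)
  (fun t z y => @eigen_ge0 t z y) mK (fun z => uniform_le (Kuniform z)) interior_int nu1 me1).
exact: norm_sign_of_le1.
Qed.

Let ipp2 t : 0 <= t -> mu.-integrable setT (EFin \o pp2 t).
Proof.
apply: (integrable_heat_potential_part b_sum meta eta_bounded measurable_bext bext_bounded
  (fun t z y => @boundary_ge0 t z y) mg (fun z => uniform_le (guniform z)) boundary_int nu2 me2).
exact: norm_sign_of_le1.
Qed.

Let green_potential x : Omega x -> green Omega G f x = w x * pot1 x.
Proof.
move=> Ox; rewrite (green_weighted n_gt0 domOmega gamma01 kernG G_two_sided mf Ox); congr (_ * _).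
rewrite /pot1 /potential (Rintegral_density_sign ir1n mr1 (k := fun z => K z x)); last first.
  exact: (measurable_fun_pair1 x mK).
by apply: eq_Rintegral => y _; rewrite (green_kernel_sym G_two_sided x y).
Qed.

(** Surface integrals against [h] become integrals for the finite measure [nu2] with the sign [e2],
    the only form in which they enter Fubini. *)
Let surface_potential (k F : 'rV[R]_n -> R) c : measurable_fun setT k -> 0 <= c ->
  (forall z, frontier Omega z -> F z = c * k z) ->
  \int[surf]_(z in frontier Omega) (F z * h z) = c * \int[nu2]_z (k z * e2 z).
Proof.
move=> mk c0' Fk; rewrite (Rintegral_density_sign ir2n mr2 mk).
transitivity (\int[surf]_(z in frontier Omega) (c * (k z * r2 z))).
  apply: eq_Rintegral => z /set_mem fz; rewrite Fk// /r2 indicE mem_set// mulr1.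
  by rewrite mulrA.
rewrite Rintegral_scale_ge0//; last by apply: measurable_funTS; exact: measurable_funM.
congr (_ * _); rewrite /Rintegral integral_mkcond; congr fine.
apply: eq_integral => z _; rewrite patchE; case: ifPn => // /negP fz.
by rewrite /r2 indicE memNset ?mulr0// => fz'; apply: fz; rewrite inE.
Qed.

Let martin_potential x : Omega x -> martin Omega gamma G h x = w x * pot2 x.
Proof.
move=> Ox; apply: surface_potential.
- exact: (measurable_fun_pair1 x mg).
- exact: dist_weight_ge0.
move=> z fz; rewrite boundary_green_in// mulrC divfK// gt_eqF//.
exact: w0.
Qed.

Let boundary_part t x : 0 <= t -> Omega x ->
  \int[leb1]_(r in `[0, t]) \int[surf]_(z in frontier Omega)
    (heat_trace Omega gamma lam phi (t - r) z x * h z) = w x * pp2 t x.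
Proof.
move=> t0 Ox.
pose H (r : R) := \int[nu2]_z (q2 r z x * e2 z).
have mH : measurable_fun setT H.
  apply: (measurable_partial_Rintegral nu2 (f := fun p : R * 'rV[R]_n => q2 p.1 p.2 x * e2 p.2)).
  apply: measurable_funM; first exact: (measurable_fun_pair1 x mq2).
  exact: (measurableT_comp me2 (@measurable_snd _ _ _ _)).
rewrite (@Rintegral_reflection_pos _ (fun r => \int[surf]_(z in frontier Omega)
    (heat_trace Omega gamma lam phi r z x * h z)) (fun r => w x * H r)); first last.
- move=> r r0; apply: surface_potential.
  + exact: (measurable_fun_pair2 r (measurable_fun_pair1 x mq2)).
  + exact: dist_weight_ge0.
  move=> z fz; rewrite (heat_trace_boundary n_gt0 domOmega eta_bounded b_sum ext_cvg r0 fz Ox).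
  by rewrite /positive_heat r0 bext_in.
- by apply: measurable_funM; [exact: measurable_cst|exact: mH].
rewrite Rintegral_scale_ge0//; first exact: dist_weight_ge0.
exact: measurable_funTS.
Qed.

(** The cut-off turns the measurability of [S] on nonnegative times and [Omega] into measurability
    on the whole product. *)
Let F (r : R) x := if `[< 0 < r /\ Omega x >] then S r f x else 0.

Let measurable_F : measurable_fun setT (fun p : R * 'rV[R]_n => F p.1 p.2).
Proof.
have [_ _ /(_ f fL1) mS] := heatS.
have mD : measurable ((`]0, +oo[%classic : set R) `*` Omega) by exact: measurableX.
have mS' : measurable_fun ((`]0, +oo[%classic : set R) `*` Omega)
    (fun p : R * 'rV[R]_n => S p.1 f p.2).
  apply: measurable_funS mS.
    apply: measurableX => //; rewrite (_ : [set t | _] = (`[0, +oo[%classic : set R))//.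
    by apply/seteqP; split => r /=; rewrite in_itv/= andbT.
  by move=> [r x] [/=]; rewrite in_itv/= andbT => /ltW.
rewrite (_ : (fun p => _) = (fun p : R * 'rV[R]_n => S p.1 f p.2) \_
    ((`]0, +oo[%classic : set R) `*` Omega)).
  exact: (measurable_restrictT _ mD).1 mS'.
apply/funext => -[r x]; rewrite patchE /F /=; case: asboolP => [[r0 Ox]|h'].
  by rewrite mem_set//; split => //=; rewrite in_itv/= r0.
by rewrite memNset// => -[/=]; rewrite in_itv/= andbT => r0 Ox; apply: h'.
Qed.

Let source_part_F t x : Omega x ->
  \int[leb1]_(r in `[0, t]) S (t - r) f x = \int[leb1]_(r in `[0, t]) F r x.
Proof.
move=> Ox; apply: (@Rintegral_reflection_pos _ (fun r => S r f x) (fun r => F r x)).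
  exact: (measurable_fun_pair1 x measurable_F).
by move=> r r0; rewrite /F asboolT.
Qed.

Let H1 (r : R) x := \int[nu1]_z (q1 r z x * e1 z).

Let mH1 : measurable_fun setT (fun p : R * 'rV[R]_n => H1 p.1 p.2).
Proof.
apply: (measurable_partial_Rintegral nu1
  (f := fun p : (R * 'rV[R]_n) * 'rV[R]_n => q1 p.1.1 p.2 p.1.2 * e1 p.2)).
apply: measurable_funM; last exact: (measurableT_comp me1 (@measurable_snd _ _ _ _)).
apply: (measurableT_comp mq1
  (g := fun p : (R * 'rV[R]_n) * 'rV[R]_n => ((p.1.1, p.2), p.1.2))).
have m11 : measurable_fun setT (fun p : (R * 'rV[R]_n) * 'rV[R]_n => p.1.1).
  exact: (measurableT_comp (@measurable_fst _ _ _ _) (@measurable_fst _ _ _ _)).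
have m12 : measurable_fun setT (fun p : (R * 'rV[R]_n) * 'rV[R]_n => p.1.2).
  exact: (measurableT_comp (@measurable_snd _ _ _ _) (@measurable_fst _ _ _ _)).
by apply/measurable_fun_pair => //; exact/measurable_fun_pair.
Qed.

(** Symmetry of the heat kernel lets the charge sit in the variable of integration, and the pairing
    formula then gives the heat flow of [r1]. *)
Let H1E r x : 0 < r -> H1 r x = ht r (cf r1) x.
Proof.
move=> r0; rewrite /H1 (Rintegral_density_sign ir1n mr1 (k := fun z => q1 r z x)); last first.
  exact: (measurable_fun_pair2 r (measurable_fun_pair1 x mq1)).
have a1 k : `|eta k x| <= 1 * b k by rewrite mul1r.
transitivity (\int[mu]_z (ht r (eta ^~ x) z * r1 z)).
  apply: eq_Rintegral => z _; rewrite /positive_heat r0; congr (_ * _).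
  by apply: eq_rsum => k; congr (_ * _); exact: mulrC.
rewrite (integral_heat b_sum b_ge0 meta eta_bounded (a := eta ^~ x) a1 ir1 r0).
by apply: eq_rsum => k; congr (_ * _); exact: mulrC.
Qed.

(** [S r f] is identified with the heat series at each [r] for almost every [x], whereas the time
    integral at a fixed [x] needs the quantifiers in the other order. *)
Let source_ae : {ae mu, forall x, {ae leb1, forall r, (F r x)%:E = (w x * H1 r x)%:E}}.
Proof.
have mwH : measurable_fun setT (fun p : R * 'rV[R]_n => w p.2 * H1 p.1 p.2).
  apply: measurable_funM; last exact: mH1.
  exact: (measurableT_comp mw (@measurable_snd _ _ _ _)).
apply: (@ae_swap _ _ _ _ _ leb1 mu (fun p => (F p.1 p.2)%:E) (fun p => (w p.2 * H1 p.1 p.2)%:E)).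
- exact/measurable_EFinP.
- exact/measurable_EFinP.
apply: aeW => r; have [r0|r0] := ltP 0 r; last first.
  apply: aeW => x /=; rewrite /F asboolF; last by rewrite ltNge r0 => -[].
  rewrite /H1 /Rintegral integral0_eq ?mulr0// => z _.
  by rewrite positive_heat0// mul0r.
apply: filterS2 (semigroup_inL1w n_gt0 domOmega gamma01 onb heatS b_ge0 eta_bounded b_sum r0 fL1)
  (ae_weighted_domain n_gt0 domOmega gamma01) => x Ex Ox /=.
rewrite /F asboolT// H1E// -Ex mulrC.
by rewrite (weight_quotientK gamma n_gt0 domOmega).
Qed.

Let source_part t : 0 <= t -> {ae mu, forall x,
  \int[leb1]_(r in `[0, t]) S (t - r) f x = w x * pp1 t x}.
Proof.
move=> t0.
apply: filterS2 source_ae (ae_weighted_domain n_gt0 domOmega gamma01) => x [N [mN N0 NP]] Ox.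
have mHx : measurable_fun setT (H1 ^~ x) by exact: (measurable_fun_pair1 x mH1).
have mFx : measurable_fun setT (F ^~ x) by exact: (measurable_fun_pair1 x measurable_F).
rewrite source_part_F// /pp1 /potential_part -Rintegral_scale_ge0//; first last.
- exact: measurable_funTS.
- exact: dist_weight_ge0.
rewrite /Rintegral; congr fine; apply: ae_eq_integral => //.
- by apply/measurable_EFinP; exact: measurable_funTS.
- apply/measurable_EFinP; apply: measurable_funTS; apply: measurable_funM; last exact: mHx.
  exact: measurable_cst.
by exists N; split => // r nr; apply: NP => Er; apply: nr => _; exact: Er.
Qed.

Local Notation par t := (parabolic Omega gamma lambda phi S u0 (fun=> f) (fun=> h) t).

(** Membership in the weighted space asks for measurability of the function itself, so the source
    term is rewritten with [F] at every point of [Omega] rather than through the almost everywhere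
    identity [source_part]. *)
Let measurable_par t : 0 <= t -> measurable_fun Omega (par t).
Proof.
move=> t0; have [_ /(_ t t0)[SL1 _] _] := heatS.
have [mSu _] := (inL1wP n_gt0 domOmega gamma01 _).1 (SL1 _ u0L1).
pose I x := \int[leb1]_r (F r x * \1_(`[0, t]%classic : set R) r).
have mI : measurable_fun setT I.
  apply: (measurable_partial_Rintegral leb1
    (f := fun p : 'rV[R]_n * R => F p.2 p.1 * \1_(`[0, t]%classic : set R) p.2)).
  apply: measurable_funM.
    apply: (measurableT_comp measurable_F (g := fun p : 'rV[R]_n * R => (p.2, p.1))).
    by apply/measurable_fun_pair; [exact: measurable_snd|exact: measurable_fst].
  have mi : measurable_fun setT (\1_(`[0, t]%classic : set R) : R -> R) by exact: measurable_indic.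
  exact: (measurableT_comp mi (@measurable_snd _ _ _ _)).
apply: (eq_measurable_fun (fun x => S t u0 x + I x + w x * pp2 t x)).
  move=> x /set_mem Ox; rewrite /parabolic boundary_part// source_part_F//; congr (_ + _ + _).
  rewrite /I /Rintegral; congr fine; rewrite [RHS]integral_mkcond; apply: eq_integral => r _.
  by rewrite patchE indicE; case: ifPn => _; rewrite ?mulr1 ?mulr0.
have mpp2 : measurable_fun setT (pp2 t) by have /integrableP[/measurable_EFinP] := ipp2 t0.
apply: measurable_funD; first by apply: measurable_funD => //; exact: measurable_funTS.
by apply: measurable_funTS; exact: measurable_funM.
Qed.

Let inL1w_ae (u v : 'rV[R]_n -> R) : measurable_fun Omega u ->
  mu.-integrable setT (EFin \o v) -> {ae mu, forall x, wq u x = v x} -> inL1w Omega gamma u.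
Proof.
move=> mu_ iv uv; apply/(inL1wP n_gt0 domOmega gamma01); split => //.
have mwu : measurable_fun setT (wq u) by exact: measurable_weight_quotient.
have /integrableP[/measurable_EFinP mv iv'] := iv.
apply/integrableP; split; first exact/measurable_EFinP.
rewrite (_ : (\int[mu]_x _ = \int[mu]_x `|(EFin \o v) x|)%E)//.
apply: ae_eq_integral => //.
- by apply: measurableT_comp => //; exact/measurable_EFinP.
- by apply: measurableT_comp => //; exact/measurable_EFinP.
by apply: filterS uv => x E _; rewrite /= E.
Qed.

Local Notation lim_u := (green Omega G f + martin Omega gamma G h).

Let lim_uE x : Omega x -> lim_u x = w x * (pot1 x + pot2 x).
Proof. by move=> Ox; rewrite mulrDr -green_potential// -martin_potential. Qed.

Let measurable_lim : measurable_fun Omega lim_u.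
Proof.
have m1 : measurable_fun setT pot1 by have /integrableP[/measurable_EFinP] := ipot1.
have m2 : measurable_fun setT pot2 by have /integrableP[/measurable_EFinP] := ipot2.
apply: (eq_measurable_fun (fun x => w x * (pot1 x + pot2 x))).
  by move=> x /set_mem Ox; rewrite lim_uE.
by apply: measurable_funTS; apply: measurable_funM => //; exact: measurable_funD.
Qed.

Let wq_lim : {ae mu, forall x, wq lim_u x = pot1 x + pot2 x}.
Proof.
apply: filterS (ae_weighted_domain n_gt0 domOmega gamma01) => x Ox.
rewrite weight_quotient_in// lim_uE// mulrC.
by rewrite mulKf// gt_eqF// w0.
Qed.

Let wq_par t : 0 < t -> {ae mu, forall x,
  wq (par t) x = ht t (cf (wq u0)) x + pp1 t x + pp2 t x}.
Proof.
move=> t0; apply: filterS3 (source_part (ltW t0)) (semigroup_inL1w n_gt0 domOmega gamma01 onb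
  heatS b_ge0 eta_bounded b_sum t0 u0L1) (ae_weighted_domain n_gt0 domOmega gamma01) => x E1 E2 Ox.
have WQ v : wq v x = v x / w x by exact: weight_quotient_in.
have EP : par t x = S t u0 x + w x * pp1 t x + w x * pp2 t x.
  by rewrite /parabolic E1 (boundary_part (ltW t0) Ox).
rewrite -E2 !WQ EP; have := w0 Ox.
move: (S t u0 x) (w x) (pp1 t x) (pp2 t x) => p q r v q0.
by field; rewrite gt_eqF.
Qed.

Let decay (t : R) : R := expR (- lam 0%N * (t - 1)) *
  (\int[mu]_y `|wq u0 y| * dirichlet lam 1 (fun k => b k ^+ 2)).

Let heat_decay t x : 1 <= t -> `|ht t (cf (wq u0)) x| <= decay t.
Proof.
move=> t1; apply: (dirichlet_decay lam_ge b_sum) => //.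
  by apply: Rintegral_ge0.
by apply: (heat_term_le eta_bounded) => k; exact: (coef_le meta eta_bounded).
Qed.

Let decay_cvg : (decay t * fine (mu setT)) @[t --> +oo] --> 0.
Proof.
rewrite -(mul0r (fine (mu setT))); apply: cvgM; last exact: cvg_cst.
rewrite /decay; set A := _ * dirichlet _ _ _; rewrite -(mul0r A).
apply: cvgM; last exact: cvg_cst.
have hh : lam 0%N * (t - 1) @[t --> +oo] --> +oo.
  apply/cvgryPge => B; exists (B / lam 0%N + 1); split; first exact: num_real.
  move=> t /= tB; rewrite mulrC -ler_pdivrMr// lerBrDr.
  exact: ltW.
have := cvg_comp _ _ hh (@cvgr_expR R).
by apply: cvg_trans; apply: near_eq_cvg; apply: nearW => t /=; rewrite mulNr.
Qed.

Let integrable_heat t : 0 < t -> mu.-integrable setT (EFin \o ht t (cf (wq u0))).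
Proof.
move=> t0; have cA k : `|cf (wq u0) k| <= \int[mu]_y `|wq u0 y| * b k.
  exact: (coef_le meta eta_bounded).
apply: (bounded_integrable mu (measurable_heat b_sum meta eta_bounded cA t0)).
by move=> y; exact: (heat_bounded b_sum eta_bounded y cA t0).
Qed.

Theorem parabolic_cvgL1w : cvgL1w Omega gamma
  (parabolic Omega gamma lambda phi S u0 (fun=> f) (fun=> h)) lim_u.
Proof.
have par_near : \forall t \near +oo, (1 : R) <= t.
  by exists 1; split; [exact: num_real|move=> t /ltW].
split.
- exact: inL1w_ae measurable_lim (integrable_Radd measurableT ipot1 ipot2) wq_lim.
- apply: filterS par_near => t t1; have t0 : 0 < t by exact: lt_le_trans t1.
  apply: inL1w_ae (measurable_par (ltW t0)) _ (wq_par t0).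
  apply: integrable_Radd (ipp2 (ltW t0)) => //.
  by apply: integrable_Radd (ipp1 (ltW t0)) => //; exact: integrable_heat.
(* The three errors come from the initial datum, the source and the boundary data. *)
pose U (t : R) := ((decay t * fine (mu setT))%:E +
  (\int[mu]_x (`|pp1 t x - pot1 x|)%:E + \int[mu]_x (`|pp2 t x - pot2 x|)%:E))%E.
have U0 : U t @[t --> +oo] --> 0%E.
  have d0 : (decay t * fine (mu setT))%:E @[t --> +oo] --> 0%E.
    by apply: cvg_EFin; [exact: nearW|exact: decay_cvg].
  have z0 : ((0 : \bar R) +? 0)%E by [].
  have h12 : (\int[mu]_x (`|pp1 t x - pot1 x|)%:E + \int[mu]_x (`|pp2 t x - pot2 x|)%:E)%E
      @[t --> +oo] --> (0 + 0)%E by exact: cvgeD z0 pp1_cvg pp2_cvg.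
  rewrite adde0 in h12.
  have : U t @[t --> +oo] --> (0 + 0)%E by exact: cvgeD z0 d0 h12.
  by rewrite adde0.
apply: (squeeze_cvge _ (cvg_cst 0%E) U0).
apply: filterS par_near => t t1; have t0 : 0 < t by exact: lt_le_trans t1.
rewrite Lnorm_ge0/=.
have mdiff : measurable_fun Omega (par t - lim_u).
  exact: measurable_funB (measurable_par (ltW t0)) measurable_lim.
rewrite (normL1w_weight n_gt0 domOmega gamma01 mdiff).
have m1 : measurable_fun setT (fun x => pp1 t x - pot1 x).
  by have /integrableP[/measurable_EFinP] := integrable_Rsub measurableT (ipp1 (ltW t0)) ipot1.
have m2 : measurable_fun setT (fun x => pp2 t x - pot2 x).
  by have /integrableP[/measurable_EFinP] := integrable_Rsub measurableT (ipp2 (ltW t0)) ipot2.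
have n1 : measurable_fun setT (fun x => `|pp1 t x - pot1 x|) by exact: measurableT_comp.
have n2 : measurable_fun setT (fun x => `|pp2 t x - pot2 x|) by exact: measurableT_comp.
have n12 := measurable_funD n1 n2.
have d0 : 0 <= decay t by exact: le_trans (normr_ge0 _) (heat_decay 0 t1).
apply: (@le_trans _ _ (\int[mu]_x (decay t + (`|pp1 t x - pot1 x| + `|pp2 t x - pot2 x|))%:E)%E).
  apply: ae_ge0_le_integral => //.
  - apply/measurable_EFinP; apply: measurableT_comp => //.
    exact: (measurable_weight_quotient gamma n_gt0 domOmega mdiff).
  - by move=> x _; rewrite lee_fin !addr_ge0.
  - by apply/measurable_EFinP; apply: measurable_funD; [exact: measurable_cst|exact: n12].
  apply: filterS2 wq_lim (wq_par t0) => x E1 E2 _.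
  rewrite lee_fin weight_quotientB E1 E2.
  have := heat_decay x t1.
  move: (ht _ _ _) (pp1 _ _) (pp2 _ _) (pot1 _) (pot2 _) (decay t) => p q r v z D hp.
  rewrite (_ : p + q + r - (v + z) = p + ((q - v) + (r - z))); last by ring.
  apply: le_trans (ler_normD _ _) _; apply: lerD => //; exact: ler_normD.
have E1 : (\int[mu]_x (decay t + (`|pp1 t x - pot1 x| + `|pp2 t x - pot2 x|))%:E =
    \int[mu]_x (decay t)%:E + \int[mu]_x (`|pp1 t x - pot1 x| + `|pp2 t x - pot2 x|)%:E)%E.
  apply: (@ge0_integralD _ _ _ mu setT measurableT (fun=> (decay t)%:E)
    (fun x => (`|pp1 t x - pot1 x| + `|pp2 t x - pot2 x|)%:E)).
  - by move=> x _; rewrite lee_fin.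
  - exact: measurable_cst.
  - by move=> x _; rewrite lee_fin addr_ge0.
  - by apply/measurable_EFinP; exact: n12.
have E2 : (\int[mu]_x (`|pp1 t x - pot1 x| + `|pp2 t x - pot2 x|)%:E =
    \int[mu]_x (`|pp1 t x - pot1 x|)%:E + \int[mu]_x (`|pp2 t x - pot2 x|)%:E)%E.
  apply: (@ge0_integralD _ _ _ mu setT measurableT (fun x => (`|pp1 t x - pot1 x|)%:E)
    (fun x => (`|pp2 t x - pot2 x|)%:E)).
  - by move=> x _; rewrite lee_fin normr_ge0.
  - by apply/measurable_EFinP; exact: n1.
  - by move=> x _; rewrite lee_fin normr_ge0.
  - by apply/measurable_EFinP; exact: n2.
rewrite E1 E2 /U; apply: leeD => //.
by rewrite integral_cst// [leRHS]EFinM fineK ?fin_num_measure.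
Qed.

End limit.

(** * Continuous extension of the eigenfunction quotients to the boundary *)

Section extension.
Context {R : realType} {n : nat} (Omega : set 'rV[R]_n) (gamma : R)
  (G : 'rV[R]_n -> 'rV[R]_n -> \bar R)
  (lambda : nat -> R) (phi : nat -> 'rV[R]_n -> R) (b : R^nat).
Hypotheses (n_gt0 : (0 < n)%N) (domOmega : bounded_domain Omega)
  (eigG : eigen_decomposition Omega G lambda phi)
  (G_regularizing : forall u, inLinfw Omega gamma u -> inCw Omega gamma (green Omega G u))
  (eta_bounded : forall k x, `|eigen_quotient Omega gamma phi k x| <= b k).
Local Notation eta := (eigen_quotient Omega gamma phi).

(** [phi k] is [lambda k] times its own Green potential. Boundedness of [eta k] puts [phi k] into
    the space that the Green operator maps to functions with a quotient continuous up to the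
    boundary. *)
Lemma eigen_quotient_extension : exists ext : nat -> 'rV[R]_n -> R,
  (forall k y, Omega y -> eta k x @[x --> y] --> eta k y) /\
  (forall k z, closure Omega z ->
    eta k x @[x --> boundary_filter Omega z] --> ext k z).
Proof.
have h k : exists v : 'rV[R]_n -> R, {within closure Omega, continuous v} /\
    forall x, Omega x -> eta k x = v x.
  have mphik := measurable_phi domOmega eigG k.
  have [v cv gv] := G_regularizing
    (inLinfw_bounded n_gt0 domOmega mphik (eta_bounded k)).
  exists (fun x => lambda k * v x); split.
    by move=> x; apply: cvgM; [exact: cvg_cst|exact: cv].
  move=> x Ox; have [_ _ _ _ /(_ k x Ox) E] := eigG.
  have lk := lambda_gt0 eigG k; have wx := dist_weight_gt0 gamma n_gt0 domOmega Ox.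
  rewrite /eigen_quotient weight_quotient_in//.
  have := gv x Ox; rewrite E -[delta Omega x `^ gamma]/(dist_weight Omega gamma x).
  move: (phi k x) (dist_weight _ _ _) (v x) (lambda k) lk wx => p q r l l0 q0 E'.
  have -> : p = l * (q * r) by rewrite -E' mulrA divff ?mul1r// gt_eqF.
  by field; rewrite gt_eqF.
have [ext extP] := choice h.
have ext_cvg k z : closure Omega z ->
    eta k x @[x --> boundary_filter Omega z] --> ext k z.
  move=> cz; have [cv ev] := extP k.
  move=> P /= Pz; have := (subspace_continuousP _ _).1 cv z cz P Pz.
  move=> H; have H' : nbhs z [set x | closure Omega x -> P (ext k x)] by exact: H.
  suff : nbhs z [set x | Omega x -> P (eta k x)] by exact.
  apply: filterS H' => x Px Ox; rewrite ev//; apply: Px; exact: subset_closure.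
exists ext; split => // k y Oy.
have oO : open Omega by case: domOmega.
have [_ ev] := extP k.
move=> P /= Py; rewrite (ev _ Oy) in Py.
have h1 : nbhs y [set x | Omega x -> P (eta k x)].
  exact: (ext_cvg k y (subset_closure Oy) P Py).
have h2 : nbhs y Omega by exact: open_nbhs_nbhs (conj oO Oy).
suff : nbhs y [set x | P (eta k x)] by exact.
by apply: filterS2 h2 h1 => x Ox; exact.
Qed.

End extension.

Theorem theorem10p1 (R : realType) (n : nat) (s gamma : R)
    (Omega : set 'rV[R]_n) (G : 'rV[R]_n -> 'rV[R]_n -> \bar R)
    (lambda : nat -> R) (phi : nat -> 'rV[R]_n -> R)
    (S : R -> ('rV[R]_n -> R) -> 'rV[R]_n -> R)
    (s01 : 0 < s < 1) (gamma01 : 0 < gamma <= 1) (n2s : 2 * s < n%:R)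
    (domOmega : bounded_domain Omega)
    (kernG : nonneg_kernel Omega G)
    (L2G : green_operatorL2 Omega G)
    (eigG : eigen_decomposition Omega G lambda phi)
    (heatS : heat_semigroup Omega gamma lambda phi S)
    (G_two_sided : exists c C : R, [/\ 0 < c, 0 < C &
       forall x y, Omega x -> Omega y -> x != y ->
         G x y = G y x /\
         ((c * comparison_kernel Omega gamma s x y)%:E <= G x y
            <= (C * comparison_kernel Omega gamma s x y)%:E)%E])
    (G_regularizing :
       continuous_operator (inLinfw Omega gamma) (normLinfw Omega gamma)
                           (inCw Omega gamma) (normCw Omega gamma)
                           (green Omega G))
    (S_submarkov : forall (t : R) (u0 : 'rV[R]_n -> R), 0 <= t ->
       measurable_fun Omega u0 ->
       {ae lebesgue_rV R n, forall x, Omega x -> 0 <= u0 x <= 1} ->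
       {ae lebesgue_rV R n, forall x, Omega x -> 0 <= S t u0 x <= 1})
    (G_trace : forall z y, frontier Omega z -> Omega y ->
       cvg (boundary_quotient Omega gamma (fun x => fine (G x y)) x
              @[x --> boundary_filter Omega z]))
    (u0 f h : 'rV[R]_n -> R)
    (u0L1 : inL1w Omega gamma u0) (fL1 : inL1w Omega gamma f)
    (hL1 : surface_measure.-integrable (frontier Omega) (EFin \o h)) :
  cvgL1w Omega gamma
    (parabolic Omega gamma lambda phi S u0 (fun=> f) (fun=> h))
    (green Omega G f + martin Omega gamma G h).
Proof.
have [s0 _] := andP s01.
have n_gt0 : (0 < n)%N.
  by rewrite -(ltr0n R); apply: lt_trans n2s; rewrite mulr_gt0.
have [c0 [C0 [c0_gt0 C0_gt0 G2]]] := G_two_sided.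
have [C1 [M [C1_ge0 excess_le]]] :=
  singular_bound_excess n_gt0 domOmega s0 gamma01 n2s C0_gt0.
have [b [b_ge0 eta_bounded b_sum]] :=
  eigen_quotient_growth n2s kernG C0_gt0 G2 eigG C1_ge0 excess_le.
have [ext [ceta ext_cvg]] :=
  eigen_quotient_extension n_gt0 domOmega eigG G_regularizing.1 eta_bounded.
exact: (parabolic_cvgL1w n2s kernG c0_gt0 C0_gt0 G2 eigG heatS S_submarkov G_trace
  C1_ge0 excess_le b_ge0 eta_bounded b_sum ceta ext_cvg u0L1 fL1 hL1).
Qed.
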